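(* Fix $\alpha>0$ and $\rho>0$. Then there exist constants $L_0,\rho^*,C_1>0$ such that for all $L\ge L_0$ and all initial conditions $x(0)\in\mathcal{B}_{L,\rho}$ the following holds, with $T:=\alpha L^{2k-3}$: (i) $x(t)\in\mathcal{B}_{L,\rho^*}$ for all $0\le t\le T$; (ii) $H(x(T))-H(x(0))\le -C_1\,\dfrac{T}{L^{4k-6}}$.
   Context: Fix integers $n\ge 2$ and $k$ with $2\le k\le n$. The phase space is $\Omega=\mathbb{R}^n\times\mathbb{T}^n$, with $\mathbb{T}=\mathbb{R}/2\pi\mathbb{Z}$, with points $x=(\mathbf{I},\boldsymbol{\phi})$, $\mathbf{I}=(I_1,\dots,I_n)$, $\boldsymbol{\phi}=(\phi_1,\dots,\phi_n)$. For $i=1,\dots,n-1$, $U_i:\mathbb{T}\to\mathbb{R}$ is a real smooth function whose Fourier series contains only finitely many modes, has no constant mode, and which is non-degenerate: there is no $\phi\in\mathbb{T}$ with $U_i'(\phi)=U_i''(\phi)=0$. The Hamiltonian is $H(\mathbf{I},\boldsymbol{\phi})=\frac12\sum_{i=1}^n I_i^2+\sum_{i=1}^{n-1}U_i(\phi_{i+1}-\phi_i)$. Fix $\gamma>0$; $x(t)$ denotes the solution of $\dot I_i=-\partial_{\phi_i}H-\delta_{i,1}\gamma I_1$, $\dot\phi_i=\partial_{I_i}H$ ($i=1,\dots,n$). For $L,\rho>0$, $\mathcal{B}_{L,\rho}=\{(\mathbf{I},\boldsymbol{\phi})\in\Omega:\ |I_i-L\delta_{i,k}|<\rho,\ i=1,\dots,n\}$.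 *)

(* Defs.v *)
From Stdlib Require Import Reals Lra Arith.
From Coquelicot Require Import Coquelicot.
Open Scope R_scope.

(* Indices are 0-based: the paper's I_i, phi_i (i = 1..n) are  I (i-1), phi (i-1),
   and the paper's U_i (i = 1..n-1) is  U (i-1).  Angles are represented by
   real lifts (all objects below are 2*pi-periodic in the angles). *)

Fixpoint fsum (M : nat) (f : nat -> R) : R :=
  match M with
  | O => 0
  | S M' => fsum M' f + f M'
  end.

Definition finite_modes_no_const (U : R -> R) : Prop :=
  exists (M : nat) (a b : nat -> R), forall th : R,
    U th = fsum M (fun m => a (S m) * cos (INR (S m) * th) + b (S m) * sin (INR (S m) * th)).

Definition nondegenerate (U : R -> R) : Prop :=
  ~ exists th : R, Derive U th = 0 /\ Derive (Derive U) th = 0.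

Definition Ham (n : nat) (U : nat -> R -> R) (I phi : nat -> R) : R :=
  / 2 * fsum n (fun i => I i ^ 2) + fsum (n - 1) (fun i => U i (phi (S i) - phi i)).

Definition upd (v : nat -> R) (j : nat) (s : R) : nat -> R :=
  fun m => if Nat.eqb m j then s else v m.

Definition dH_dI (n : nat) (U : nat -> R -> R) (I phi : nat -> R) (j : nat) : R :=
  Derive (fun s => Ham n U (upd I j s) phi) (I j).
Definition dH_dphi (n : nat) (U : nat -> R -> R) (I phi : nat -> R) (j : nat) : R :=
  Derive (fun s => Ham n U I (upd phi j s)) (phi j).

Definition solves (n : nat) (U : nat -> R -> R) (gamma : R)
    (I phi : R -> nat -> R) (T : R) : Prop :=
  forall t, 0 <= t <= T -> forall j, (j < n)%nat ->
    is_derive (fun s => I s j) t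
      (- dH_dphi n U (I t) (phi t) j - (if Nat.eqb j 0 then gamma * I t 0%nat else 0))
    /\ is_derive (fun s => phi s j) t (dH_dI n U (I t) (phi t) j).

(* B_{L,rho}: |I_i - L delta_{i,k}| < rho for all i = 1..n (paper's index k is 0-based k-1) *)
Definition inB (n k : nat) (L rho : R) (I : nat -> R) : Prop :=
  forall i, (i < n)%nat -> Rabs (I i - (if Nat.eqb i (k - 1) then L else 0)) < rho.

(* Main.v *)
Require Import Defs.
From Stdlib Require Import Reals Lra Lia ZArith List Arith Classical.
From Stdlib Require Import Ranalysis5 IndefiniteDescription.
From Coquelicot Require Import Coquelicot.
Import ListNotations.
Open Scope R_scope.

(** Write J for the fast action, [kap] = k - 1 for its 0-based site.

    (i) Since the potentials are trigonometric polynomials, a formal canonical transformation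
    (Deprit's Lie series in the algebra of trigonometric polynomials with coefficients in the
    actions and 1/J) removes the fast angle from H to any order in 1/J, and pulling J back gives
    an adiabatic invariant X = J + V/J + O(1/J^2).  The friction at site 0 enters X' only at
    order J^(-2 kap), because each order reaches one variable further down the chain.  Truncated at
    order 2 kap + 1, X loses over the time alpha L^(2 kap - 1) at most o(1/L), up to a term controlled
    by the decay of H; hence J loses at most D/L with D independent of the a priori bound on the
    slow actions.  As H decreases, the slow sites then keep a bounded energy.

    (ii) H' = - gamma I_0^2.  On a unit time window, either I_0 is somewhere of order one, or it
    is uniformly small, and then so are, site after site, all slow forces; by nondegeneracy the
    stiffnesses U_i'' along the slow bonds are bounded below.  The time derivative of order 2 kap
    of I_0 equals J times the product of the stiffnesses up to O(1), so about L times per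
    unit of time it has size L during a time of order 1/L, which forces |I_0| to be of order
    L^(1 - 2 kap) on a comparable interval. *)

(** * Finite sums and products *)

(** The scale 1/L is forced: since the fast kinetic energy is J^2/2, a loss D/L of J releases an
    energy of order one into the slow sites. If D grew with the assumed bound r on the slow actions,
    the bootstrap would be circular. The correction V/J at both ends of the time span is harmless,
    because the slow kinetic energies carry no fast angle and drop out of V. The friction term is
    not: it has size |I_0| L^(-2 kap) during a time L^(2 kap - 1), so bounding |I_0| by r would give
    r/L. Young's inequality splits it into a part free of I_0 and a multiple of I_0^2, which is paid
    for by the energy that friction itself removes.

    Order in 1/J and reach along the chain are properties of single terms, so the canonical
    transformation is carried out on lists of terms. Algebraic identities, Jacobi's included, are
    then claimed only for the functions represented, on the half-space J > 0. The transformation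
    treats the Hamiltonian part alone; friction is applied to the finished invariant. The only fast
    frequency is J, so no small divisors occur. *)

Lemma fsum_ext n f g : (forall i, (i < n)%nat -> f i = g i) -> fsum n f = fsum n g.
Proof.
  induction n as [|n IH]; intros H; simpl; [easy|].
  rewrite IH, H; auto.
Qed.

Lemma fsum_plus n f g : fsum n (fun i => f i + g i) = fsum n f + fsum n g.
Proof. induction n as [|n IH]; simpl; [ring|]. rewrite IH; ring. Qed.

Lemma fsum_opp n f : fsum n (fun i => - f i) = - fsum n f.
Proof. induction n as [|n IH]; simpl; [ring|]. rewrite IH; ring. Qed.

Lemma fsum_minus n f g : fsum n (fun i => f i - g i) = fsum n f - fsum n g.
Proof. induction n as [|n IH]; simpl; [ring|]. rewrite IH; ring. Qed.

Lemma fsum_scal n c f : fsum n (fun i => c * f i) = c * fsum n f.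
Proof. induction n as [|n IH]; simpl; [ring|]. rewrite IH; ring. Qed.

Lemma fsum_zero n f : (forall i, (i < n)%nat -> f i = 0) -> fsum n f = 0.
Proof.
  intros H; rewrite (fsum_ext n f (fun _ => 0)) by easy.
  clear H; induction n as [|n IH]; simpl; lra.
Qed.

Lemma fsum_delta n j f : (j < n)%nat ->
  fsum n (fun i => if Nat.eqb i j then f i else 0) = f j.
Proof.
  induction n as [|n IH]; intros Hj; [lia|]; simpl.
  destruct (Nat.eq_dec j n) as [->|Hne].
  - rewrite Nat.eqb_refl, fsum_zero; [ring|].
    intros i Hi. replace (Nat.eqb i n) with false; [easy|].
    symmetry; apply Nat.eqb_neq; lia.
  - rewrite IH by lia. replace (Nat.eqb n j) with false; [ring|].
    symmetry; apply Nat.eqb_neq; lia.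
Qed.

Lemma fsum_swap n p f :
  fsum n (fun i => fsum p (fun j => f i j)) = fsum p (fun j => fsum n (fun i => f i j)).
Proof.
  induction n as [|n IH]; simpl.
  - rewrite fsum_zero; easy.
  - rewrite IH, <- fsum_plus; easy.
Qed.

Lemma fsum_split_first n f : fsum (S n) f = f 0%nat + fsum n (fun i => f (S i)).
Proof.
  induction n as [|n IH]; [simpl; ring|].
  change (fsum (S n) f + f (S n) = f 0%nat + (fsum n (fun i => f (S i)) + f (S n))).
  rewrite IH; ring.
Qed.

Lemma fsum_le n f g : (forall i, (i < n)%nat -> f i <= g i) -> fsum n f <= fsum n g.
Proof.
  induction n as [|n IH]; intros H; simpl; [lra|].
  apply Rplus_le_compat; auto.
Qed.

Lemma fsum_const n c : fsum n (fun _ => c) = INR n * c.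
Proof.
  induction n as [|n IH]; [simpl; ring|]. rewrite S_INR; simpl fsum; rewrite IH; ring.
Qed.

Lemma fsum_nonneg n f : (forall i, (i < n)%nat -> 0 <= f i) -> 0 <= fsum n f.
Proof.
  intros H. rewrite <- (fsum_zero n (fun _ => 0)) by easy. now apply fsum_le.
Qed.

Lemma is_derive_Rconst (c t : R) : is_derive (fun _ : R => c) t 0.
Proof. apply (is_derive_const (K := R_AbsRing) (V := R_NormedModule)). Qed.

Lemma is_derive_Rplus (f g : R -> R) (t a b : R) : is_derive f t a -> is_derive g t b ->
  is_derive (fun s => f s + g s) t (a + b).
Proof. apply (is_derive_plus (K := R_AbsRing) (V := R_NormedModule) f g t a b). Qed.

Lemma is_derive_Rmult (f g : R -> R) (t a b : R) : is_derive f t a -> is_derive g t b ->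
  is_derive (fun s => f s * g s) t (a * g t + f t * b).
Proof.
  intros Hf Hg. apply (is_derive_mult f g t a b Hf Hg). intros; apply Rmult_comm.
Qed.

Lemma is_derive_fsum n (f : nat -> R -> R) (d : nat -> R) t :
  (forall i, (i < n)%nat -> is_derive (f i) t (d i)) ->
  is_derive (fun s => fsum n (fun i => f i s)) t (fsum n d).
Proof.
  induction n as [|n IH]; intros H; simpl.
  - apply is_derive_Rconst.
  - apply (is_derive_Rplus (fun s => fsum n (fun i => f i s)) (f n)); auto.
Qed.

Fixpoint fprod (n : nat) (f : nat -> R) : R :=
  match n with
  | O => 1
  | S n' => fprod n' f * f n'
  end.

Lemma fprod_ext n f g : (forall i, (i < n)%nat -> f i = g i) -> fprod n f = fprod n g.
Proof.
  induction n as [|n IH]; intros H; simpl; [easy|].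
  rewrite IH, H; auto.
Qed.

Lemma fprod_mult n f g : fprod n (fun i => f i * g i) = fprod n f * fprod n g.
Proof. induction n as [|n IH]; simpl; [ring|]. rewrite IH; ring. Qed.

Lemma fprod_one n f : (forall i, (i < n)%nat -> f i = 1) -> fprod n f = 1.
Proof.
  induction n as [|n IH]; intros H; simpl; [easy|].
  rewrite IH, H; auto; ring.
Qed.

Lemma fprod_split n j f : (j < n)%nat ->
  fprod n f = f j * fprod n (fun i => if Nat.eqb i j then 1 else f i).
Proof.
  induction n as [|n IH]; intros Hj; [lia|]; simpl.
  destruct (Nat.eq_dec j n) as [->|Hne].
  - rewrite Nat.eqb_refl.
    rewrite (fprod_ext n (fun i => if Nat.eqb i n then 1 else f i) f); [ring|].
    intros i Hi. replace (Nat.eqb i n) with false; [easy|].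
    symmetry; apply Nat.eqb_neq; lia.
  - rewrite IH by lia. replace (Nat.eqb n j) with false; [ring|].
    symmetry; apply Nat.eqb_neq; lia.
Qed.

Lemma is_derive_fprod n (f : nat -> R -> R) (d : nat -> R) t :
  (forall i, (i < n)%nat -> is_derive (f i) t (d i)) ->
  is_derive (fun s => fprod n (fun i => f i s)) t
    (fsum n (fun j => d j * fprod n (fun i => if Nat.eqb i j then 1 else f i t))).
Proof.
  induction n as [|n IH]; intros H; simpl.
  - apply is_derive_Rconst.
  - evar_last.
    + apply (is_derive_Rmult (fun s => fprod n (fun i => f i s)) (f n) t).
      * apply IH; auto.
      * apply H; lia.
    + cbv beta. rewrite Nat.eqb_refl.
      rewrite (fprod_ext n (fun i => if Nat.eqb i n then 1 else f i t) (fun i => f i t)).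
      2:{ intros i Hi. replace (Nat.eqb i n) with false; [easy|].
          symmetry; apply Nat.eqb_neq; lia. }
      rewrite Rmult_1_r. f_equal; [|ring].
      rewrite Rmult_comm, <- fsum_scal. apply fsum_ext; intros j Hj.
      replace (Nat.eqb n j) with false; [ring|].
      symmetry; apply Nat.eqb_neq; lia.
Qed.

(** * Trigonometric polynomials with powers of the fast action *)

(* [Term c m a q d] stands for  c * J^(-m) * prod_{i <> kap} I_i^(a i) * cos (q.phi + d),
   where J = I_kap is the fast action.  The phase [d] makes the family closed under
   differentiation and integration in the angles without separate sine terms. *)
Record term := Term {
  tc : R; tm : Z; ta : nat -> nat; tq : nat -> Z; td : R }.

Definition tpoly := list term.

Section Algebra.
Variables n kap : nat.

(** [Rpower] admits every integer exponent of J and turns products into sums of exponents, but it is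
    a power only for a positive base. Hence the hypothesis J > 0 wherever derivatives or explicit
    values are taken. *)
Definition factor (t : term) (I : nat -> R) (i : nat) : R :=
  if Nat.eqb i kap then Rpower (I i) (IZR (- tm t)) else I i ^ ta t i.

Definition phase (t : term) (phi : nat -> R) : R :=
  fsum n (fun i => IZR (tq t i) * phi i) + td t.

Definition tval (t : term) (I phi : nat -> R) : R :=
  tc t * fprod n (factor t I) * cos (phase t phi).

Definition peval (f : tpoly) (I phi : nat -> R) : R :=
  fold_right (fun t s => tval t I phi + s) 0 f.

(** A derivative that vanishes identically gives the empty list, not a term with coefficient 0: the
    later estimates of order and locality speak about every term that occurs. *)
Definition dI_term (j : nat) (t : term) : tpoly :=
  if Nat.eqb j kap then
    if Z.eqb (tm t) 0 then []
    else [Term (tc t * IZR (- tm t)) (tm t + 1) (ta t) (tq t) (td t)]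
  else
    if Nat.eqb (ta t j) 0 then []
    else [Term (tc t * INR (ta t j)) (tm t)
            (fun i => if Nat.eqb i j then (ta t i - 1)%nat else ta t i) (tq t) (td t)].

Definition dphi_term (j : nat) (t : term) : tpoly :=
  if Z.eqb (tq t j) 0 then []
  else [Term (tc t * IZR (tq t j)) (tm t) (ta t) (tq t) (td t + PI / 2)].

Definition pdI (j : nat) (f : tpoly) : tpoly := flat_map (dI_term j) f.
Definition dphi (j : nat) (f : tpoly) : tpoly := flat_map (dphi_term j) f.

(** Product-to-sum formula: cos u cos v is half of cos (u + v) + cos (u - v). *)
Definition mul_term (t s : term) : tpoly :=
  [Term (tc t * tc s / 2) (tm t + tm s) (fun i => (ta t i + ta s i)%nat)
     (fun i => (tq t i + tq s i)%Z) (td t + td s);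
   Term (tc t * tc s / 2) (tm t + tm s) (fun i => (ta t i + ta s i)%nat)
     (fun i => (tq t i - tq s i)%Z) (td t - td s)].

Definition pmul (f g : tpoly) : tpoly := flat_map (fun t => flat_map (mul_term t) g) f.

Definition scal_term (c : R) (t : term) : term :=
  Term (c * tc t) (tm t) (ta t) (tq t) (td t).
Definition pscal (c : R) (f : tpoly) : tpoly := map (scal_term c) f.

Fixpoint lsum (p : nat) (F : nat -> tpoly) : tpoly :=
  match p with
  | O => []
  | S p' => lsum p' F ++ F p'
  end.

(** The Poisson bracket, with the sign for which f' = {f, H} along phi' = dH/dI, I' = - dH/dphi. *)
Definition pbr (f g : tpoly) : tpoly :=
  lsum n (fun j => pmul (dphi j f) (pdI j g) ++ pscal (-1) (pmul (pdI j f) (dphi j g))).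

Lemma eval_app f g I phi : peval (f ++ g) I phi = peval f I phi + peval g I phi.
Proof. induction f as [|t f IH]; simpl; [ring|]. unfold peval in *; rewrite IH; ring. Qed.

Lemma eval_cons t f I phi : peval (t :: f) I phi = tval t I phi + peval f I phi.
Proof. reflexivity. Qed.

Lemma eval_scal c f I phi : peval (pscal c f) I phi = c * peval f I phi.
Proof.
  induction f as [|t f IH]; [simpl; ring|].
  change (pscal c (t :: f)) with (scal_term c t :: pscal c f).
  rewrite !eval_cons, IH.
  replace (tval (scal_term c t) I phi) with (c * tval t I phi); [ring|].
  unfold tval, scal_term; simpl. change (phase (Term (c * tc t) (tm t) (ta t) (tq t) (td t)) phi) with (phase t phi).
  change (fprod n (factor (Term (c * tc t) (tm t) (ta t) (tq t) (td t)) I)) with (fprod n (factor t I)).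
  ring.
Qed.

Lemma eval_lsum p F I phi : peval (lsum p F) I phi = fsum p (fun l => peval (F l) I phi).
Proof. induction p as [|p IH]; simpl; [easy|]. rewrite eval_app, IH; easy. Qed.

Lemma eval_flat_map_ext (h : term -> tpoly) (g : term -> R) f I phi :
  (forall t, peval (h t) I phi = g t) ->
  peval (flat_map h f) I phi = fold_right (fun t s => g t + s) 0 f.
Proof.
  intros H; induction f as [|t f IH]; simpl; [easy|].
  rewrite eval_app, H, IH; easy.
Qed.

Lemma eval_mul_term t s I phi :
  peval (mul_term t s) I phi = tval t I phi * tval s I phi.
Proof.
  unfold mul_term. rewrite !eval_cons. unfold peval; simpl. unfold tval; simpl.
  set (P1 := fprod n (factor (Term _ _ _ (fun i => (tq t i + tq s i)%Z) _) I)).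
  set (P2 := fprod n (factor (Term _ _ _ (fun i => (tq t i - tq s i)%Z) _) I)).
  assert (E1 : P1 = fprod n (factor t I) * fprod n (factor s I)).
  { unfold P1. rewrite <- fprod_mult. apply fprod_ext; intros i Hi.
    unfold factor; simpl. destruct (Nat.eqb i kap).
    - rewrite <- Rpower_plus. f_equal. rewrite <- plus_IZR. f_equal. lia.
    - apply pow_add. }
  change P2 with P1. rewrite E1.
  assert (E3 : phase (Term (tc t * tc s / 2) (tm t + tm s) (fun i => (ta t i + ta s i)%nat)
     (fun i => (tq t i + tq s i)%Z) (td t + td s)) phi = phase t phi + phase s phi).
  { unfold phase; simpl.
    rewrite (fsum_ext n _ (fun i => IZR (tq t i) * phi i + IZR (tq s i) * phi i)).
    - rewrite fsum_plus; ring.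
    - intros; rewrite plus_IZR; ring. }
  assert (E4 : phase (Term (tc t * tc s / 2) (tm t + tm s) (fun i => (ta t i + ta s i)%nat)
     (fun i => (tq t i - tq s i)%Z) (td t - td s)) phi = phase t phi - phase s phi).
  { unfold phase; simpl.
    rewrite (fsum_ext n _ (fun i => IZR (tq t i) * phi i - IZR (tq s i) * phi i)).
    - rewrite fsum_minus; ring.
    - intros; rewrite minus_IZR; ring. }
  rewrite E3, E4, cos_plus, cos_minus. field.
Qed.

Lemma eval_mul f g I phi : peval (pmul f g) I phi = peval f I phi * peval g I phi.
Proof.
  unfold pmul. rewrite (eval_flat_map_ext _ (fun t => tval t I phi * peval g I phi)).
  - induction f as [|t f IH]; simpl; [ring|]. rewrite IH; fold (peval f I phi); ring.
  - intros t. rewrite (eval_flat_map_ext _ (fun s => tval t I phi * tval s I phi)).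
    + induction g as [|s g IH]; simpl; [ring|]. rewrite IH; fold (peval g I phi); ring.
    + intros s; apply eval_mul_term.
Qed.

Lemma eval_br f g I phi : peval (pbr f g) I phi =
  fsum n (fun j => peval (dphi j f) I phi * peval (pdI j g) I phi
                 - peval (pdI j f) I phi * peval (dphi j g) I phi).
Proof.
  unfold pbr. rewrite eval_lsum. apply fsum_ext; intros j Hj.
  rewrite eval_app, eval_scal, !eval_mul; ring.
Qed.

Lemma dI_app j f g : pdI j (f ++ g) = pdI j f ++ pdI j g.
Proof. apply flat_map_app. Qed.
Lemma dphi_app j f g : dphi j (f ++ g) = dphi j f ++ dphi j g.
Proof. apply flat_map_app. Qed.

Lemma eval_ext f I I' phi phi' :
  (forall i, (i < n)%nat -> I i = I' i) -> (forall i, (i < n)%nat -> phi i = phi' i) ->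
  peval f I phi = peval f I' phi'.
Proof.
  intros HI Hp; induction f as [|t f IH]; [easy|]. rewrite !eval_cons, IH. f_equal.
  unfold tval, phase. f_equal; [f_equal|f_equal; f_equal].
  - apply fprod_ext; intros i Hi; unfold factor. rewrite HI; auto.
  - apply fsum_ext; intros i Hi; rewrite Hp; auto.
Qed.

Lemma evalT_ext t t' I phi :
  tc t = tc t' -> tm t = tm t' -> (forall i, ta t i = ta t' i) ->
  (forall i, tq t i = tq t' i) -> td t = td t' -> tval t I phi = tval t' I phi.
Proof.
  intros H1 H2 H3 H4 H5. unfold tval, phase. rewrite H1, H5.
  f_equal; [f_equal|f_equal; f_equal].
  - apply fprod_ext; intros i Hi; unfold factor. rewrite H2, H3; auto.
  - apply fsum_ext; intros i Hi; rewrite H4; auto.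
Qed.

Definition dfactor (t : term) (I : nat -> R) (j : nat) : R :=
  if Nat.eqb j kap then IZR (- tm t) * Rpower (I j) (IZR (- tm t - 1))
  else INR (ta t j) * I j ^ (ta t j - 1).

Lemma eval_dphi_term j t I phi :
  peval (dphi_term j t) I phi =
  - IZR (tq t j) * tc t * fprod n (factor t I) * sin (phase t phi).
Proof.
  unfold dphi_term. destruct (Z.eqb_spec (tq t j) 0) as [H0|H0].
  - rewrite H0; simpl; ring.
  - rewrite eval_cons; simpl. unfold tval, phase; simpl.
    rewrite <- Rplus_assoc, cos_plus, cos_PI2, sin_PI2.
    change (factor (Term (tc t * IZR (tq t j)) (tm t) (ta t) (tq t) (td t + PI / 2)) I) with (factor t I).
    ring.
Qed.

Lemma is_derive_factor t (I : R -> nat -> R) s j d :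
  (0 < I s kap) -> is_derive (fun u => I u j) s d ->
  is_derive (fun u => factor t (I u) j) s (d * dfactor t (I s) j).
Proof.
  intros HJ Hd. unfold factor, dfactor. destruct (Nat.eqb_spec j kap) as [->|Hj].
  - unfold Rpower. set (x := fun u => I u kap) in *.
    change (is_derive (fun u => exp (IZR (- tm t) * ln (x u))) s
      (d * (IZR (- tm t) * exp (IZR (- tm t - 1) * ln (x s))))).
    change (0 < x s) in HJ. change (is_derive x s d) in Hd. clearbody x. auto_derive.
    + split; [exists d; exact Hd|]. split; easy.
    + change (Derive (fun x0 => x x0) s) with (Derive x s).
      rewrite (is_derive_unique _ _ _ Hd).
      rewrite minus_IZR. unfold Rminus at 1. rewrite Rmult_plus_distr_r, exp_plus.
      replace (- (1) * ln (x s)) with (- ln (x s)) by ring.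
      rewrite exp_Ropp, exp_ln by easy. field. lra.
  - set (x := fun u => I u j) in *.
    change (is_derive (fun u => x u ^ ta t j) s (d * (INR (ta t j) * x s ^ (ta t j - 1)))).
    change (is_derive x s d) in Hd. clearbody x. auto_derive.
    + exists d; exact Hd.
    + change (Derive (fun x0 => x x0) s) with (Derive x s).
      rewrite (is_derive_unique _ _ _ Hd).
      replace (Nat.pred (ta t j)) with (ta t j - 1)%nat by lia. ring.
Qed.

Lemma is_derive_upd (v : nat -> R) j i :
  is_derive (fun s => upd v j s i) (v j) (if Nat.eqb i j then 1 else 0).
Proof.
  unfold upd. destruct (Nat.eqb i j).
  - apply (is_derive_id (K := R_AbsRing)).
  - apply is_derive_Rconst.
Qed.

Lemma upd_same (v : nat -> R) j i : upd v j (v j) i = v i.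
Proof. unfold upd. destruct (Nat.eqb_spec i j); congruence. Qed.

Lemma locally_upd_pos (I : nat -> R) j : 0 < I kap ->
  locally (I j) (fun s => 0 < upd I j s kap).
Proof.
  intros H. unfold upd. destruct (Nat.eqb_spec kap j) as [->|Hne].
  - apply (open_gt 0). exact H.
  - apply filter_forall; easy.
Qed.

Lemma dI_scal j c f : forall I phi, peval (pdI j (pscal c f)) I phi = c * peval (pdI j f) I phi.
Proof.
  intros I phi. induction f as [|t f IH]; [simpl; ring|].
  change (pdI j (pscal c (t :: f))) with (dI_term j (scal_term c t) ++ pdI j (pscal c f)).
  change (pdI j (t :: f)) with (dI_term j t ++ pdI j f).
  rewrite !eval_app, IH.
  replace (dI_term j (scal_term c t)) with (pscal c (dI_term j t)).
  - rewrite eval_scal; ring.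
  - unfold dI_term; simpl. destruct (Nat.eqb j kap), (Z.eqb (tm t) 0), (Nat.eqb (ta t j) 0);
      simpl; unfold scal_term; simpl; rewrite ?Rmult_assoc; easy.
Qed.

Lemma dphi_scal j c f : forall I phi, peval (dphi j (pscal c f)) I phi = c * peval (dphi j f) I phi.
Proof.
  intros I phi. induction f as [|t f IH]; [simpl; ring|].
  change (dphi j (pscal c (t :: f))) with (dphi_term j (scal_term c t) ++ dphi j (pscal c f)).
  change (dphi j (t :: f)) with (dphi_term j t ++ dphi j f).
  rewrite !eval_app, IH.
  replace (dphi_term j (scal_term c t)) with (pscal c (dphi_term j t)).
  - rewrite eval_scal; ring.
  - unfold dphi_term; simpl. destruct (Z.eqb (tq t j) 0);
      simpl; unfold scal_term; simpl; rewrite ?Rmult_assoc; easy.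
Qed.

Lemma dI_lsum j p F : pdI j (lsum p F) = lsum p (fun l => pdI j (F l)).
Proof. induction p as [|p IH]; simpl; [easy|]. rewrite dI_app, IH; easy. Qed.

Lemma dphi_lsum j p F : dphi j (lsum p F) = lsum p (fun l => dphi j (F l)).
Proof. induction p as [|p IH]; simpl; [easy|]. rewrite dphi_app, IH; easy. Qed.

Lemma br_anti f g I phi : peval (pbr f g) I phi = - peval (pbr g f) I phi.
Proof. rewrite !eval_br, <- fsum_opp. apply fsum_ext; intros; ring. Qed.

Lemma eval_br_app_l f f' g I phi :
  peval (pbr (f ++ f') g) I phi = peval (pbr f g) I phi + peval (pbr f' g) I phi.
Proof.
  rewrite !eval_br, <- fsum_plus. apply fsum_ext; intros.
  rewrite dI_app, dphi_app, !eval_app; ring.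
Qed.

Lemma eval_br_app_r f g g' I phi :
  peval (pbr f (g ++ g')) I phi = peval (pbr f g) I phi + peval (pbr f g') I phi.
Proof. rewrite br_anti, eval_br_app_l, (br_anti g), (br_anti g'); ring. Qed.

Lemma eval_br_scal_l c f g I phi : peval (pbr (pscal c f) g) I phi = c * peval (pbr f g) I phi.
Proof.
  rewrite !eval_br, <- fsum_scal. apply fsum_ext; intros.
  rewrite dI_scal, dphi_scal; ring.
Qed.

Lemma eval_br_scal_r c f g I phi : peval (pbr f (pscal c g)) I phi = c * peval (pbr f g) I phi.
Proof. rewrite br_anti, eval_br_scal_l, (br_anti g); ring. Qed.

Lemma eval_br_nil_l g I phi : peval (pbr [] g) I phi = 0.
Proof. rewrite eval_br. apply fsum_zero; intros; simpl; ring. Qed.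

Lemma eval_br_nil_r f I phi : peval (pbr f []) I phi = 0.
Proof. rewrite br_anti, eval_br_nil_l; ring. Qed.

Lemma eval_br_lsum_l p F g I phi :
  peval (pbr (lsum p F) g) I phi = fsum p (fun l => peval (pbr (F l) g) I phi).
Proof.
  induction p as [|p IH]; simpl; [apply eval_br_nil_l|].
  rewrite eval_br_app_l, IH; easy.
Qed.

Lemma eval_br_lsum_r p f F I phi :
  peval (pbr f (lsum p F)) I phi = fsum p (fun l => peval (pbr f (F l)) I phi).
Proof.
  rewrite br_anti, eval_br_lsum_l, <- fsum_opp. apply fsum_ext; intros.
  rewrite (br_anti f). ring.
Qed.

(** * Formal derivatives agree with true derivatives where J > 0 *)

Hypothesis Hkap : (kap < n)%nat.

Lemma eval_dI_term j t I phi : (j < n)%nat ->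
  peval (dI_term j t) I phi =
  tc t * (dfactor t I j * fprod n (fun i => if Nat.eqb i j then 1 else factor t I i))
  * cos (phase t phi).
Proof.
  intros Hj. unfold dI_term, dfactor.
  destruct (Nat.eqb_spec j kap) as [->|Hjk].
  - destruct (Z.eqb_spec (tm t) 0) as [H0|H0].
    + rewrite H0; simpl. ring.
    + rewrite eval_cons; simpl. unfold tval; simpl.
      rewrite (fprod_split n kap) by easy. unfold factor at 1; simpl.
      rewrite Nat.eqb_refl.
      rewrite (fprod_ext n (fun i => if Nat.eqb i kap then 1 else factor (Term _ _ _ _ _) I i)
        (fun i => if Nat.eqb i kap then 1 else factor t I i)).
      2:{ intros i Hi. unfold factor; simpl. destruct (Nat.eqb i kap); easy. }
      unfold phase; simpl. replace (- (tm t + 1))%Z with (- tm t - 1)%Z by lia. ring.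
  - destruct (Nat.eqb_spec (ta t j) 0) as [H0|H0].
    + rewrite H0; simpl. ring.
    + rewrite eval_cons; simpl. unfold tval; simpl.
      rewrite (fprod_split n j) by easy. unfold factor at 1; simpl.
      rewrite Nat.eqb_refl. replace (Nat.eqb j kap) with false by (symmetry; now apply Nat.eqb_neq).
      rewrite (fprod_ext n (fun i => if Nat.eqb i j then 1 else factor (Term _ _ _ _ _) I i)
        (fun i => if Nat.eqb i j then 1 else factor t I i)).
      2:{ intros i Hi. unfold factor; simpl. destruct (Nat.eqb i j), (Nat.eqb i kap); easy. }
      unfold phase; simpl. ring.
Qed.

Lemma is_derive_evalT t (I phi : R -> nat -> R) s (dIs dphis : nat -> R) :
  0 < I s kap ->
  (forall j, (j < n)%nat -> is_derive (fun u => I u j) s (dIs j)) ->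
  (forall j, (j < n)%nat -> is_derive (fun u => phi u j) s (dphis j)) ->
  is_derive (fun u => tval t (I u) (phi u)) s
    (fsum n (fun j => peval (dI_term j t) (I s) (phi s) * dIs j
                    + peval (dphi_term j t) (I s) (phi s) * dphis j)).
Proof.
  intros HJ HI Hp. unfold tval.
  assert (H1 := is_derive_fprod n (fun i u => factor t (I u) i) _ s
    (fun i Hi => is_derive_factor t I s i (dIs i) HJ (HI i Hi))).
  assert (H2 : is_derive (fun u => phase t (phi u)) s (fsum n (fun j => IZR (tq t j) * dphis j))).
  { unfold phase. evar_last.
    - apply is_derive_Rplus.
      + apply (is_derive_fsum n (fun i u => IZR (tq t i) * phi u i)); intros i Hi.
        apply is_derive_scal. apply Hp; easy.
      + apply is_derive_Rconst.
    - ring. }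
  evar_last.
  - apply (is_derive_Rmult (fun u => tc t * fprod n (factor t (I u))) (fun u => cos (phase t (phi u)))).
    + apply is_derive_scal. exact H1.
    + apply (is_derive_comp cos (fun u => phase t (phi u))); [apply is_derive_cos|exact H2].
  - cbv [plus mult Hierarchy.scal]; simpl. cbv [mult]; simpl. rewrite fsum_plus. f_equal.
    + rewrite Rmult_comm, <- !fsum_scal. apply fsum_ext; intros j Hj.
      rewrite eval_dI_term by easy. ring.
    + rewrite (Rmult_comm (fsum _ _)), <- Rmult_assoc, <- fsum_scal.
      apply fsum_ext; intros j Hj. rewrite eval_dphi_term. ring.
Qed.

Lemma is_derive_eval f (I phi : R -> nat -> R) s (dIs dphis : nat -> R) :
  0 < I s kap ->
  (forall j, (j < n)%nat -> is_derive (fun u => I u j) s (dIs j)) ->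
  (forall j, (j < n)%nat -> is_derive (fun u => phi u j) s (dphis j)) ->
  is_derive (fun u => peval f (I u) (phi u)) s
    (fsum n (fun j => peval (pdI j f) (I s) (phi s) * dIs j
                    + peval (dphi j f) (I s) (phi s) * dphis j)).
Proof.
  intros HJ HI Hp. induction f as [|t f IH].
  - simpl. rewrite fsum_zero by (intros; ring).
    apply is_derive_Rconst.
  - evar_last.
    + apply (is_derive_Rplus
        (fun u => tval t (I u) (phi u)) (fun u => peval f (I u) (phi u))); [|exact IH].
      apply is_derive_evalT; eassumption.
    + rewrite <- fsum_plus. apply fsum_ext; intros j Hj.
      cbn [pdI dphi flat_map]. rewrite !eval_app. fold (pdI j f) (dphi j f). ring.
Qed.

Lemma is_derive_dI f j (I phi : nat -> R) : (j < n)%nat -> 0 < I kap ->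
  is_derive (fun s => peval f (upd I j s) phi) (I j) (peval (pdI j f) I phi).
Proof.
  intros Hj HJ. evar_last.
  - apply (is_derive_eval f (fun s => upd I j s) (fun _ => phi) (I j)
      (fun i => if Nat.eqb i j then 1 else 0) (fun _ => 0)).
    + rewrite upd_same; easy.
    + intros i _; apply is_derive_upd.
    + intros; apply is_derive_Rconst.
  - simpl. rewrite (fsum_ext n _ (fun i => if Nat.eqb i j then peval (pdI i f) I phi else 0)).
    + rewrite fsum_delta; easy.
    + intros i Hi. rewrite (eval_ext (pdI i f) _ I phi phi) by (intros; try apply upd_same; easy).
      destruct (Nat.eqb i j); ring.
Qed.

Lemma is_derive_dphi f j (I phi : nat -> R) : (j < n)%nat -> 0 < I kap ->
  is_derive (fun s => peval f I (upd phi j s)) (phi j) (peval (dphi j f) I phi).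
Proof.
  intros Hj HJ. evar_last.
  - apply (is_derive_eval f (fun _ => I) (fun s => upd phi j s) (phi j) (fun _ => 0)
      (fun i => if Nat.eqb i j then 1 else 0)).
    + easy.
    + intros; apply is_derive_Rconst.
    + intros i _; apply is_derive_upd.
  - simpl. rewrite (fsum_ext n _ (fun i => if Nat.eqb i j then peval (dphi i f) I phi else 0)).
    + rewrite fsum_delta; easy.
    + intros i Hi. rewrite (eval_ext (dphi i f) I I _ phi) by (intros; try apply upd_same; easy).
      destruct (Nat.eqb i j); ring.
Qed.

Definition peqv (f g : tpoly) : Prop :=
  forall I phi, 0 < I kap -> peval f I phi = peval g I phi.

(** Different lists may represent the same function. As J > 0 is an open condition, equality there
    passes to the true derivatives, and these are the evaluations of the formal ones. *)
Lemma dI_eqv f g j : (j < n)%nat -> peqv f g -> peqv (pdI j f) (pdI j g).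
Proof.
  intros Hj H I phi HJ.
  rewrite <- (is_derive_unique _ _ _ (is_derive_dI f j I phi Hj HJ)).
  rewrite <- (is_derive_unique _ _ _ (is_derive_dI g j I phi Hj HJ)).
  apply Derive_ext_loc. generalize (locally_upd_pos I j HJ).
  apply filter_imp; intros s Hs; apply H; easy.
Qed.

Lemma dphi_eqv f g j : (j < n)%nat -> peqv f g -> peqv (dphi j f) (dphi j g).
Proof.
  intros Hj H I phi HJ.
  rewrite <- (is_derive_unique _ _ _ (is_derive_dphi f j I phi Hj HJ)).
  rewrite <- (is_derive_unique _ _ _ (is_derive_dphi g j I phi Hj HJ)).
  apply Derive_ext; intros s; apply H; easy.
Qed.

Lemma br_eqv f f' g g' : peqv f f' -> peqv g g' -> peqv (pbr f g) (pbr f' g').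
Proof.
  intros Hf Hg I phi HJ. rewrite !eval_br. apply fsum_ext; intros j Hj.
  rewrite (dI_eqv f f' j Hj Hf), (dI_eqv g g' j Hj Hg),
    (dphi_eqv f f' j Hj Hf), (dphi_eqv g g' j Hj Hg) by easy. easy.
Qed.

(** Obtained from uniqueness of the true derivative of the evaluated product; no comparison of the
    two lists of terms is made. *)
Lemma eval_dI_mul f g j I phi : (j < n)%nat -> 0 < I kap ->
  peval (pdI j (pmul f g)) I phi =
  peval (pdI j f) I phi * peval g I phi + peval f I phi * peval (pdI j g) I phi.
Proof.
  intros Hj HJ.
  rewrite <- (is_derive_unique _ _ _ (is_derive_dI (pmul f g) j I phi Hj HJ)).
  apply is_derive_unique.
  apply is_derive_ext with (fun s => peval f (upd I j s) phi * peval g (upd I j s) phi).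
  - intros; rewrite eval_mul; easy.
  - evar_last.
    + apply is_derive_Rmult; apply is_derive_dI; assumption.
    + cbv beta. rewrite (eval_ext f (upd I j (I j)) I phi phi), (eval_ext g (upd I j (I j)) I phi phi)
        by (intros; try apply upd_same; easy). ring.
Qed.

Lemma eval_dphi_mul f g j I phi : (j < n)%nat -> 0 < I kap ->
  peval (dphi j (pmul f g)) I phi =
  peval (dphi j f) I phi * peval g I phi + peval f I phi * peval (dphi j g) I phi.
Proof.
  intros Hj HJ.
  rewrite <- (is_derive_unique _ _ _ (is_derive_dphi (pmul f g) j I phi Hj HJ)).
  apply is_derive_unique.
  apply is_derive_ext with (fun s => peval f I (upd phi j s) * peval g I (upd phi j s)).
  - intros; rewrite eval_mul; easy.
  - evar_last.
    + apply is_derive_Rmult; apply is_derive_dphi; assumption.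
    + cbv beta. rewrite (eval_ext f I I (upd phi j (phi j)) phi), (eval_ext g I I (upd phi j (phi j)) phi)
        by (intros; try apply upd_same; easy). ring.
Qed.

(** * Commuting derivatives and the Jacobi identity *)

Lemma eval_flat_map_comm (h1 h2 : term -> tpoly) f I phi :
  (forall t, peval (flat_map h1 (h2 t)) I phi = peval (flat_map h2 (h1 t)) I phi) ->
  peval (flat_map h1 (flat_map h2 f)) I phi = peval (flat_map h2 (flat_map h1 f)) I phi.
Proof.
  intros H; induction f as [|t f IH]; [easy|].
  cbn [flat_map]. rewrite !flat_map_app, !eval_app, IH, H. easy.
Qed.

Lemma dphi_dphi_comm i j f I phi :
  peval (dphi i (dphi j f)) I phi = peval (dphi j (dphi i f)) I phi.
Proof.
  apply eval_flat_map_comm; intros t. unfold dphi_term at 2 4.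
  destruct (Z.eqb_spec (tq t i) 0) as [Hi|Hi], (Z.eqb_spec (tq t j) 0) as [Hj|Hj];
    simpl; rewrite ?app_nil_r; unfold dphi_term; simpl.
  - easy.
  - rewrite Hi; easy.
  - rewrite Hj; easy.
  - rewrite (proj2 (Z.eqb_neq _ _) Hi), (proj2 (Z.eqb_neq _ _) Hj).
    rewrite !eval_cons. f_equal. apply evalT_ext; simpl; try easy; ring.
Qed.

Lemma dI_dphi_comm i j f I phi :
  peval (pdI i (dphi j f)) I phi = peval (dphi j (pdI i f)) I phi.
Proof.
  apply eval_flat_map_comm; intros t. unfold dphi_term at 1, dI_term at 2.
  destruct (Nat.eqb_spec i kap) as [Hk|Hk];
  [destruct (Z.eqb_spec (tm t) 0) as [Hi|Hi]|destruct (Nat.eqb_spec (ta t i) 0) as [Hi|Hi]];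
  destruct (Z.eqb_spec (tq t j) 0) as [Hj|Hj];
    simpl; rewrite ?app_nil_r; unfold dphi_term, dI_term; simpl;
    rewrite ?(proj2 (Nat.eqb_eq _ _) Hk), ?(proj2 (Nat.eqb_neq _ _) Hk), ?(proj2 (Z.eqb_eq _ _) Hj), ?(proj2 (Z.eqb_neq _ _) Hj); try easy.
  - rewrite (proj2 (Z.eqb_eq _ _) Hi); easy.
  - rewrite (proj2 (Z.eqb_neq _ _) Hi). rewrite !eval_cons. f_equal.
    apply evalT_ext; simpl; try easy; ring.
  - rewrite (proj2 (Nat.eqb_eq _ _) Hi); easy.
  - rewrite (proj2 (Nat.eqb_neq _ _) Hi). rewrite !eval_cons. f_equal.
    apply evalT_ext; simpl; try easy; ring.
Qed.

Lemma dI_dI_comm i j f I phi :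
  peval (pdI i (pdI j f)) I phi = peval (pdI j (pdI i f)) I phi.
Proof.
  destruct (Nat.eq_dec i j) as [->|Hij]; [easy|].
  apply eval_flat_map_comm; intros t. unfold dI_term at 2 4.
  destruct (Nat.eqb_spec i kap) as [Hik|Hik], (Nat.eqb_spec j kap) as [Hjk|Hjk].
  - congruence.
  - destruct (Z.eqb_spec (tm t) 0) as [Hi|Hi], (Nat.eqb_spec (ta t j) 0) as [Hj|Hj];
    simpl; rewrite ?app_nil_r; unfold dI_term; simpl;
    rewrite ?(proj2 (Nat.eqb_eq _ _) Hik), ?(proj2 (Nat.eqb_neq _ _) Hjk), ?(proj2 (Z.eqb_eq _ _) Hi),
     ?(proj2 (Z.eqb_neq _ _) Hi), ?(proj2 (Nat.eqb_eq _ _) Hj), ?(proj2 (Nat.eqb_neq _ _) Hj); try easy.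
    rewrite !eval_cons. f_equal. apply evalT_ext; simpl; try easy; ring.
  - destruct (Z.eqb_spec (tm t) 0) as [Hi|Hi], (Nat.eqb_spec (ta t i) 0) as [Hj|Hj];
    simpl; rewrite ?app_nil_r; unfold dI_term; simpl;
    rewrite ?(proj2 (Nat.eqb_eq _ _) Hjk), ?(proj2 (Nat.eqb_neq _ _) Hik), ?(proj2 (Z.eqb_eq _ _) Hi),
     ?(proj2 (Z.eqb_neq _ _) Hi), ?(proj2 (Nat.eqb_eq _ _) Hj), ?(proj2 (Nat.eqb_neq _ _) Hj); try easy.
    rewrite !eval_cons. f_equal. apply evalT_ext; simpl; try easy; ring.
  - assert (Hji : j <> i) by congruence.
    destruct (Nat.eqb_spec (ta t i) 0) as [Hi|Hi], (Nat.eqb_spec (ta t j) 0) as [Hj|Hj];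
    simpl; rewrite ?app_nil_r; unfold dI_term; simpl;
    rewrite ?(proj2 (Nat.eqb_neq _ _) Hjk), ?(proj2 (Nat.eqb_neq _ _) Hik),
      ?(proj2 (Nat.eqb_neq _ _) Hij), ?(proj2 (Nat.eqb_neq _ _) Hji), ?(proj2 (Nat.eqb_eq _ _) Hi),
     ?(proj2 (Nat.eqb_neq _ _) Hi), ?(proj2 (Nat.eqb_eq _ _) Hj), ?(proj2 (Nat.eqb_neq _ _) Hj); try easy.
    rewrite !eval_cons. f_equal. apply evalT_ext; simpl; try easy; try ring.
    intros l. destruct (Nat.eqb_spec l i), (Nat.eqb_spec l j); subst; easy.
Qed.

Lemma eval_dI_br i g h I phi : (i < n)%nat -> 0 < I kap ->
  peval (pdI i (pbr g h)) I phi = fsum n (fun j =>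
    peval (pdI i (dphi j g)) I phi * peval (pdI j h) I phi
    + peval (dphi j g) I phi * peval (pdI i (pdI j h)) I phi
    - peval (pdI i (pdI j g)) I phi * peval (dphi j h) I phi
    - peval (pdI j g) I phi * peval (pdI i (dphi j h)) I phi).
Proof.
  intros Hi HJ. unfold pbr. rewrite dI_lsum, eval_lsum. apply fsum_ext; intros j Hj.
  rewrite dI_app, eval_app, dI_scal, !eval_dI_mul by easy. ring.
Qed.

Lemma eval_dphi_br i g h I phi : (i < n)%nat -> 0 < I kap ->
  peval (dphi i (pbr g h)) I phi = fsum n (fun j =>
    peval (dphi i (dphi j g)) I phi * peval (pdI j h) I phi
    + peval (dphi j g) I phi * peval (dphi i (pdI j h)) I phi
    - peval (dphi i (pdI j g)) I phi * peval (dphi j h) I phi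
    - peval (pdI j g) I phi * peval (dphi i (dphi j h)) I phi).
Proof.
  intros Hi HJ. unfold pbr. rewrite dphi_lsum, eval_lsum. apply fsum_ext; intros j Hj.
  rewrite dphi_app, eval_app, dphi_scal, !eval_dphi_mul by easy. ring.
Qed.

Lemma eval_br_br f g h I phi : 0 < I kap ->
  peval (pbr f (pbr g h)) I phi = fsum n (fun i => fsum n (fun j =>
    peval (dphi i f) I phi * (
    peval (dphi j (pdI i g)) I phi * peval (pdI j h) I phi
    + peval (dphi j g) I phi * peval (pdI i (pdI j h)) I phi
    - peval (pdI i (pdI j g)) I phi * peval (dphi j h) I phi
    - peval (pdI j g) I phi * peval (dphi j (pdI i h)) I phi)
    - peval (pdI i f) I phi * (
    peval (dphi i (dphi j g)) I phi * peval (pdI j h) I phi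
    + peval (dphi j g) I phi * peval (dphi i (pdI j h)) I phi
    - peval (dphi i (pdI j g)) I phi * peval (dphi j h) I phi
    - peval (pdI j g) I phi * peval (dphi i (dphi j h)) I phi))).
Proof.
  intros HJ. rewrite eval_br. apply fsum_ext; intros i Hi.
  rewrite eval_dI_br, eval_dphi_br by easy.
  rewrite <- !fsum_scal, <- fsum_minus. apply fsum_ext; intros j Hj.
  rewrite !dI_dphi_comm. easy.
Qed.

(** In the expanded Jacobi identity the summand at (i, j) need not vanish by itself; it cancels
    against the summand at (j, i). Adding the double sum to its transpose uses exactly this. *)
Lemma double_fsum_zero p T1 T2 T3 :
  (forall i j, T1 i j + T2 i j + T3 i j + (T1 j i + T2 j i + T3 j i) = 0) ->
  fsum p (fun i => fsum p (fun j => T1 i j)) + fsum p (fun i => fsum p (fun j => T2 i j))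
  + fsum p (fun i => fsum p (fun j => T3 i j)) = 0.
Proof.
  intros H.
  set (T := fun i j => T1 i j + T2 i j + T3 i j).
  assert (E0 : fsum p (fun i => fsum p (fun j => T1 i j)) + fsum p (fun i => fsum p (fun j => T2 i j))
    + fsum p (fun i => fsum p (fun j => T3 i j)) = fsum p (fun i => fsum p (fun j => T i j))).
  { rewrite <- !fsum_plus. apply fsum_ext; intros i _. rewrite <- !fsum_plus. easy. }
  assert (E : fsum p (fun i => fsum p (fun j => T i j)) + fsum p (fun i => fsum p (fun j => T i j)) = 0).
  { rewrite (fsum_swap p p T) at 2. rewrite <- fsum_plus.
    apply fsum_zero; intros i _. rewrite <- fsum_plus. apply fsum_zero; intros j _. apply H. }
  lra.
Qed.

Lemma jacobi f g h I phi : 0 < I kap ->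
  peval (pbr f (pbr g h)) I phi + peval (pbr g (pbr h f)) I phi + peval (pbr h (pbr f g)) I phi = 0.
Proof.
  intros HJ. rewrite !eval_br_br by easy.
  apply double_fsum_zero. intros i j.
  rewrite (dI_dI_comm j i f), (dI_dI_comm j i g), (dI_dI_comm j i h),
    (dphi_dphi_comm j i f), (dphi_dphi_comm j i g), (dphi_dphi_comm j i h).
  ring.
Qed.

(** Jacobi with brackets turned around by antisymmetry. In this form it says that infinitesimal
    transport along g respects brackets. *)
Lemma br_derivation g u v I phi : 0 < I kap ->
  peval (pbr (pbr g u) v) I phi + peval (pbr u (pbr g v)) I phi = peval (pbr g (pbr u v)) I phi.
Proof.
  intros HJ. generalize (jacobi g u v I phi HJ).
  rewrite (br_anti (pbr g u) v).
  assert (E : peval (pbr u (pbr v g)) I phi = - peval (pbr u (pbr g v)) I phi).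
  { transitivity (peval (pbr u (pscal (-1) (pbr g v))) I phi).
    - apply br_eqv; try easy. intros I' phi' H'. rewrite eval_scal, br_anti. ring.
    - rewrite eval_br_scal_r; ring. }
  rewrite E. lra.
Qed.

End Algebra.

(** * Removing the fast angle to all orders: Deprit's Lie series *)

Lemma fsum_trunc p q f : (p <= q)%nat ->
  fsum p f = fsum q (fun l => if Nat.ltb l p then f l else 0).
Proof.
  intros H. induction q as [|q IH].
  - replace p with 0%nat by lia. easy.
  - destruct (Nat.eq_dec p (S q)) as [->|Hne].
    + apply fsum_ext; intros i Hi. now rewrite (proj2 (Nat.ltb_lt _ _) Hi).
    + simpl. rewrite IH by lia. rewrite (proj2 (Nat.ltb_ge q p)) by lia. ring.
Qed.

Lemma fsum_rev m f : fsum (S m) f = fsum (S m) (fun i => f (m - i)%nat).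
Proof.
  revert f; induction m as [|m IH]; intros f; [easy|].
  rewrite fsum_split_first, IH.
  change (fsum (S (S m)) (fun i => f (S m - i)%nat)) with
    (fsum (S m) (fun i => f (S m - i)%nat) + f (S m - S m)%nat).
  rewrite Nat.sub_diag, Rplus_comm. f_equal.
  apply fsum_ext; intros i Hi. f_equal; lia.
Qed.

(** Both sides sum T over all triples of naturals with sum m; only the order of summation
    differs. *)
Lemma fsum_triangle_swap m (T : nat -> nat -> nat -> R) :
  fsum (S m) (fun i => fsum (S (m - i)) (fun l => T l i (m - i - l)%nat)) =
  fsum (S m) (fun l => fsum (S (m - l)) (fun a => T l a (m - l - a)%nat)).
Proof.
  transitivity (fsum (S m) (fun i => fsum (S m) (fun l =>
    if Nat.ltb l (S (m - i)) then T l i (m - i - l)%nat else 0))).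
  { apply fsum_ext; intros i Hi. apply fsum_trunc; lia. }
  rewrite fsum_swap. apply fsum_ext; intros l Hl.
  rewrite (fsum_trunc (S (m - l)) (S m)) by lia.
  apply fsum_ext; intros i Hi.
  destruct (Nat.ltb_spec l (S (m - i))), (Nat.ltb_spec i (S (m - l))); try lia; try easy.
  f_equal; lia.
Qed.

Lemma fsum_triangle_shift m (T : nat -> nat -> nat -> R) :
  fsum (S m) (fun i => fsum (S i) (fun l => T l (i - l)%nat (m - i)%nat)) =
  fsum (S m) (fun l => fsum (S (m - l)) (fun a => T l a (m - l - a)%nat)).
Proof.
  rewrite fsum_rev.
  transitivity (fsum (S m) (fun i => fsum (S (m - i)) (fun l =>
    (fun l' i' r' => T l' r' i') l i (m - i - l)%nat))).
  { apply fsum_ext; intros i Hi. apply fsum_ext; intros l Hl. f_equal; lia. }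
  rewrite (fsum_triangle_swap m (fun l' i' r' => T l' r' i')).
  apply fsum_ext; intros l Hl. rewrite fsum_rev.
  apply fsum_ext; intros a Ha. f_equal; lia.
Qed.

Section Deprit.
Variables n kap : nat.

Local Notation eval := (peval n kap).
Local Notation br := (pbr n kap).
Local Notation dI := (pdI kap).
Local Notation eqv := (peqv n kap).
Local Notation evalT := (tval n kap).

Definition ham_fast : tpoly := [Term (1 / 2) (-2) (fun _ => 0%nat) (fun _ => 0%Z) 0].
Definition Jp : tpoly := [Term 1 (-1) (fun _ => 0%nat) (fun _ => 0%Z) 0].

Lemma dI_pure_J j c m : j <> kap -> dI j [Term c m (fun _ => 0%nat) (fun _ => 0%Z) 0] = [].
Proof.
  intros Hj. unfold pdI, dI_term; simpl. rewrite (proj2 (Nat.eqb_neq _ _) Hj). easy.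
Qed.

Definition mean (f : tpoly) : tpoly := filter (fun t => Z.eqb (tq t kap) 0) f.

(** Right inverse of J d/dphi_kap on terms that contain the fast angle: integration divides by the
    frequency number and turns the phase back by pi/2, and division by J raises the order by one. *)
Definition hom_term (t : term) : tpoly :=
  if Z.eqb (tq t kap) 0 then []
  else [Term (tc t / IZR (tq t kap)) (tm t + 1) (ta t) (tq t) (td t - PI / 2)].

Definition hom (f : tpoly) : tpoly := flat_map hom_term f.

Lemma dphi_mean f : dphi kap (mean f) = [].
Proof.
  unfold mean, dphi. induction f as [|t f IH]; simpl; [easy|].
  destruct (Z.eqb (tq t kap) 0) eqn:E; [|easy]. simpl. rewrite IH.
  unfold dphi_term. rewrite E. easy.
Qed.

(** Each coefficient needs all earlier ones. Stage i is a table that is final at all indices up to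
    i, which makes this course-of-values recursion structural. *)
Fixpoint Ptab (G : nat -> tpoly) (w : tpoly) (i : nat) : nat -> tpoly :=
  match i with
  | O => fun _ => w
  | S i' => fun j =>
      if Nat.eqb j (S i')
      then pscal (/ INR (S i')) (lsum (S i') (fun l => br (G l) (Ptab G w i' (i' - l)%nat)))
      else Ptab G w i' j
  end.

(* The Taylor coefficients in eps of the solution of F'(eps) = {G(eps), F(eps)}, F(0) = w. *)
Definition Phi (G : nat -> tpoly) (w : tpoly) (i : nat) : tpoly := Ptab G w i i.

Lemma Ptab_Phi G w i j : (j <= i)%nat -> Ptab G w i j = Phi G w j.
Proof.
  induction i as [|i IH]; intros Hj.
  - replace j with 0%nat by lia. easy.
  - destruct (Nat.eq_dec j (S i)) as [->|Hne]; [easy|].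
    simpl. rewrite (proj2 (Nat.eqb_neq j (S i))) by easy. apply IH; lia.
Qed.

Lemma lsum_ext p F F' : (forall l, (l < p)%nat -> F l = F' l) -> lsum p F = lsum p F'.
Proof.
  induction p as [|p IH]; intros H; simpl; [easy|]. rewrite IH, H; auto.
Qed.

Lemma Phi_0 G w : Phi G w 0 = w.
Proof. easy. Qed.

Lemma Phi_S G w i : Phi G w (S i) =
  pscal (/ INR (S i)) (lsum (S i) (fun l => br (G l) (Phi G w (i - l)%nat))).
Proof.
  unfold Phi at 1. cbn [Ptab]. rewrite Nat.eqb_refl. f_equal.
  apply lsum_ext; intros l Hl. rewrite Ptab_Phi by lia. easy.
Qed.

Lemma Phi_S_eqv G w i : eqv (pscal (INR (S i)) (Phi G w (S i)))
  (lsum (S i) (fun l => br (G l) (Phi G w (i - l)%nat))).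
Proof.
  intros I phi _. rewrite Phi_S, !eval_scal. field. apply not_0_INR; lia.
Qed.

(** Coefficient i sees only the generators below i. This is what allows the generators to be defined
    in terms of the transport that they generate. *)
Lemma Phi_ext G G' w i : (forall l, (l < i)%nat -> G l = G' l) -> Phi G w i = Phi G' w i.
Proof.
  induction i as [i IH] using (well_founded_induction lt_wf); intros H.
  destruct i as [|i]; [easy|]. rewrite !Phi_S. f_equal. apply lsum_ext; intros l Hl.
  rewrite H by lia. f_equal. apply IH; [lia|]. intros; apply H; lia.
Qed.

Variable P : tpoly.

(** Put H(eps) = J^2/2 + eps P and ask that H'(eps) = {G(eps), H(eps)} + sum_j eps^j W_j(eps), where
    W_j is w_j transported along G and w_j is free of the fast angle. At order eps^m this reads
    {G_m, J^2/2} = rhs_m - w_m, and rhs_m contains only earlier generators and averages. It is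
    solved by w_m = [mean] and G_m = [hom] of rhs_m. *)
Definition rhs (G w : nat -> tpoly) (m : nat) : tpoly :=
  match m with O => P | S m' => pscal (-1) (br (G m') P) end
  ++ pscal (-1) (lsum m (fun j => Phi G (w j) (m - j)%nat)).

Lemma rhs_ext G G' w w' m : (forall l, (l < m)%nat -> G l = G' l) ->
  (forall l, (l < m)%nat -> w l = w' l) -> rhs G w m = rhs G' w' m.
Proof.
  intros HG Hw. unfold rhs. f_equal.
  - destruct m; [easy|]. rewrite HG by lia. easy.
  - f_equal. apply lsum_ext; intros j Hj. rewrite Hw by easy.
    apply Phi_ext; intros; apply HG; lia.
Qed.

Fixpoint GWtab (m : nat) : (nat -> tpoly) * (nat -> tpoly) :=
  match m with
  | O => (fun _ => [], fun _ => [])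
  | S m' =>
      let GW := GWtab m' in
      let r := rhs (fst GW) (snd GW) m' in
      (fun j => if Nat.eqb j m' then hom r else fst GW j,
       fun j => if Nat.eqb j m' then mean r else snd GW j)
  end.

Definition Gs (m : nat) : tpoly := fst (GWtab (S m)) m.
Definition ws (m : nat) : tpoly := snd (GWtab (S m)) m.

Lemma GWtab_prefix M j : (j < M)%nat -> fst (GWtab M) j = Gs j /\ snd (GWtab M) j = ws j.
Proof.
  induction M as [|M IH]; intros Hj; [lia|].
  destruct (Nat.eq_dec j M) as [->|Hne]; [easy|].
  cbn [GWtab fst snd]. rewrite (proj2 (Nat.eqb_neq j M)) by easy. apply IH; lia.
Qed.

Lemma Gs_eq m : Gs m = hom (rhs Gs ws m).
Proof.
  unfold Gs at 1. cbn [GWtab fst snd]. rewrite Nat.eqb_refl. f_equal.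
  apply rhs_ext; intros l Hl; apply GWtab_prefix; easy.
Qed.

Lemma ws_eq m : ws m = mean (rhs Gs ws m).
Proof.
  unfold ws at 1. cbn [GWtab fst snd]. rewrite Nat.eqb_refl. f_equal.
  apply rhs_ext; intros l Hl; apply GWtab_prefix; easy.
Qed.

(** The fast action J transported along G, order by order in eps. J commutes with functions free of
    the fast angle, and transport turns this into formal commutation of X with H. *)
Definition Xs (i : nat) : tpoly := Phi Gs Jp i.

Hypothesis Hkap : (kap < n)%nat.

(* Bracketing with G is a derivation both of the bracket and of Cauchy products, so if u and v
   are transported along G (v up to a defect d), so is their Cauchy bracket. *)
Lemma cauchy_bracket_transport (G u v d : nat -> tpoly) m I phi :
  0 < I kap ->
  (forall i, eqv (pscal (INR (S i)) (u (S i))) (lsum (S i) (fun l => br (G l) (u (i - l)%nat)))) ->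
  (forall i, eqv (pscal (INR (S i)) (v (S i)))
               (lsum (S i) (fun l => br (G l) (v (i - l)%nat)) ++ d i)) ->
  INR (S m) * eval (lsum (S (S m)) (fun i => br (u i) (v (S m - i)%nat))) I phi =
  fsum (S m) (fun l => eval (br (G l) (lsum (S (m - l)) (fun i => br (u i) (v (m - l - i)%nat)))) I phi)
  + fsum (S m) (fun i => eval (br (u i) (d (m - i)%nat)) I phi).
Proof.
  intros HJ Hu Hv. rewrite eval_lsum, <- fsum_scal.
  set (E := fun i => eval (br (u i) (v (S m - i)%nat)) I phi).
  (* The factor m + 1 is split as i + (m + 1 - i), so that each part feeds the transport equation of
     one of the two arguments. *)
  rewrite (fsum_ext _ _ (fun i => INR i * E i + INR (S m - i) * E i)).
  2:{ intros i Hi. rewrite minus_INR by lia. unfold E. ring. }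
  rewrite fsum_plus.
  rewrite (fsum_split_first (S m) (fun i => INR i * E i)).
  change (fsum (S (S m)) (fun i => INR (S m - i) * E i)) with
    (fsum (S m) (fun i => INR (S m - i) * E i) + INR (S m - S m) * E (S m)).
  rewrite Nat.sub_diag. change (INR 0) with 0. rewrite !Rmult_0_l, Rplus_0_l, Rplus_0_r.
  assert (A1 : fsum (S m) (fun i => INR (S i) * E (S i)) =
    fsum (S m) (fun i => fsum (S i) (fun l =>
      eval (br (br (G l) (u (i - l)%nat)) (v (m - i)%nat)) I phi))).
  { apply fsum_ext; intros i Hi. unfold E.
    rewrite <- eval_br_scal_l.
    rewrite (br_eqv n kap Hkap _ _ _ _ (Hu i) (fun _ _ _ => eq_refl)) by easy.
    replace (S m - S i)%nat with (m - i)%nat by lia. apply eval_br_lsum_l. }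
  assert (A2 : fsum (S m) (fun i => INR (S m - i) * E i) =
    fsum (S m) (fun i => fsum (S (m - i)) (fun l =>
      eval (br (u i) (br (G l) (v (m - i - l)%nat))) I phi))
    + fsum (S m) (fun i => eval (br (u i) (d (m - i)%nat)) I phi)).
  { rewrite <- fsum_plus. apply fsum_ext; intros i Hi. unfold E.
    rewrite <- eval_br_scal_r. replace (S m - i)%nat with (S (m - i)) by lia.
    rewrite (br_eqv n kap Hkap _ _ _ _ (fun _ _ _ => eq_refl) (Hv (m - i)%nat)) by easy.
    rewrite eval_br_app_r, eval_br_lsum_r. easy. }
  rewrite A1, A2.
  rewrite (fsum_triangle_shift m (fun l a b => eval (br (br (G l) (u a)) (v b)) I phi)).
  rewrite (fsum_triangle_swap m (fun l a b => eval (br (u a) (br (G l) (v b))) I phi)).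
  rewrite <- Rplus_assoc, <- fsum_plus. f_equal.
  apply fsum_ext; intros l Hl. rewrite eval_br_lsum_r, <- fsum_plus.
  apply fsum_ext; intros a Ha. apply br_derivation; easy.
Qed.

Lemma eval_pure_J c m I phi : 0 < I kap ->
  eval [Term c m (fun _ => 0%nat) (fun _ => 0%Z) 0] I phi = c * Rpower (I kap) (IZR (- m)).
Proof.
  intros HJ. rewrite eval_cons. unfold peval; simpl. unfold tval, phase; simpl.
  rewrite fsum_zero by (intros; ring). rewrite !Rplus_0_r, cos_0.
  rewrite (fprod_split n kap) by easy. rewrite fprod_one.
  - unfold factor; simpl. rewrite Nat.eqb_refl. ring.
  - intros i Hi. unfold factor; simpl. destruct (Nat.eqb i kap); easy.
Qed.

Lemma eval_H0 I phi : 0 < I kap -> eval ham_fast I phi = / 2 * I kap ^ 2.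
Proof.
  intros HJ. unfold ham_fast. rewrite eval_pure_J by easy.
  change (IZR (- -2)) with (INR 2). rewrite Rpower_pow by easy. field.
Qed.

Lemma eval_Jp I phi : 0 < I kap -> eval Jp I phi = I kap.
Proof.
  intros HJ. unfold Jp. rewrite eval_pure_J by easy.
  change (IZR (- -1)) with 1. rewrite Rpower_1 by easy. ring.
Qed.

Lemma dI_kap_Jp I phi : 0 < I kap -> eval (dI kap Jp) I phi = 1.
Proof.
  intros HJ.
  replace (dI kap Jp) with [Term (1 * 1) 0 (fun _ => 0%nat) (fun _ => 0%Z) 0]
    by (unfold pdI, Jp, dI_term; cbn [flat_map]; rewrite Nat.eqb_refl; reflexivity).
  rewrite eval_pure_J by easy. change (IZR (- 0)) with 0. rewrite Rpower_O by easy. ring.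
Qed.

Lemma dI_kap_H0 I phi : 0 < I kap -> eval (dI kap ham_fast) I phi = I kap.
Proof.
  intros HJ.
  replace (dI kap ham_fast) with [Term (1 / 2 * 2) (-1) (fun _ => 0%nat) (fun _ => 0%Z) 0]
    by (unfold pdI, ham_fast, dI_term; cbn [flat_map]; rewrite Nat.eqb_refl; reflexivity).
  rewrite eval_pure_J by easy. change (IZR (- -1)) with 1. rewrite Rpower_1 by easy. field.
Qed.

Lemma eval_br_pure_J c m g I phi :
  eval (br g [Term c m (fun _ => 0%nat) (fun _ => 0%Z) 0]) I phi =
  eval (dphi kap g) I phi * eval (dI kap [Term c m (fun _ => 0%nat) (fun _ => 0%Z) 0]) I phi.
Proof.
  rewrite eval_br.
  rewrite (fsum_ext n _ (fun j => if Nat.eqb j kap then eval (dphi j g) I phi * eval (dI j [Term c m (fun _ => 0%nat) (fun _ => 0%Z) 0]) I phi else 0)).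
  - rewrite fsum_delta; easy.
  - intros j Hj. change (dphi j [Term c m (fun _ => 0%nat) (fun _ => 0%Z) 0]) with (@nil term).
    destruct (Nat.eqb_spec j kap) as [->|Hne].
    + change (eval [] I phi) with 0. ring.
    + rewrite dI_pure_J by easy. change (eval [] I phi) with 0. ring.
Qed.

Lemma eval_br_H0 g I phi : 0 < I kap -> eval (br g ham_fast) I phi = eval (dphi kap g) I phi * I kap.
Proof.
  intros HJ. unfold ham_fast. rewrite eval_br_pure_J. fold ham_fast. rewrite dI_kap_H0; easy.
Qed.

Lemma eval_br_Jp g I phi : 0 < I kap -> eval (br g Jp) I phi = eval (dphi kap g) I phi.
Proof.
  intros HJ. unfold Jp. rewrite eval_br_pure_J. fold Jp. rewrite dI_kap_Jp by easy. ring.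
Qed.

Lemma homological f I phi : 0 < I kap ->
  eval (br (hom f) ham_fast) I phi = eval f I phi - eval (mean f) I phi.
Proof.
  intros HJ. rewrite eval_br_H0 by easy.
  induction f as [|t f IH]; [simpl; unfold peval; simpl; ring|].
  change (hom (t :: f)) with (hom_term t ++ hom f).
  rewrite dphi_app, eval_app, Rmult_plus_distr_r, IH.
  assert (E : eval (dphi kap (hom_term t)) I phi * I kap
    = eval [t] I phi - eval (mean [t]) I phi).
  { unfold hom_term, mean; simpl. destruct (Z.eqb_spec (tq t kap) 0) as [H|H].
    - simpl. unfold peval; simpl; ring.
    - unfold dphi, dphi_term; simpl. rewrite (proj2 (Z.eqb_neq _ _) H). simpl.
      unfold peval; simpl. rewrite Rplus_0_r, Rminus_0_r, Rplus_0_r.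
      unfold tval; simpl. unfold phase at 1; simpl.
      set (F := factor kap (Term _ _ _ _ _) I).
      rewrite (fprod_split n kap F Hkap), (fprod_split n kap (factor kap t I) Hkap).
      rewrite (fprod_ext n (fun i => if Nat.eqb i kap then 1 else F i)
        (fun i => if Nat.eqb i kap then 1 else factor kap t I i)).
      2:{ intros i Hi. unfold F, factor; simpl. destruct (Nat.eqb i kap); easy. }
      set (Q := fprod n (fun i => if Nat.eqb i kap then 1 else factor kap t I i)).
      unfold F, factor; simpl. rewrite Nat.eqb_refl.
      replace (td t - PI / 2 + PI / 2) with (td t) by ring. fold (phase n t phi).
      replace (- (tm t + 1))%Z with (- tm t + - 1)%Z by lia.
      rewrite plus_IZR, Rpower_plus. change (IZR (-1)) with (- (1)).
      rewrite Rpower_Ropp, Rpower_1 by easy.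
      field. split; [lra|]. now apply not_0_IZR. }
  rewrite E. rewrite eval_cons. unfold mean; simpl. destruct (Z.eqb (tq t kap) 0);
    rewrite ?eval_cons; unfold peval; simpl; ring.
Qed.

(** At order 0 the bracket is that of J with an average free of the fast angle, hence zero. Both
    arguments are transported along the same G, so their bracket is too, and zero stays zero. *)
Lemma cauchy_bracket_Xs_ws j m I phi : 0 < I kap ->
  eval (lsum (S m) (fun i => br (Xs i) (Phi Gs (ws j) (m - i)%nat))) I phi = 0.
Proof.
  revert I phi. induction m as [m IH] using (well_founded_induction lt_wf); intros I phi HJ.
  destruct m as [|m].
  - simpl. unfold Xs. rewrite !Phi_0, ws_eq, br_anti, eval_br_Jp, dphi_mean by easy.
    unfold peval; simpl; ring.
  - assert (Hm : 0 < INR (S m)) by (apply lt_0_INR; lia).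
    apply Rmult_eq_reg_l with (INR (S m)); [|lra]. rewrite Rmult_0_r.
    rewrite (cauchy_bracket_transport Gs Xs (Phi Gs (ws j)) (fun _ => []) m I phi HJ).
    + rewrite !fsum_zero; [ring| |].
      * intros; apply eval_br_nil_r.
      * intros l Hl. rewrite (br_eqv n kap Hkap _ (Gs l) _ []); try easy.
        -- apply eval_br_nil_r.
        -- intros I' phi' H'. rewrite IH; [easy|lia|easy].
    + apply Phi_S_eqv.
    + intros i. rewrite app_nil_r. apply Phi_S_eqv.
Qed.

Definition Hstream (i : nat) : tpoly :=
  match i with O => ham_fast | 1%nat => P | _ => [] end.

(** The equation for which [rhs] was designed. H is not transported along G; its defect is the sum
    of the transported averages. *)
Lemma Hstream_defect i : eqv (pscal (INR (S i)) (Hstream (S i)))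
  (lsum (S i) (fun l => br (Gs l) (Hstream (i - l)%nat))
   ++ lsum (S i) (fun j => Phi Gs (ws j) (i - j)%nat)).
Proof.
  intros I phi HJ. rewrite eval_scal, eval_app, !eval_lsum.
  cbn [fsum]. rewrite Nat.sub_diag, Phi_0. cbn [Hstream].
  assert (E : eval (br (Gs i) ham_fast) I phi = eval (rhs Gs ws i) I phi - eval (ws i) I phi).
  { rewrite Gs_eq, homological by easy. rewrite <- ws_eq. easy. }
  rewrite E. unfold rhs. rewrite eval_app, eval_scal, eval_lsum.
  destruct i as [|i].
  - simpl. ring.
  - cbn [fsum]. replace (S i - i)%nat with 1%nat by lia. cbn [Hstream].
    rewrite eval_scal.
    rewrite (fsum_zero i (fun l => eval (br (Gs l) (Hstream (S i - l)%nat)) I phi)).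
    + change (eval [] I phi) with 0. ring.
    + intros l Hl. replace (S i - l)%nat with (S (S (i - S l))) by lia.
      apply eval_br_nil_r.
Qed.

(** The bracket of X with H obeys the transport equation with source {X, transported averages}. The
    source vanishes by [cauchy_bracket_Xs_ws], and the bracket starts at {J, J^2/2} = 0. *)
Lemma cauchy_bracket_Xs_H m I phi : 0 < I kap ->
  eval (lsum (S m) (fun i => br (Xs i) (Hstream (m - i)%nat))) I phi = 0.
Proof.
  revert I phi. induction m as [m IH] using (well_founded_induction lt_wf); intros I phi HJ.
  destruct m as [|m].
  - simpl. rewrite eval_br_H0 by easy. change (dphi kap (Xs 0)) with (@nil term).
    unfold peval; simpl; ring.
  - assert (Hm : 0 < INR (S m)) by (apply lt_0_INR; lia).
    apply Rmult_eq_reg_l with (INR (S m)); [|lra]. rewrite Rmult_0_r.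
    rewrite (cauchy_bracket_transport Gs Xs Hstream
      (fun i => lsum (S i) (fun j => Phi Gs (ws j) (i - j)%nat)) m I phi HJ).
    3: apply Hstream_defect.
    2: apply Phi_S_eqv.
    rewrite fsum_zero, Rplus_0_l.
    + transitivity (fsum (S m) (fun i => fsum (S (m - i)) (fun l =>
        (fun l' i' r' => eval (br (Xs i') (Phi Gs (ws l') r')) I phi) l i (m - i - l)%nat))).
      { apply fsum_ext; intros i Hi. rewrite eval_br_lsum_r. easy. }
      rewrite (fsum_triangle_swap m (fun l' i' r' => eval (br (Xs i') (Phi Gs (ws l') r')) I phi)).
      apply fsum_zero; intros l Hl.
      rewrite <- (cauchy_bracket_Xs_ws l (m - l) I phi HJ), eval_lsum. easy.
    + intros l Hl. rewrite (br_eqv n kap Hkap _ (Gs l) _ []); try easy.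
      * apply eval_br_nil_r.
      * intros I' phi' H'. rewrite IH; [easy|lia|easy].
Qed.

Lemma Xs_recursion m I phi : 0 < I kap ->
  eval (br (Xs (S m)) ham_fast) I phi + eval (br (Xs m) P) I phi = 0.
Proof.
  intros HJ. rewrite <- (cauchy_bracket_Xs_H (S m) I phi HJ), eval_lsum.
  cbn [fsum]. rewrite Nat.sub_diag. replace (S m - m)%nat with 1%nat by lia. cbn [Hstream].
  rewrite fsum_zero; [ring|]. intros i Hi.
  replace (S m - i)%nat with (S (S (m - S i))) by lia. apply eval_br_nil_r.
Qed.

(** At eps = 1 consecutive orders cancel through [Xs_recursion]. The sum telescopes, and truncation
    leaves the one bracket whose partner was cut off. *)
Lemma adiabatic_invariant M I phi : 0 < I kap ->
  eval (br (lsum (S M) Xs) (ham_fast ++ P)) I phi = eval (br (Xs M) P) I phi.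
Proof.
  intros HJ. rewrite eval_br_lsum_l. induction M as [|M IH].
  - cbn [fsum]. rewrite Rplus_0_l, eval_br_app_r, eval_br_H0 by easy.
    change (dphi kap (Xs 0)) with (@nil term). change (eval [] I phi) with 0. ring.
  - change (fsum (S (S M)) (fun l => eval (br (Xs l) (ham_fast ++ P)) I phi)) with
      (fsum (S M) (fun l => eval (br (Xs l) (ham_fast ++ P)) I phi) + eval (br (Xs (S M)) (ham_fast ++ P)) I phi).
    rewrite IH, eval_br_app_r. generalize (Xs_recursion M I phi HJ). lra.
Qed.

Lemma Xs_1 I phi : 0 < I kap ->
  I kap * eval (Xs 1) I phi = eval P I phi - eval (mean P) I phi.
Proof.
  intros HJ. unfold Xs. rewrite Phi_S, eval_scal, eval_lsum. simpl fsum.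
  rewrite Phi_0, eval_br_Jp by easy. rewrite <- (homological P I phi HJ), eval_br_H0 by easy.
  rewrite Gs_eq. unfold rhs. rewrite app_nil_r. simpl. field.
Qed.

End Deprit.

(** * Order in 1/J and locality along the chain *)

Lemma in_lsum t p F : In t (lsum p F) -> exists l, (l < p)%nat /\ In t (F l).
Proof.
  induction p as [|p IH]; simpl; [easy|]. intros H.
  apply in_app_or in H. destruct H as [H|H].
  - destruct (IH H) as [l [Hl Ht]]. exists l. split; [lia|easy].
  - exists p. split; [lia|easy].
Qed.

Lemma in_pscal t c f : In t (pscal c f) -> exists s, In s f /\ t = scal_term c s.
Proof.
  intros H. apply in_map_iff in H. destruct H as [s [E Hs]]. exists s; easy.
Qed.

Lemma in_mul_term t s r : In t (mul_term s r) ->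
  tm t = (tm s + tm r)%Z /\
  (forall i, ta t i <> 0%nat -> ta s i <> 0%nat \/ ta r i <> 0%nat) /\
  (forall i, tq t i <> 0%Z -> tq s i <> 0%Z \/ tq r i <> 0%Z).
Proof.
  intros [<-|[<-|[]]]; simpl; (split; [easy|split; intros i; lia]).
Qed.

Lemma in_pmul t f g : In t (pmul f g) ->
  exists s r, In s f /\ In r g /\ In t (mul_term s r).
Proof.
  intros H. apply in_flat_map in H. destruct H as [s [Hs H]].
  apply in_flat_map in H. destruct H as [r [Hr H]]. exists s, r; easy.
Qed.

Lemma in_dphi s j f : In s (dphi j f) -> exists t, In t f /\
  tq t j <> 0%Z /\ tm s = tm t /\ ta s = ta t /\ tq s = tq t.
Proof.
  intros H. apply in_flat_map in H. destruct H as [t [Ht H]]. exists t. split; [easy|].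
  unfold dphi_term in H. destruct (Z.eqb_spec (tq t j) 0) as [E|E]; [easy|].
  destruct H as [<-|[]]. simpl. easy.
Qed.

Lemma in_dI kap s j f : In s (pdI kap j f) -> exists t, In t f /\ tq s = tq t /\
  (forall i, ta s i <> 0%nat -> ta t i <> 0%nat) /\
  ((j = kap /\ tm s = (tm t + 1)%Z /\ tm t <> 0%Z)
   \/ (j <> kap /\ tm s = tm t /\ ta t j <> 0%nat)).
Proof.
  intros H. apply in_flat_map in H. destruct H as [t [Ht H]]. exists t. split; [easy|].
  unfold dI_term in H. destruct (Nat.eqb_spec j kap) as [E|E].
  - destruct (Z.eqb_spec (tm t) 0) as [E'|E']; [easy|].
    destruct H as [<-|[]]. simpl. split; [easy|split; [easy|]]. left; easy.
  - destruct (Nat.eqb_spec (ta t j) 0) as [E'|E']; [easy|].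
    destruct H as [<-|[]]. simpl. split; [easy|split].
    + intros i. destruct (Nat.eqb i j); lia.
    + right; easy.
Qed.

Section Classes.
Variables n kap : nat.

Local Notation eval := (peval n kap).
Local Notation br := (pbr n kap).
Local Notation dI := (pdI kap).
Local Notation eqv := (peqv n kap).

(** The copy [t'] absorbs the sign of the second half of the bracket, which alters the coefficient
    only. *)
Lemma in_br t f g : In t (br f g) -> exists j s r t', (j < n)%nat /\
  tm t = tm t' /\ ta t = ta t' /\ tq t = tq t' /\ In t' (mul_term s r) /\
  ((In s (dphi j f) /\ In r (dI j g)) \/ (In s (dI j f) /\ In r (dphi j g))).
Proof.
  intros H. apply in_lsum in H. destruct H as [j [Hj H]].
  apply in_app_or in H. destruct H as [H|H].
  - apply in_pmul in H. destruct H as [s [r [Hs [Hr H]]]].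
    exists j, s, r, t. repeat split; auto.
  - apply in_pscal in H. destruct H as [t' [H ->]].
    apply in_pmul in H. destruct H as [s [r [Hs [Hr H]]]].
    exists j, s, r, t'. repeat split; auto.
Qed.

(* Order at least p in 1/J, and a dependence on I_j, resp. phi_j, with j < kap is allowed only
   from order 2 (kap - j) - d, resp. 2 (kap - j) - 1 - d, on: each bracket with the Hamiltonian
   reaches one variable further down the chain I_kap, phi_(kap-1), I_(kap-1), phi_(kap-2), ... *)
Definition term_cls (d p : Z) (t : term) : Prop :=
  (p <= tm t)%Z /\ forall j, (j < kap)%nat ->
    (ta t j <> 0%nat -> (2 * (Z.of_nat kap - Z.of_nat j) <= tm t + d)%Z) /\
    (tq t j <> 0%Z -> (2 * (Z.of_nat kap - Z.of_nat j) - 1 <= tm t + d)%Z).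

Definition cls (d p : Z) (f : tpoly) : Prop := forall t, In t f -> term_cls d p t.

Lemma cls_app d p f g : cls d p f -> cls d p g -> cls d p (f ++ g).
Proof. intros Hf Hg t Ht. apply in_app_or in Ht. destruct Ht; auto. Qed.

Lemma cls_pscal d p c f : cls d p f -> cls d p (pscal c f).
Proof.
  intros Hf t Ht. apply in_pscal in Ht. destruct Ht as [s [Hs ->]]. exact (Hf s Hs).
Qed.

Lemma cls_lsum d p q F : (forall l, (l < q)%nat -> cls d p (F l)) -> cls d p (lsum q F).
Proof.
  intros H t Ht. apply in_lsum in Ht. destruct Ht as [l [Hl Ht]]. exact (H l Hl t Ht).
Qed.

Lemma cls_dphi d p j f : cls d p f -> cls d p (dphi j f).
Proof.
  intros Hf s Hs. apply in_dphi in Hs. destruct Hs as [t [Ht [_ [E1 [E2 E3]]]]].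
  unfold term_cls. rewrite E1, E2, E3. apply Hf; easy.
Qed.

Lemma cls_dI d p j f : cls d p f -> cls d p (dI j f).
Proof.
  intros Hf s Hs. apply in_dI in Hs. destruct Hs as [t [Ht [E1 [E2 E3]]]].
  destruct (Hf t Ht) as [H1 H2]. split; [lia|]. intros i Hi. destruct (H2 i Hi) as [Ha Hq].
  rewrite E1. split; intros H.
  - specialize (Ha (E2 i H)). lia.
  - specialize (Hq H). lia.
Qed.

(** A variable of the product occurs in one factor. The order of the other factor is added to the
    total order, so it can pay for the difference between that factor's allowance and D. *)
Lemma mul_term_cls d p d' p' D s r t :
  term_cls d p s -> term_cls d' p' r -> (d <= D + p')%Z -> (d' <= D + p)%Z ->
  In t (mul_term s r) -> term_cls D (p + p') t.
Proof.
  intros [Hs1 Hs2] [Hr1 Hr2] Hd Hd' Ht. apply in_mul_term in Ht. destruct Ht as [E1 [E2 E3]].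
  split; [lia|]. intros j Hj. destruct (Hs2 j Hj) as [Hsa Hsq]. destruct (Hr2 j Hj) as [Hra Hrq].
  split; intros H.
  - destruct (E2 j H) as [H'|H']; [specialize (Hsa H')|specialize (Hra H')]; lia.
  - destruct (E3 j H) as [H'|H']; [specialize (Hsq H')|specialize (Hrq H')]; lia.
Qed.

Lemma term_cls_copy d p t t' : tm t = tm t' -> ta t = ta t' -> tq t = tq t' ->
  term_cls d p t' -> term_cls d p t.
Proof. intros E1 E2 E3 H. unfold term_cls. rewrite E1, E2, E3. exact H. Qed.

Lemma br_cls d p p' f g : (0 <= d <= 1)%Z -> (1 <= p)%Z -> (0 <= p')%Z ->
  cls 0 p f -> cls d p' g -> cls d (p + p') (br f g).
Proof.
  intros Hd Hp Hp' Hf Hg t Ht. apply in_br in Ht.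
  destruct Ht as [j [s [r [t' [Hj [E1 [E2 [E3 [Hm H]]]]]]]]].
  apply (term_cls_copy d (p + p') t t' E1 E2 E3).
  apply (mul_term_cls 0 p d p' d s r); try easy; try lia; destruct H as [[Hs Hr]|[Hs Hr]].
  - exact (cls_dphi 0 p j f Hf s Hs).
  - exact (cls_dI 0 p j f Hf s Hs).
  - exact (cls_dI d p' j g Hg r Hr).
  - exact (cls_dphi d p' j g Hg r Hr).
Qed.

Lemma br_cls_Jp p f : (0 <= p)%Z -> cls 0 p f -> cls 0 p (br f Jp).
Proof.
  intros Hp Hf t Ht. apply in_br in Ht.
  destruct Ht as [j [s [r [t' [Hj [E1 [E2 [E3 [Hm H]]]]]]]]].
  apply (term_cls_copy 0 p t t' E1 E2 E3). rewrite <- (Z.add_0_r p).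
  destruct H as [[Hs Hr]|[Hs Hr]]; [|easy].
  apply (mul_term_cls 0 p 0 0 0 s r); try easy; try lia.
  - exact (cls_dphi 0 p j f Hf s Hs).
  - apply in_dI in Hr. destruct Hr as [u [[<-|[]] [F1 [F2 F3]]]].
    split.
    + destruct F3 as [[_ [F3 _]]|[_ [_ F3]]]; [|easy]. rewrite F3; simpl; lia.
    + intros i Hi. split; intros H.
      * now specialize (F2 i H).
      * rewrite F1 in H. easy.
Qed.

(** The division by J gains one order, exactly the unit of allowance that a bracket with the
    perturbation costs. *)
Lemma hom_cls p f : cls 1 p f -> cls 0 (p + 1) (hom kap f).
Proof.
  intros Hf s Hs. apply in_flat_map in Hs. destruct Hs as [t [Ht H]].
  unfold hom_term in H. destruct (Z.eqb (tq t kap) 0); [easy|].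
  destruct H as [<-|[]]. destruct (Hf t Ht) as [H1 H2].
  split; cbn [tm ta tq tc td]; [lia|]. intros j Hj. destruct (H2 j Hj) as [Ha Hq].
  split; intros H; [specialize (Ha H)|specialize (Hq H)]; lia.
Qed.

Lemma mean_cls d p f : cls d p f -> cls d p (mean kap f).
Proof. intros Hf t Ht. apply filter_In in Ht. apply Hf; easy. Qed.

(** * The perturbation, and the reach of its brackets *)

Variable UU : nat -> tpoly.
Hypothesis HUU : forall l t, In t (UU l) ->
  tm t = 0%Z /\ (forall j, ta t j = 0%nat) /\ (forall j, tq t j <> 0%Z -> j = l \/ j = S l).

Definition kinetic (j : nat) : term :=
  Term (1 / 2) 0 (fun i => if Nat.eqb i j then 2%nat else 0%nat) (fun _ => 0%Z) 0.

Definition Pk : tpoly := lsum n (fun j => if Nat.eqb j kap then [] else [kinetic j]).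
Definition Pu : tpoly := lsum (n - 1) UU.
Definition Pp : tpoly := Pk ++ Pu.

Lemma in_Pp t : In t Pp ->
  (exists j, j <> kap /\ (j < n)%nat /\ t = kinetic j) \/ (exists l, In t (UU l)).
Proof.
  intros H. apply in_app_or in H. destruct H as [H|H].
  - left. apply in_lsum in H. destruct H as [j [Hj H]]. exists j.
    destruct (Nat.eqb_spec j kap) as [E|E]; [easy|]. destruct H as [<-|[]]. easy.
  - right. apply in_lsum in H. destruct H as [l [_ H]]. exists l; easy.
Qed.

(** The thresholds of phi_j, I_j, phi_(j-1) are consecutive integers. A kinetic term replaces phi_j
    by I_j and a bond replaces I_j by neighbouring angles, so one bracket moves at most one
    threshold down the chain, while the order need not grow: the allowance rises from 0 to 1. *)
Lemma br_cls_Pp p f g : (1 <= p)%Z -> cls 0 p f -> incl g Pp -> cls 1 p (br f g).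
Proof.
  intros Hp Hf Hg t Ht. apply in_br in Ht.
  destruct Ht as [j [s [r [t' [Hj [E1 [E2 [E3 [Hm H]]]]]]]]].
  apply (term_cls_copy 1 p t t' E1 E2 E3). clear t E1 E2 E3.
  apply in_mul_term in Hm. destruct Hm as [E1 [E2 E3]].
  destruct H as [[Hs Hr]|[Hs Hr]].
  - apply in_dphi in Hs. destruct Hs as [u [Hu [Hq [F1 [F2 F3]]]]].
    apply in_dI in Hr. destruct Hr as [v [Hv [K1 [K2 K3]]]].
    destruct (Hf u Hu) as [Hu1 Hu2].
    destruct (in_Pp v (Hg v Hv)) as [[j' [Hj1 [Hj2 ->]]]|[l Hl]].
    + assert (tm r = 0%Z /\ j = j') as [Hr0 <-].
      { simpl in K3. destruct K3 as [[_ [_ K3]]|[_ [K3 K4]]]; [easy|].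
        split; [easy|]. destruct (Nat.eqb_spec j j'); easy. }
      split; [lia|]. intros i Hi. destruct (Hu2 i Hi) as [Ha Hb].
      rewrite F2, F3 in *. split; intros H.
      * destruct (E2 i H) as [H'|H'].
        -- specialize (Ha H'). lia.
        -- specialize (K2 i H'). simpl in K2. destruct (Nat.eqb_spec i j) as [Eij|]; [|easy].
           rewrite Eij in Hb |- *. specialize (Hb Hq). lia.
      * destruct (E3 i H) as [H'|H'].
        -- specialize (Hb H'). lia.
        -- rewrite K1 in H'. easy.
    + exfalso. destruct (HUU l v Hl) as [L1 [L2 _]].
      destruct K3 as [[_ [_ K3]]|[_ [_ K3]]]; [easy|]. apply K3, L2.
  - apply in_dI in Hs. destruct Hs as [u [Hu [F1 [F2 F3]]]].
    apply in_dphi in Hr. destruct Hr as [v [Hv [Hq [K1 [K2 K3]]]]].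
    destruct (Hf u Hu) as [Hu1 Hu2].
    destruct (in_Pp v (Hg v Hv)) as [[j' [Hj1 [Hj2 ->]]]|[l Hl]]; [easy|].
    destruct (HUU l v Hl) as [L1 [L2 L3]].
    split; [lia|]. intros i Hi. destruct (Hu2 i Hi) as [Ha Hb].
    rewrite F1, K2, K3 in *. split; intros H.
    + destruct (E2 i H) as [H'|H'].
      * specialize (Ha (F2 i H')). lia.
      * now specialize (L2 i).
    + destruct (E3 i H) as [H'|H'].
      * specialize (Hb H'). lia.
      * specialize (L3 i H') as L4. specialize (L3 j Hq).
        (* If j = kap, the only new angle below kap is phi_(kap-1), whose threshold 1 is met. Sites
           beyond kap touch no angle below kap, and sites below it use the threshold of I_j. *)
        destruct F3 as [[F3 [F4 _]]|[F3 [F4 F5]]].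
        -- lia.
        -- destruct (Nat.lt_ge_cases j kap) as [Hjk|Hjk]; [|lia].
           destruct (Hu2 j Hjk) as [Ha' _]. specialize (Ha' F5). lia.
Qed.

Lemma hom_cls_Pp : cls 0 1 (hom kap Pp).
Proof.
  intros s Hs. apply in_flat_map in Hs. destruct Hs as [t [Ht H]].
  unfold hom_term in H. destruct (Z.eqb_spec (tq t kap) 0) as [E|E]; [easy|].
  destruct H as [<-|[]].
  destruct (in_Pp t Ht) as [[j' [Hj1 [Hj2 ->]]]|[l Hl]]; [easy|].
  destruct (HUU l t Hl) as [L1 [L2 L3]].
  split; cbn [tm ta tq tc td]; [lia|]. intros j Hj. split; intros H.
  - now specialize (L2 j).
  - specialize (L3 kap E) as L4. specialize (L3 j H). lia.
Qed.

Local Notation Gs_ := (Gs n kap Pp).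
Local Notation ws_ := (ws n kap Pp).
Local Notation Xs_ := (Xs n kap Pp).
Local Notation Phi_ := (Phi n kap).

(** The zeroth average is part of the perturbation and holds slow kinetic energies already at order
    0, so in general it satisfies no bound of the form [cls 1 0]. A bracket with it nevertheless
    costs the same as one with the perturbation. *)
Definition wcls (p : Z) (w : tpoly) : Prop := (p = 0%Z /\ incl w Pp) \/ ((0 <= p)%Z /\ cls 1 p w).

Lemma br_wcls q p f w : (1 <= q)%Z -> cls 0 q f -> wcls p w -> cls 1 (q + p) (br f w).
Proof.
  intros Hq Hf [[-> Hw]|[Hp Hw]].
  - rewrite Z.add_0_r. apply br_cls_Pp; easy.
  - apply br_cls; easy.
Qed.

Lemma Phi_wcls (G : nat -> tpoly) w p i : (0 <= p)%Z ->
  (forall l, (l < i)%nat -> cls 0 (Z.of_nat l + 1) (G l)) -> wcls p w ->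
  wcls (p + Z.of_nat i) (Phi_ G w i) /\ ((1 <= i)%nat -> cls 1 (p + Z.of_nat i) (Phi_ G w i)).
Proof.
  intros Hp. induction i as [i IH] using (well_founded_induction lt_wf); intros HG Hw.
  destruct i as [|i].
  - rewrite Phi_0, Z.add_0_r. split; [easy|lia].
  - assert (H : cls 1 (p + Z.of_nat (S i)) (Phi_ G w (S i))).
    { rewrite Phi_S. apply cls_pscal, cls_lsum. intros l Hl.
      replace (p + Z.of_nat (S i))%Z with ((Z.of_nat l + 1) + (p + Z.of_nat (i - l)))%Z by lia.
      apply br_wcls; [lia|apply HG; lia|].
      refine (proj1 (IH (i - l)%nat _ _ Hw)); [lia|]. intros; apply HG; lia. }
    split; [right; split; [lia|easy]|easy].
Qed.

(** Joint induction: the right-hand side at order m has allowance 1, which the average keeps;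
    solving the homological equation brings the generator back to allowance 0 at order m + 1. *)
Lemma GW_cls m : cls 0 (Z.of_nat m + 1) (Gs_ m) /\ wcls (Z.of_nat m) (ws_ m).
Proof.
  induction m as [m IH] using (well_founded_induction lt_wf).
  destruct m as [|m].
  - rewrite Gs_eq, ws_eq. unfold rhs. rewrite app_nil_r. split.
    + apply hom_cls_Pp.
    + left. split; [easy|]. intros t Ht. apply filter_In in Ht; easy.
  - assert (H : cls 1 (Z.of_nat (S m)) (rhs n kap Pp Gs_ ws_ (S m))).
    { unfold rhs. apply cls_app; apply cls_pscal.
      - replace (Z.of_nat (S m)) with (Z.of_nat m + 1)%Z by lia.
        apply br_cls_Pp; [lia|apply IH; lia|apply incl_refl].
      - apply cls_lsum. intros j Hj.
        replace (Z.of_nat (S m)) with (Z.of_nat j + Z.of_nat (S m - j))%Z by lia.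
        apply Phi_wcls; [lia| |apply IH; lia|lia].
        intros l Hl. apply IH; lia. }
    rewrite Gs_eq, ws_eq. split.
    + apply hom_cls; easy.
    + right. split; [lia|]. apply mean_cls; easy.
Qed.

Lemma Xs_cls i : (1 <= i)%nat -> cls 0 (Z.of_nat i) (Xs_ i).
Proof.
  induction i as [i IH] using (well_founded_induction lt_wf); intros Hi.
  destruct i as [|i]; [lia|]. unfold Xs. rewrite Phi_S.
  apply cls_pscal, cls_lsum. intros l Hl. destruct (GW_cls l) as [HG _].
  destruct (Nat.eq_dec l i) as [->|Hne].
  - rewrite Nat.sub_diag, Phi_0.
    replace (Z.of_nat (S i)) with (Z.of_nat i + 1)%Z by lia.
    apply br_cls_Jp; [lia|easy].
  - replace (Z.of_nat (S i)) with ((Z.of_nat l + 1) + Z.of_nat (i - l))%Z by lia.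
    apply br_cls; try lia; [easy|]. apply IH; lia.
Qed.

Lemma Xs_dI_0_cls i : (1 <= kap)%nat -> forall t, In t (dI 0 (Xs_ i)) ->
  (2 * Z.of_nat kap <= tm t)%Z.
Proof.
  intros Hk t Ht. destruct i as [|i].
  - change (In t (dI 0 Jp)) in Ht. unfold Jp in Ht. rewrite dI_pure_J in Ht by lia. easy.
  - apply in_dI in Ht. destruct Ht as [u [Hu [E1 [E2 E3]]]].
    destruct E3 as [E3|[_ [E3 E4]]]; [lia|].
    destruct (Xs_cls (S i)) with (t := u) as [_ H]; [lia|easy|].
    destruct (H 0%nat) as [Ha _]; [lia|]. specialize (Ha E4). lia.
Qed.

(** * From order in 1/J to numerical bounds *)

Lemma fprod_abs_le m f g : (forall i, (i < m)%nat -> Rabs (f i) <= g i) ->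
  Rabs (fprod m f) <= fprod m g.
Proof.
  induction m as [|m IH]; intros H; simpl; [rewrite Rabs_R1; lra|].
  rewrite Rabs_mult. apply Rmult_le_compat; auto using Rabs_pos.
Qed.

Hypothesis Hkap : (kap < n)%nat.

Lemma eval_bound r f p : (forall t, In t f -> (Z.of_nat p <= tm t)%Z) ->
  exists C, 0 <= C /\ forall I phi, 1 <= I kap ->
    (forall j, (j < n)%nat -> j <> kap -> Rabs (I j) <= r) ->
    Rabs (eval f I phi) <= C * (/ I kap) ^ p.
Proof.
  induction f as [|t f IH]; intros H.
  - exists 0. split; [lra|]. intros I phi _ _. unfold peval; simpl. rewrite Rabs_R0. lra.
  - destruct IH as [C [HC HB]]; [intros; apply H; now right|].
    set (K := fprod n (fun i => if Nat.eqb i kap then 1 else Rabs r ^ ta t i)).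
    exists (Rabs (tc t) * Rabs K + C). split.
    { generalize (Rmult_le_pos _ _ (Rabs_pos (tc t)) (Rabs_pos K)). lra. }
    intros I phi HJ HI. rewrite eval_cons.
    eapply Rle_trans; [apply Rabs_triang|]. rewrite Rmult_plus_distr_r.
    apply Rplus_le_compat; [|apply HB; easy].
    unfold tval. rewrite !Rabs_mult.
    assert (Hc : Rabs (cos (phase n t phi)) <= 1).
    { apply Rabs_le. generalize (COS_bound (phase n t phi)). lra. }
    assert (Hpw : 0 < (/ I kap) ^ p) by (apply pow_lt, Rinv_0_lt_compat; lra).
    assert (Hf : Rabs (fprod n (factor kap t I)) <= (/ I kap) ^ p * K).
    { rewrite (fprod_split n kap) by easy. rewrite Rabs_mult.
      apply Rmult_le_compat; try apply Rabs_pos.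
      - unfold factor. rewrite Nat.eqb_refl. unfold Rpower at 1.
        rewrite Rabs_pos_eq by (left; apply exp_pos).
        fold (Rpower (I kap) (IZR (- tm t))).
        rewrite pow_inv, <- Rpower_pow by lra. rewrite <- Rpower_Ropp.
        apply Rle_Rpower; [easy|]. rewrite INR_IZR_INZ, <- opp_IZR. apply IZR_le.
        specialize (H t (or_introl eq_refl)). lia.
      - apply fprod_abs_le. intros i Hi. unfold factor.
        destruct (Nat.eqb_spec i kap) as [E|E]; [rewrite Rabs_R1; lra|].
        rewrite <- RPow_abs. apply pow_incr. split; [apply Rabs_pos|].
        eapply Rle_trans; [apply HI; easy|]. apply Rle_abs. }
    assert (HK : K <= Rabs K) by apply Rle_abs.
    apply Rle_trans with (Rabs (tc t) * ((/ I kap) ^ p * K) * 1).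
    + apply Rmult_le_compat; try easy; try apply Rabs_pos.
      * apply Rmult_le_pos; apply Rabs_pos.
      * apply Rmult_le_compat_l; [apply Rabs_pos|easy].
    + rewrite Rmult_1_r. rewrite (Rmult_comm _ K), <- Rmult_assoc.
      apply Rmult_le_compat_r; [lra|]. apply Rmult_le_compat_l; [apply Rabs_pos|easy].
Qed.

(* The first correction is V / J, whose size does not depend on the slow actions. *)
Lemma Xs_1_bound : exists C, 0 <= C /\ forall I phi, 0 < I kap ->
  Rabs (eval (Xs_ 1) I phi) <= C / I kap.
Proof.
  assert (H : exists C, 0 <= C /\ forall I phi, 0 < I kap ->
    Rabs (eval Pp I phi - eval (mean kap Pp) I phi) <= C).
  (* Induction over lists contained in [Pp]. Terms without the fast angle cancel against the mean;
     the others come from bonds and contain no action, so cos <= 1 is enough. *)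
  { assert (Hg : incl Pp Pp) by apply incl_refl. revert Hg. generalize Pp at 1 3 4 as f.
    induction f as [|t f IH]; intros Hg.
    - exists 0. split; [lra|]. intros. unfold peval; simpl. rewrite Rminus_0_r, Rabs_R0; lra.
    - destruct IH as [C [HC HB]]; [intros u Hu; apply Hg; now right|].
      destruct (Z.eqb_spec (tq t kap) 0) as [E|E].
      + exists C. split; [easy|]. intros I phi HJ. unfold mean; simpl.
        rewrite (proj2 (Z.eqb_eq _ _) E).
        change (Rabs (tval n kap t I phi + eval f I phi - (tval n kap t I phi + eval (mean kap f) I phi)) <= C).
        replace (_ + _ - _) with (eval f I phi - eval (mean kap f) I phi) by ring. apply HB; easy.
      + exists (Rabs (tc t) + C). split; [generalize (Rabs_pos (tc t)); lra|].
        intros I phi HJ. unfold mean; simpl. rewrite (proj2 (Z.eqb_neq _ _) E).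
        change (Rabs (tval n kap t I phi + eval f I phi - eval (mean kap f) I phi) <= Rabs (tc t) + C).
        replace (_ + _ - _) with (tval n kap t I phi + (eval f I phi - eval (mean kap f) I phi)) by ring.
        eapply Rle_trans; [apply Rabs_triang|]. apply Rplus_le_compat; [|apply HB; easy].
        destruct (in_Pp t (Hg t (or_introl eq_refl))) as [[j' [_ [_ ->]]]|[l Hl]]; [easy|].
        destruct (HUU l t Hl) as [L1 [L2 _]]. unfold tval.
        rewrite fprod_one, Rmult_1_r, Rabs_mult.
        * rewrite <- (Rmult_1_r (Rabs (tc t))) at 2. apply Rmult_le_compat_l; [apply Rabs_pos|].
          apply Rabs_le. generalize (COS_bound (phase n t phi)). lra.
        * intros i Hi. unfold factor. rewrite L1, L2. destruct (Nat.eqb_spec i kap) as [->|Hik].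
          -- apply Rpower_O; easy.
          -- easy. }
  destruct H as [C [HC HB]]. exists C. split; [easy|]. intros I phi HJ.
  specialize (HB I phi HJ). rewrite <- (Xs_1 n kap Pp Hkap I phi HJ) in HB.
  rewrite Rabs_mult, (Rabs_pos_eq (I kap)) in HB by lra.
  apply Rmult_le_reg_l with (I kap); [easy|]. replace (I kap * (C / I kap)) with C by (field; lra). easy.
Qed.

End Classes.

(** * The potentials *)

Lemma finite_modes_bound U : finite_modes_no_const U ->
  exists B, 0 <= B /\ forall x, Rabs (U x) <= B.
Proof.
  intros [M [a [b HU]]].
  exists (fsum M (fun m => Rabs (a (S m)) + Rabs (b (S m)))). split.
  - apply fsum_nonneg. intros i _. generalize (Rabs_pos (a (S i))) (Rabs_pos (b (S i))). lra.
  - intros x. rewrite HU. clear HU. induction M as [|M IH]; cbn [fsum]; [rewrite Rabs_R0; lra|].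
    eapply Rle_trans; [apply Rabs_triang|]. apply Rplus_le_compat; [easy|].
    eapply Rle_trans; [apply Rabs_triang|]. rewrite !Rabs_mult.
    assert (H1 : Rabs (cos (INR (S M) * x)) <= 1)
      by (apply Rabs_le; generalize (COS_bound (INR (S M) * x)); lra).
    assert (H2 : Rabs (sin (INR (S M) * x)) <= 1)
      by (apply Rabs_le; generalize (SIN_bound (INR (S M) * x)); lra).
    generalize (Rmult_le_compat_l _ _ _ (Rabs_pos (a (S M))) H1)
      (Rmult_le_compat_l _ _ _ (Rabs_pos (b (S M))) H2). lra.
Qed.

Lemma finite_modes_derive U : finite_modes_no_const U ->
  exists V, finite_modes_no_const V /\ forall x, is_derive U x (V x).
Proof.
  intros [M [a [b HU]]].
  exists (fun th => fsum M (fun m => (INR (S m) * b (S m)) * cos (INR (S m) * th)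
     + (- INR (S m) * a (S m)) * sin (INR (S m) * th))).
  split.
  - exists M, (fun m => INR m * b m), (fun m => - INR m * a m). easy.
  - intros x. apply is_derive_ext with (fun th => fsum M (fun m =>
      a (S m) * cos (INR (S m) * th) + b (S m) * sin (INR (S m) * th))); [easy|].
    apply (is_derive_fsum M (fun m th => a (S m) * cos (INR (S m) * th) + b (S m) * sin (INR (S m) * th))).
    intros m _. generalize (INR (S m)) (a (S m)) (b (S m)); intros k p q. auto_derive; [easy|]. ring.
Qed.

Lemma finite_modes_ex_derive U : finite_modes_no_const U -> forall x, ex_derive U x.
Proof.
  intros H x. destruct (finite_modes_derive U H) as [V [_ HV]]. exists (V x). apply HV.
Qed.

Lemma finite_modes_Derive U : finite_modes_no_const U -> finite_modes_no_const (Derive U).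
Proof.
  intros H. destruct (finite_modes_derive U H) as [V [[M [a [b E]]] HV]].
  exists M, a, b. intros th. rewrite <- E. apply is_derive_unique, HV.
Qed.

Lemma finite_modes_period U : finite_modes_no_const U ->
  forall x, U (x + 2 * PI) = U x.
Proof.
  intros [M [a [b HU]]] x. rewrite !HU. apply fsum_ext; intros m _.
  replace (INR (S m) * (x + 2 * PI)) with (INR (S m) * x + 2 * INR (S m) * PI) by ring.
  rewrite cos_period, sin_period. easy.
Qed.

Definition bond_mode (l m i : nat) : Z :=
  if Nat.eqb i (S l) then Z.of_nat m else if Nat.eqb i l then (- Z.of_nat m)%Z else 0%Z.

Definition bond_poly (l M : nat) (a b : nat -> R) : tpoly :=
  lsum M (fun m => [Term (a (S m)) 0 (fun _ => 0%nat) (bond_mode l (S m)) 0;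
                    Term (b (S m)) 0 (fun _ => 0%nat) (bond_mode l (S m)) (- (PI / 2))]).

Lemma in_bond_poly l M a b t : In t (bond_poly l M a b) ->
  tm t = 0%Z /\ (forall j, ta t j = 0%nat) /\ (forall j, tq t j <> 0%Z -> j = l \/ j = S l).
Proof.
  intros H. apply in_lsum in H. destruct H as [m [_ H]].
  assert (Hq : forall j, bond_mode l (S m) j <> 0%Z -> j = l \/ j = S l).
  { intros j. unfold bond_mode. destruct (Nat.eqb_spec j (S l)), (Nat.eqb_spec j l); intuition. }
  destruct H as [<-|[<-|[]]]; (split; [easy|split; [easy|exact Hq]]).
Qed.

Lemma eval_bond_term n kap l m c d I phi : (S l < n)%nat -> 0 < I kap ->
  tval n kap (Term c 0 (fun _ => 0%nat) (bond_mode l m) d) I phi =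
  c * cos (INR m * (phi (S l) - phi l) + d).
Proof.
  intros Hl HJ. unfold tval; cbn [tc].
  rewrite fprod_one, Rmult_1_r.
  - unfold phase; cbn [tq td].
    rewrite (fsum_ext n _ (fun i => (if Nat.eqb i (S l) then INR m * phi i else 0)
      + (if Nat.eqb i l then - INR m * phi i else 0))).
    + rewrite fsum_plus, !fsum_delta by lia. do 2 f_equal. ring.
    + intros i Hi. unfold bond_mode.
      destruct (Nat.eqb_spec i (S l)) as [E1|E1], (Nat.eqb_spec i l) as [E2|E2].
      * lia.
      * rewrite <- INR_IZR_INZ. ring.
      * rewrite opp_IZR, <- INR_IZR_INZ. ring.
      * ring.
  - intros i Hi. unfold factor; cbn [tm ta]. destruct (Nat.eqb_spec i kap) as [->|Hne].
    + apply Rpower_O; easy.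
    + easy.
Qed.

Lemma eval_bond_poly n kap l M a b I phi : (S l < n)%nat -> 0 < I kap ->
  peval n kap (bond_poly l M a b) I phi =
  fsum M (fun m => a (S m) * cos (INR (S m) * (phi (S l) - phi l))
                 + b (S m) * sin (INR (S m) * (phi (S l) - phi l))).
Proof.
  intros Hl HJ. unfold bond_poly. rewrite eval_lsum. apply fsum_ext; intros m _.
  rewrite !eval_cons, !eval_bond_term by easy. change (peval n kap [] I phi) with 0.
  rewrite Rplus_0_r, cos_plus, cos_neg, sin_neg, cos_PI2, sin_PI2, Rplus_0_r. ring.
Qed.

Lemma is_derive_increment_ge (f df : R -> R) a b c : a <= b ->
  (forall x, a <= x <= b -> is_derive f x (df x)) -> (forall x, a <= x <= b -> c <= df x) ->
  c * (b - a) <= f b - f a.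
Proof.
  intros Hab Hd Hc.
  destruct (MVT_gen f a b df) as [x [Hx E]].
  - rewrite Rmin_left, Rmax_right by easy. intros x Hx. apply Hd; lra.
  - rewrite Rmin_left, Rmax_right by easy. intros x Hx.
    apply continuity_pt_filterlim, (ex_derive_continuous (K := R_AbsRing) (V := R_NormedModule)).
    exists (df x). apply Hd; lra.
  - rewrite Rmin_left, Rmax_right in Hx by easy. rewrite E.
    apply Rmult_le_compat_r; [lra|apply Hc; easy].
Qed.

(** * Dynamics *)

Lemma dH_dI_eq n U I phi j : (j < n)%nat -> dH_dI n U I phi j = I j.
Proof.
  intros Hj. unfold dH_dI, Ham. apply is_derive_unique. evar_last.
  - apply is_derive_Rplus; [|apply is_derive_Rconst].
    apply is_derive_scal.
    apply (is_derive_fsum n (fun i s => upd I j s i ^ 2) (fun i => if Nat.eqb i j then 2 * I i else 0)).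
    intros i Hi. unfold upd. destruct (Nat.eqb_spec i j) as [->|Hne].
    + auto_derive; [easy|]. simpl; ring.
    + apply is_derive_Rconst.
  - rewrite fsum_delta by easy. field.
Qed.

Lemma dH_dphi_eq n U I phi j :
  (forall l, (l < n - 1)%nat -> finite_modes_no_const (U l)) -> (j < n)%nat ->
  dH_dphi n U I phi j =
  (if Nat.eqb j 0 then 0 else Derive (U (j - 1)%nat) (phi j - phi (j - 1)%nat))
  - (if Nat.ltb j (n - 1) then Derive (U j) (phi (S j) - phi j) else 0).
Proof.
  intros HUm Hj. unfold dH_dphi, Ham. apply is_derive_unique. evar_last.
  - apply is_derive_Rplus; [apply is_derive_Rconst|].
    apply (is_derive_fsum (n - 1) (fun i s => U i (upd phi j s (S i) - upd phi j s i))
      (fun i => (if Nat.eqb (S i) j then Derive (U i) (phi (S i) - phi i) else 0)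
              + (if Nat.eqb i j then - Derive (U i) (phi (S i) - phi i) else 0))).
    intros i Hi.
    assert (HD := Derive_correct _ _ (finite_modes_ex_derive _ (HUm i Hi) (phi (S i) - phi i))).
    evar_last.
    + apply (is_derive_comp (U i) (fun s => upd phi j s (S i) - upd phi j s i)).
      * rewrite !upd_same. exact HD.
      * apply (is_derive_minus (K := R_AbsRing) (V := R_NormedModule)
          (fun s => upd phi j s (S i)) (fun s => upd phi j s i)); apply is_derive_upd.
    + cbv [Hierarchy.scal minus plus opp]; simpl. cbv [mult]; simpl.
      destruct (Nat.eqb_spec i j), j as [|j']; simpl; try lra;
        destruct (Nat.eqb_spec i j'); simpl; try lra; lia.
  - rewrite fsum_plus, Rplus_0_l.
    assert (E1 : fsum (n - 1) (fun i => if Nat.eqb (S i) j then Derive (U i) (phi (S i) - phi i) else 0)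
      = if Nat.eqb j 0 then 0 else Derive (U (j - 1)%nat) (phi j - phi (j - 1)%nat)).
    { destruct j as [|j].
      - apply fsum_zero; easy.
      - cbn [Nat.eqb]. replace (S j - 1)%nat with j by lia.
        rewrite (fsum_delta (n - 1) j (fun i => Derive (U i) (phi (S i) - phi i))) by lia. easy. }
    assert (E2 : fsum (n - 1) (fun i => if Nat.eqb i j then - Derive (U i) (phi (S i) - phi i) else 0)
      = - if Nat.ltb j (n - 1) then Derive (U j) (phi (S j) - phi j) else 0).
    { destruct (Nat.ltb_spec j (n - 1)) as [H|H].
      - rewrite (fsum_delta (n - 1) j (fun i => - Derive (U i) (phi (S i) - phi i))) by lia. easy.
      - rewrite fsum_zero; [ring|]. intros i Hi.
        rewrite (proj2 (Nat.eqb_neq i j)) by lia. easy. }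
    rewrite E1, E2. easy.
Qed.

Section Dynamics.
Variables n kap : nat.
Hypothesis Hkap : (kap < n)%nat.
Variable U : nat -> R -> R.
Variable UU : nat -> tpoly.
Hypothesis HUU : forall l t, In t (UU l) ->
  tm t = 0%Z /\ (forall j, ta t j = 0%nat) /\ (forall j, tq t j <> 0%Z -> j = l \/ j = S l).
Hypothesis HUUe : forall l I phi, (l < n - 1)%nat -> 0 < I kap ->
  peval n kap (UU l) I phi = U l (phi (S l) - phi l).

Local Notation eval := (peval n kap).
Local Notation br := (pbr n kap).
Local Notation dI := (pdI kap).
Local Notation P := (Pp n kap UU).
Local Notation Hp := (ham_fast ++ P).

Lemma eval_kinetic j I phi : (j < n)%nat -> j <> kap -> 0 < I kap ->
  eval [kinetic j] I phi = / 2 * I j ^ 2.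
Proof.
  intros Hj Hjk HJ. rewrite eval_cons. change (eval [] I phi) with 0.
  unfold tval, kinetic, phase; cbn [tc tq td].
  rewrite fsum_zero by (intros; ring). rewrite !Rplus_0_r, cos_0.
  rewrite (fprod_split n j) by easy. rewrite fprod_one.
  - unfold factor; cbn [ta tm]. rewrite Nat.eqb_refl, (proj2 (Nat.eqb_neq _ _) Hjk). lra.
  - intros i Hi. unfold factor; cbn [ta tm].
    destruct (Nat.eqb i j); [easy|]. destruct (Nat.eqb_spec i kap) as [->|]; [|easy].
    apply Rpower_O; easy.
Qed.

Lemma Ham_eval I phi : 0 < I kap -> Ham n U I phi = eval Hp I phi.
Proof.
  intros HJ. unfold Ham, Pp, Pk, Pu. rewrite !eval_app, !eval_lsum, eval_H0 by easy.
  rewrite <- Rplus_assoc. f_equal.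
  - rewrite <- fsum_scal.
    rewrite <- (fsum_delta n kap (fun i => / 2 * I i ^ 2) Hkap), <- fsum_plus.
    apply fsum_ext; intros j Hj. destruct (Nat.eqb_spec j kap) as [->|Hne].
    + change (eval [] I phi) with 0. ring.
    + rewrite eval_kinetic by easy. ring.
  - apply fsum_ext; intros l Hl. rewrite HUUe; easy.
Qed.

Lemma dH_dI_eval I phi j : (j < n)%nat -> 0 < I kap -> dH_dI n U I phi j = eval (dI j Hp) I phi.
Proof.
  intros Hj HJ. unfold dH_dI. apply is_derive_unique.
  apply is_derive_ext_loc with (fun s => eval Hp (upd I j s) phi).
  - generalize (locally_upd_pos kap I j HJ). apply filter_imp; intros s Hs.
    symmetry; apply Ham_eval; easy.
  - apply is_derive_dI; easy.
Qed.

Lemma dH_dphi_eval I phi j : (j < n)%nat -> 0 < I kap ->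
  dH_dphi n U I phi j = eval (dphi j Hp) I phi.
Proof.
  intros Hj HJ. unfold dH_dphi. apply is_derive_unique.
  apply is_derive_ext with (fun s => eval Hp I (upd phi j s)).
  - intros s. symmetry; apply Ham_eval; easy.
  - apply is_derive_dphi; easy.
Qed.

Variable gamma : R.
Variables (I phi : R -> nat -> R) (T : R).
Hypothesis Hsol : solves n U gamma I phi T.

Lemma is_derive_along f t : 0 <= t <= T -> 0 < I t kap ->
  is_derive (fun s => eval f (I s) (phi s)) t
    (eval (br f Hp) (I t) (phi t) - gamma * I t 0%nat * eval (dI 0 f) (I t) (phi t)).
Proof.
  intros Ht HJ. evar_last.
  - apply (is_derive_eval n kap Hkap f I phi t _ _ HJ
      (fun j Hj => proj1 (Hsol t Ht j Hj)) (fun j Hj => proj2 (Hsol t Ht j Hj))).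
  - rewrite eval_br.
    assert (E : gamma * I t 0%nat * eval (dI 0 f) (I t) (phi t) =
      fsum n (fun j => if Nat.eqb j 0 then gamma * I t 0%nat * eval (dI j f) (I t) (phi t) else 0)).
    { rewrite (fsum_delta n 0 (fun j => gamma * I t 0%nat * eval (dI j f) (I t) (phi t))) by lia. easy. }
    rewrite E, <- fsum_minus.
    apply fsum_ext; intros j Hj. rewrite dH_dphi_eval, dH_dI_eval by easy.
    destruct (Nat.eqb j 0); ring.
Qed.

Lemma energy_derive t : 0 <= t <= T -> 0 < I t kap ->
  is_derive (fun s => eval Hp (I s) (phi s)) t (- gamma * I t 0%nat ^ 2).
Proof.
  intros Ht HJ. evar_last; [apply is_derive_along; easy|].
  rewrite <- dH_dI_eval, dH_dI_eq by (easy || lia).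
  assert (E : eval (br Hp Hp) (I t) (phi t) = 0).
  { generalize (br_anti n kap Hp Hp (I t) (phi t)). lra. }
  rewrite E. simpl; ring.
Qed.

End Dynamics.

(** * Stability: the adiabatic invariant traps the energy in the fast site *)

(** Bootstrap with an open condition S and its closed version Q. At the supremum of the times up to
    which S holds, Q survives by closedness, [Hboot] improves it to S, and openness carries S
    further unless that time is T. *)
Lemma continuation (S Q : R -> Prop) T : 0 <= T ->
  S 0 ->
  (forall t, 0 <= t <= T -> S t -> locally t S) ->
  (forall t, 0 < t <= T -> (forall s, 0 <= s < t -> S s) -> Q t) ->
  (forall t, S t -> Q t) ->
  (forall t, 0 <= t <= T -> (forall s, 0 <= s <= t -> Q s) -> S t) ->
  forall t, 0 <= t <= T -> S t.
Proof.
  intros HT HS0 Hopen Hclosed HSQ Hboot.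
  set (A := fun t => 0 <= t <= T /\ forall s, 0 <= s <= t -> S s).
  destruct (completeness A) as [tau [Hub Hlub]].
  { exists T. intros t [Ht _]. lra. }
  { exists 0. split; [lra|]. intros s Hs. replace s with 0 by lra. easy. }
  assert (Htau : 0 <= tau <= T).
  { split.
    - apply Hub. split; [lra|]. intros s Hs. replace s with 0 by lra. easy.
    - apply Hlub. intros t [Ht _]. lra. }
  assert (Hbelow : forall s, 0 <= s < tau -> S s).
  { intros s Hs. apply NNPP; intros HN.
    assert (tau <= s); [|lra]. apply Hlub. intros t [Ht1 Ht2].
    destruct (Rle_or_lt t s) as [H|H]; [easy|]. exfalso. apply HN, Ht2. lra. }
  assert (HStau : S tau).
  { destruct (Rle_lt_or_eq_dec 0 tau (proj1 Htau)) as [H|<-]; [|easy].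
    apply Hboot; [easy|]. intros s Hs. destruct (Rle_lt_or_eq_dec s tau (proj2 Hs)) as [H'| ->].
    - apply HSQ, Hbelow; lra.
    - apply Hclosed; [lra|easy]. }
  assert (Hle : forall s, 0 <= s <= tau -> S s).
  { intros s Hs. destruct (Rle_lt_or_eq_dec s tau (proj2 Hs)) as [H'| ->]; [|easy].
    apply Hbelow; lra. }
  destruct (Rle_lt_or_eq_dec tau T (proj2 Htau)) as [HlT|HeT].
  - exfalso. destruct (Hopen tau Htau HStau) as [eps Heps].
    set (t' := Rmin T (tau + eps / 2)).
    assert (Ht' : tau < t' <= T /\ t' <= tau + eps / 2).
    { unfold t'. generalize (cond_pos eps); intros He. split; [split|].
      - apply Rmin_glb_lt; lra.
      - apply Rmin_l.
      - apply Rmin_r. }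
    assert (A t').
    { split; [lra|]. intros s Hs. destruct (Rle_or_lt s tau) as [H|H]; [apply Hle; lra|].
      apply Heps. unfold ball; simpl. unfold AbsRing_ball, abs, minus, plus, opp; simpl.
      generalize (cond_pos eps); intros He. rewrite Rabs_pos_eq; lra. }
    specialize (Hub t' H). lra.
  - intros t Ht. apply Hle. lra.
Qed.

Lemma locally_forall_lt (m : nat) (t : R) (Q : nat -> R -> Prop) :
  (forall i, (i < m)%nat -> locally t (Q i)) ->
  locally t (fun s => forall i, (i < m)%nat -> Q i s).
Proof.
  induction m as [|m IH]; intros H.
  - apply filter_forall. intros; lia.
  - assert (H1 : locally t (fun s => forall i, (i < m)%nat -> Q i s)) by (apply IH; auto).
    assert (H2 : locally t (Q m)) by (apply H; lia).
    generalize (filter_and _ _ H1 H2). apply filter_imp. intros s [Ha Hb] i Hi.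
    destruct (Nat.eq_dec i m) as [->|Hne]; [easy|apply Ha; lia].
Qed.

Lemma fsum_single_le m j f : (j < m)%nat -> (forall i, (i < m)%nat -> 0 <= f i) -> f j <= fsum m f.
Proof.
  intros Hj Hf. rewrite <- (fsum_delta m j f Hj). apply fsum_le. intros i Hi.
  destruct (Nat.eqb i j); [lra|auto].
Qed.

Section Stability.
Variables n kap : nat.
Hypothesis Hkap : (kap < n)%nat.
Hypothesis Hkap1 : (1 <= kap)%nat.
Variable U : nat -> R -> R.
Variable UU : nat -> tpoly.
Hypothesis HUU : forall l t, In t (UU l) ->
  tm t = 0%Z /\ (forall j, ta t j = 0%nat) /\ (forall j, tq t j <> 0%Z -> j = l \/ j = S l).
Hypothesis HUUe : forall l I phi, (l < n - 1)%nat -> 0 < I kap ->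
  peval n kap (UU l) I phi = U l (phi (S l) - phi l).
Hypothesis HUm : forall l, (l < n - 1)%nat -> finite_modes_no_const (U l).
Variable gamma : R.
Hypothesis Hgamma : 0 < gamma.
Variables alpha rho : R.
Hypothesis Halpha : 0 < alpha.
Hypothesis Hrho : 0 < rho.

Local Notation eval := (peval n kap).
Local Notation br := (pbr n kap).
Local Notation dI := (pdI kap).
Local Notation P := (Pp n kap UU).
Local Notation Hp := (ham_fast ++ P).
Local Notation Xs := (Xs n kap P).

Definition nearB (L r : R) (v : nat -> R) : Prop :=
  forall i, (i < n)%nat -> Rabs (v i - (if Nat.eqb i kap then L else 0)) < r.

Definition nearB_weak (L r : R) (v : nat -> R) : Prop :=
  forall i, (i < n)%nat -> Rabs (v i - (if Nat.eqb i kap then L else 0)) <= r.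

Definition slow_square (v : nat -> R) : R :=
  fsum n (fun i => if Nat.eqb i kap then 0 else v i ^ 2).

Lemma fsum_square_split v : fsum n (fun i => v i ^ 2) = v kap ^ 2 + slow_square v.
Proof.
  unfold slow_square. rewrite <- (fsum_delta n kap (fun i => v i ^ 2) Hkap), <- fsum_plus.
  apply fsum_ext; intros i Hi. destruct (Nat.eqb i kap); ring.
Qed.

Lemma slow_square_nonneg v : 0 <= slow_square v.
Proof.
  apply fsum_nonneg. intros i _. destruct (Nat.eqb i kap); [lra|apply pow2_ge_0].
Qed.

Lemma slow_square_ge v j : (j < n)%nat -> j <> kap -> v j ^ 2 <= slow_square v.
Proof.
  intros Hj Hjk.
  eapply Rle_trans; [|apply (fsum_single_le n j (fun i => if Nat.eqb i kap then 0 else v i ^ 2) Hj)].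
  - rewrite (proj2 (Nat.eqb_neq _ _) Hjk). lra.
  - intros i _. destruct (Nat.eqb i kap); [lra|apply pow2_ge_0].
Qed.

Lemma nearB_weak_J L r v : nearB_weak L r v -> Rabs (v kap - L) <= r.
Proof. intros H. specialize (H kap Hkap). rewrite Nat.eqb_refl in H. exact H. Qed.

Lemma nearB_weak_slow L r v j : nearB_weak L r v -> (j < n)%nat -> j <> kap -> Rabs (v j) <= r.
Proof.
  intros H Hj Hne. specialize (H j Hj). rewrite (proj2 (Nat.eqb_neq _ _) Hne), Rminus_0_r in H. easy.
Qed.

Lemma nearB_nearB_weak L r v : nearB L r v -> nearB_weak L r v.
Proof. intros H i Hi. left. apply H; easy. Qed.

Lemma slow_square_le L r v : 0 <= r -> nearB_weak L r v -> slow_square v <= INR n * r ^ 2.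
Proof.
  intros Hr H. rewrite <- fsum_const. apply fsum_le. intros i Hi.
  destruct (Nat.eqb_spec i kap) as [E|E]; [apply pow2_ge_0|].
  rewrite <- (Rabs_pos_eq (v i ^ 2)) by apply pow2_ge_0. rewrite <- RPow_abs.
  apply pow_incr. split; [apply Rabs_pos|]. apply (nearB_weak_slow L); easy.
Qed.

Lemma Ham_decomposition : exists B, 0 <= B /\ forall v phi,
  Rabs (Ham n U v phi - / 2 * v kap ^ 2 - / 2 * slow_square v) <= B.
Proof.
  assert (H : exists B, 0 <= B /\ forall phi : nat -> R,
    Rabs (fsum (n - 1) (fun i => U i (phi (S i) - phi i))) <= B).
  { assert (Hm : forall m, (m <= n - 1)%nat -> exists B, 0 <= B /\ forall phi : nat -> R,
      Rabs (fsum m (fun i => U i (phi (S i) - phi i))) <= B).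
    { induction m as [|m IH]; intros Hm.
      - exists 0. split; [lra|]. intros; simpl. rewrite Rabs_R0; lra.
      - destruct IH as [B [HB HB']]; [lia|].
        destruct (finite_modes_bound (U m) (HUm m ltac:(lia))) as [B2 [HB2 HB2']].
        exists (B + B2). split; [lra|]. intros phi. cbn [fsum].
        eapply Rle_trans; [apply Rabs_triang|]. apply Rplus_le_compat; auto. }
    apply Hm; lia. }
  destruct H as [B [HB HB']]. exists B. split; [easy|]. intros v phi.
  unfold Ham. rewrite fsum_square_split.
  replace (_ - _ - _) with (fsum (n - 1) (fun i => U i (phi (S i) - phi i))) by ring. easy.
Qed.

(** The truncation error has order J^(-(2 kap + 1)) with a constant depending on r; over the time
    L^(2 kap - 1) it amounts to L^(-2). One order less would leave an r-dependent multiple of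
    1/L. *)
Definition inv_order : nat := (2 * kap + 1)%nat.
Definition Xinv : tpoly := lsum (S inv_order) Xs.

(** The order of the quantifiers matters: C1 is fixed before r. Only the corrections from second
    order on depend on r, and they are negligible against 1/L. *)
Lemma Xinv_decomposition : exists C1, 0 <= C1 /\ forall r, exists C2, 0 <= C2 /\
  forall v phi, 1 <= v kap -> (forall j, (j < n)%nat -> j <> kap -> Rabs (v j) <= r) ->
    Rabs (eval Xinv v phi - v kap) <= C1 / v kap + C2 * (/ v kap) ^ 2.
Proof.
  destruct (Xs_1_bound n kap UU HUU Hkap) as [C1 [HC1 HB1]].
  exists C1. split; [easy|]. intros r.
  destruct (eval_bound n kap Hkap r (lsum (2 * kap) (fun i => Xs (S (S i)))) 2) as [C2 [HC2 HB2]].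
  { intros t Ht. apply in_lsum in Ht. destruct Ht as [l [_ Ht]].
    destruct (Xs_cls n kap UU HUU (S (S l)) ltac:(lia) t Ht) as [H _]. lia. }
  exists C2. split; [easy|]. intros v phi HJ Hv.
  assert (E : eval Xinv v phi - v kap
    = eval (Xs 1) v phi + eval (lsum (2 * kap) (fun i => Xs (S (S i)))) v phi).
  { unfold Xinv, inv_order. rewrite !eval_lsum. replace (2 * kap + 1)%nat with (S (2 * kap)) by lia.
    rewrite !fsum_split_first. change (Xs 0) with Jp. rewrite eval_Jp by (easy || lra). ring. }
  rewrite E. eapply Rle_trans; [apply Rabs_triang|].
  apply Rplus_le_compat; [apply HB1; lra|apply HB2; easy].
Qed.

Lemma Xinv_drift r : exists C3 C4, 0 <= C3 /\ 0 <= C4 /\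
  forall v phi, 1 <= v kap -> (forall j, (j < n)%nat -> j <> kap -> Rabs (v j) <= r) ->
    Rabs (eval (br Xinv Hp) v phi) <= C3 * (/ v kap) ^ inv_order /\
    Rabs (eval (dI 0 Xinv) v phi) <= C4 * (/ v kap) ^ (2 * kap).
Proof.
  destruct (eval_bound n kap Hkap r (br (Xs inv_order) P) inv_order) as [C3 [HC3 HB3]].
  { intros t Ht.
    destruct (br_cls_Pp n kap UU HUU (Z.of_nat inv_order) (Xs inv_order) P ltac:(unfold inv_order; lia)
      (Xs_cls n kap UU HUU inv_order ltac:(unfold inv_order; lia)) (incl_refl _) t Ht) as [H _]. exact H. }
  destruct (eval_bound n kap Hkap r (dI 0 Xinv) (2 * kap)) as [C4 [HC4 HB4]].
  { intros t Ht. unfold Xinv in Ht. rewrite dI_lsum in Ht.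
    apply in_lsum in Ht. destruct Ht as [l [_ Ht]].
    generalize (Xs_dI_0_cls n kap UU HUU l Hkap1 t Ht). lia. }
  exists C3, C4. repeat split; try easy.
  - unfold Xinv. rewrite adiabatic_invariant by (easy || lra). apply HB3; easy.
  - apply HB4; easy.
Qed.

Lemma pow_inv_half_le L J p : 0 < L -> L / 2 <= J -> (/ J) ^ p <= 2 ^ p / L ^ p.
Proof.
  intros HL HJ. replace (2 ^ p / L ^ p) with ((2 / L) ^ p).
  - apply pow_incr. split; [left; apply Rinv_0_lt_compat; lra|].
    replace (2 / L) with (/ (L / 2)) by (field; lra). apply Rinv_le_contravar; lra.
  - unfold Rdiv. rewrite Rpow_mult_distr, pow_inv. easy.
Qed.

Definition fast_time (L : R) : R := alpha * L ^ (2 * kap - 1).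

Lemma energy_nonincreasing I phi T t1 : solves n U gamma I phi T ->
  0 <= t1 <= T -> (forall s, 0 <= s <= t1 -> 0 < I s kap) ->
  Ham n U (I t1) (phi t1) <= Ham n U (I 0) (phi 0).
Proof.
  intros Hsol Ht1 HJ.
  rewrite (Ham_eval n kap Hkap U UU HUUe (I t1)) by (apply HJ; lra).
  rewrite (Ham_eval n kap Hkap U UU HUUe (I 0)) by (apply HJ; lra).
  assert (H := is_derive_increment_ge (fun s => -1 * eval Hp (I s) (phi s))
    (fun s => -1 * (- gamma * I s 0%nat ^ 2)) 0 t1 0).
  assert (0 * (t1 - 0) <= -1 * eval Hp (I t1) (phi t1) - -1 * eval Hp (I 0) (phi 0)); [|lra].
  apply H; [lra| |].
  - intros s Hs. apply is_derive_scal.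
    apply (energy_derive n kap Hkap U UU HUUe gamma I phi T Hsol); [lra|apply HJ; lra].
  - intros s Hs. generalize (pow2_ge_0 (I s 0%nat)). nra.
Qed.

(* The bootstrap closes because D does not depend on the a priori bound r.  The dissipative
   part of the drift of X is absorbed by the decay of the energy: X - b H is almost nondecreasing. *)
Lemma fast_momentum_loss : exists D, 0 < D /\ forall r, 0 < r ->
  exists L1, 1 <= L1 /\ forall L, L1 <= L -> forall I phi t1,
    solves n U gamma I phi (fast_time L) -> nearB L rho (I 0) -> 0 <= t1 <= fast_time L ->
    (forall s, 0 <= s <= t1 -> nearB_weak L r (I s)) ->
    I 0 kap - I t1 kap <= D / L.
Proof.
  destruct Xinv_decomposition as [C1 [HC1 HX]].
  destruct Ham_decomposition as [B [HB HH]].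
  (* Half of the loss will be bounded by 4 C1 / L + 3 / L. The first part is V/J at the two ends,
     where J >= L/2; the three units 1/L are the Young constant, the second-order and truncation
     errors, and the energy not stored in J. *)
  exists (8 * C1 + 6). split; [lra|]. intros r Hr.
  destruct (HX r) as [C2 [HC2 HX2]]. clear HX.
  destruct (Xinv_drift r) as [C3 [C4 [HC3 [HC4 HD]]]].
  set (c3 := C3 * 2 ^ inv_order). set (c4 := gamma * C4 * 2 ^ (2 * kap)).
  assert (Hc3 : 0 <= c3) by (apply Rmult_le_pos; [easy|left; apply pow_lt; lra]).
  assert (Hc4 : 0 <= c4).
  { apply Rmult_le_pos; [apply Rmult_le_pos; lra|left; apply pow_lt; lra]. }
  (* Parameter of Young's inequality y <= lam + y^2 / lam for y = |I_0|. Integrated over the whole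
     time, the constant part gives alpha c4 lam / L <= 1/L. *)
  set (lam := / (alpha * c4 + 1)).
  assert (Hac : 0 <= alpha * c4) by (apply Rmult_le_pos; lra).
  assert (Hlam : 0 < lam) by (apply Rinv_0_lt_compat; lra).
  assert (Hlam1 : alpha * c4 * lam <= 1).
  { unfold lam. apply Rmult_le_reg_r with (alpha * c4 + 1); [lra|].
    rewrite Rmult_assoc, Rinv_l by lra. lra. }
  set (K0 := INR n * rho ^ 2 / 2 + 2 * B).
  assert (HK0 : 0 <= K0).
  { unfold K0. generalize (pos_INR n) (pow2_ge_0 rho); intros. nra. }
  set (c5 := c4 / (lam * gamma)).
  assert (Hlg : 0 < lam * gamma) by (apply Rmult_lt_0_compat; lra).
  assert (Hc5 : 0 <= c5).
  { apply Rmult_le_pos; [easy|left; apply Rinv_0_lt_compat; easy]. }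
  exists (1 + 2 * r + 2 + rho + 4 * c5 + c5 * K0 + 8 * C2 + alpha * c3).
  assert (Hck : 0 <= c5 * K0) by (apply Rmult_le_pos; easy).
  assert (Hac3 : 0 <= alpha * c3) by (apply Rmult_le_pos; lra).
  split; [lra|]. intros L HL I phi t1 Hsol Hinit Ht1 Hnear.
  assert (HL1 : 1 <= L) by lra.
  assert (HJ : forall s, 0 <= s <= t1 -> L / 2 <= I s kap).
  { intros s Hs. generalize (nearB_weak_J L r _ (Hnear s Hs)); intros H.
    apply Rabs_le_between in H. lra. }
  assert (HJ1 : forall s, 0 <= s <= t1 -> 1 <= I s kap).
  { intros s Hs. specialize (HJ s Hs). lra. }
  assert (Hslow : forall s, 0 <= s <= t1 -> forall j, (j < n)%nat -> j <> kap -> Rabs (I s j) <= r).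
  { intros s Hs j Hj Hne. apply (nearB_weak_slow L r); auto. }
  set (q := L ^ (2 * kap - 1)).
  assert (HqL : L <= q).
  { unfold q. replace (2 * kap - 1)%nat with (S (2 * kap - 2)) by lia. cbn [pow].
    rewrite <- (Rmult_1_r L) at 1. apply Rmult_le_compat_l; [lra|]. apply pow_R1_Rle; lra. }
  assert (Hq2 : L ^ (2 * kap) = q * L).
  { unfold q. replace (2 * kap)%nat with (S (2 * kap - 1)) at 1 by lia. simpl. ring. }
  assert (HqM : L ^ inv_order = q * L * L).
  { unfold inv_order. rewrite pow_add, Hq2. ring. }
  (* With this weight, b gamma I_0^2, the derivative of - b H, equals the quadratic part from
     Young's inequality. As q >= L, b is of order L^(-2) or smaller. *)
  set (b := c4 / (q * L * lam * gamma)).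
  assert (HqL0 : 0 < q * L) by (apply Rmult_lt_0_compat; lra).
  assert (Hden : 0 < q * L * lam * gamma).
  { rewrite Rmult_assoc. apply Rmult_lt_0_compat; easy. }
  assert (Hb : 0 <= b).
  { apply Rmult_le_pos; [easy|left; apply Rinv_0_lt_compat; easy]. }
  assert (Hb2 : b * L <= c5 / L).
  { unfold b, c5.
    replace (c4 / (q * L * lam * gamma) * L) with (c4 / (lam * gamma) * / q) by (field; lra).
    apply Rmult_le_compat_l; [easy|]. apply Rinv_le_contravar; lra. }
  set (dX := fun s => eval (br Xinv Hp) (I s) (phi s) - gamma * I s 0%nat * eval (dI 0 Xinv) (I s) (phi s)).
  assert (Hder : forall s, 0 <= s <= t1 ->
    is_derive (fun u => eval Xinv (I u) (phi u) + (- b) * eval Hp (I u) (phi u)) s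
      (dX s + (- b) * (- gamma * I s 0%nat ^ 2))).
  { intros s Hs. assert (0 < I s kap) by (specialize (HJ1 s Hs); lra).
    apply is_derive_Rplus.
    - apply (is_derive_along n kap Hkap U UU HUUe gamma I phi _ Hsol); [lra|easy].
    - apply is_derive_scal. apply (energy_derive n kap Hkap U UU HUUe gamma I phi _ Hsol); [lra|easy]. }
  assert (Hlow : forall s, 0 <= s <= t1 ->
    - (c3 / (q * L * L) + c4 * lam / (q * L)) <= dX s + (- b) * (- gamma * I s 0%nat ^ 2)).
  { intros s Hs. destruct (HD (I s) (phi s) (HJ1 s Hs) (Hslow s Hs)) as [Hd1 Hd2].
    assert (Hp1 := pow_inv_half_le L (I s kap) inv_order ltac:(lra) (HJ s Hs)).
    assert (Hp2 := pow_inv_half_le L (I s kap) (2 * kap) ltac:(lra) (HJ s Hs)).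
    rewrite HqM in Hp1. rewrite Hq2 in Hp2.
    set (y := Rabs (I s 0%nat)).
    assert (Hy : 0 <= y) by apply Rabs_pos.
    assert (Hy2 : I s 0%nat ^ 2 = y ^ 2) by (unfold y; rewrite pow2_abs; easy).
    rewrite Hy2. unfold dX.
    assert (A1 : Rabs (eval (br Xinv Hp) (I s) (phi s)) <= c3 / (q * L * L)).
    { eapply Rle_trans; [exact Hd1|]. unfold c3, Rdiv. rewrite Rmult_assoc.
      apply Rmult_le_compat_l; [easy|]. exact Hp1. }
    assert (A2 : Rabs (gamma * I s 0%nat * eval (dI 0 Xinv) (I s) (phi s)) <= c4 / (q * L) * y).
    { rewrite !Rabs_mult, (Rabs_pos_eq gamma) by lra. fold y.
      replace (c4 / (q * L) * y) with (gamma * y * (C4 * (2 ^ (2 * kap) / (q * L)))).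
      - apply Rmult_le_compat_l; [apply Rmult_le_pos; lra|].
        eapply Rle_trans; [exact Hd2|]. apply Rmult_le_compat_l; easy.
      - unfold c4. field. lra. }
    apply Rabs_le_between in A1. apply Rabs_le_between in A2.
    assert (A3 : c4 / (q * L) * y <= c4 * lam / (q * L) + b * gamma * y ^ 2).
    { replace (c4 * lam / (q * L) + b * gamma * y ^ 2) with (c4 / (q * L) * (lam + y ^ 2 / lam)).
      - apply Rmult_le_compat_l.
        + apply Rmult_le_pos; [easy|left; apply Rinv_0_lt_compat; easy].
        + apply Rmult_le_reg_r with lam; [easy|].
          replace ((lam + y ^ 2 / lam) * lam) with (lam ^ 2 + y ^ 2) by (field; lra). nra.
      - unfold b. field. lra. }
    lra. }
  assert (Hincr := is_derive_increment_ge _ _ 0 t1 _ (proj1 Ht1) Hder Hlow). cbv beta in Hincr.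
  assert (Hincr2 : - (alpha * c3 / (L * L) + 1 / L) <=
    - (c3 / (q * L * L) + c4 * lam / (q * L)) * (t1 - 0)).
  { assert (t1 <= alpha * q) by (unfold fast_time in Ht1; fold q in Ht1; lra).
    assert (0 <= c3 / (q * L * L) + c4 * lam / (q * L)).
    { apply Rplus_le_le_0_compat; (apply Rmult_le_pos; [|left; apply Rinv_0_lt_compat]); try easy.
      - apply Rmult_lt_0_compat; lra.
      - apply Rmult_le_pos; lra. }
    assert ((c3 / (q * L * L) + c4 * lam / (q * L)) * t1 <=
      (c3 / (q * L * L) + c4 * lam / (q * L)) * (alpha * q)) by (apply Rmult_le_compat_l; easy).
    assert (E : (c3 / (q * L * L) + c4 * lam / (q * L)) * (alpha * q) =
      alpha * c3 / (L * L) + alpha * c4 * lam / L) by (field; lra).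
    assert (alpha * c4 * lam / L <= 1 / L).
    { apply Rmult_le_compat_r; [left; apply Rinv_0_lt_compat; lra|easy]. }
    lra. }
  rewrite <- (Ham_eval n kap Hkap U UU HUUe (I t1)) in Hincr by (specialize (HJ1 t1); lra).
  rewrite <- (Ham_eval n kap Hkap U UU HUUe (I 0)) in Hincr by (specialize (HJ1 0); lra).
  assert (X1 := HX2 (I t1) (phi t1) (HJ1 t1 ltac:(lra)) (Hslow t1 ltac:(lra))).
  assert (X0 := HX2 (I 0) (phi 0) (HJ1 0 ltac:(lra)) (Hslow 0 ltac:(lra))).
  assert (HXb : forall s, 0 <= s <= t1 -> C1 / I s kap + C2 * (/ I s kap) ^ 2 <= 2 * C1 / L + 4 * C2 / (L * L)).
  { intros s Hs. apply Rplus_le_compat.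
    - replace (2 * C1 / L) with (C1 * / (L / 2)) by (field; lra).
      apply Rmult_le_compat_l; [easy|]. apply Rinv_le_contravar; [lra|apply HJ; easy].
    - replace (4 * C2 / (L * L)) with (C2 * (2 ^ 2 / L ^ 2)) by (simpl; field; lra).
      apply Rmult_le_compat_l; [easy|]. apply pow_inv_half_le; [lra|apply HJ; easy]. }
  assert (HXb1 := HXb t1 ltac:(lra)). assert (HXb0 := HXb 0 ltac:(lra)).
  apply Rabs_le_between in X1. apply Rabs_le_between in X0.
  assert (E1 := HH (I t1) (phi t1)). assert (E0 := HH (I 0) (phi 0)).
  apply Rabs_le_between in E1. apply Rabs_le_between in E0.
  assert (S0 := slow_square_le L rho (I 0) ltac:(lra) (nearB_nearB_weak _ _ _ Hinit)).
  assert (S1 := slow_square_nonneg (I t1)).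
  set (h1 := Ham n U (I t1) (phi t1)) in *. set (h0 := Ham n U (I 0) (phi 0)) in *.
  assert (HJ0 : I 0 kap <= 2 * L).
  { assert (H := nearB_weak_J L rho _ (nearB_nearB_weak _ _ _ Hinit)).
    apply Rabs_le_between in H. lra. }
  assert (HJt := HJ1 t1 ltac:(lra)).
  set (j1 := I t1 kap) in *. set (j0 := I 0 kap) in *.
  destruct (Rle_or_lt (j0 - j1) 0) as [Hneg|Hpos].
  { apply Rle_trans with 0; [easy|]. apply Rmult_le_pos; [lra|left; apply Rinv_0_lt_compat; lra]. }
  assert (He : h0 - h1 <= 2 * L * (j0 - j1) + K0).
  { unfold K0. assert (/ 2 * j0 ^ 2 - / 2 * j1 ^ 2 <= 2 * L * (j0 - j1)); [|lra].
    replace (/ 2 * j0 ^ 2 - / 2 * j1 ^ 2) with ((j0 + j1) / 2 * (j0 - j1)) by field.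
    apply Rmult_le_compat_r; lra. }
  (* The energy drop is at most 2 L times the loss of J plus a constant. Multiplied by b it becomes
     at most half of the loss, which is absorbed on the left, plus 1/L. *)
  assert (Hbe : b * (h0 - h1) <= (j0 - j1) / 2 + 1 / L).
  { apply Rle_trans with (b * (2 * L * (j0 - j1) + K0)); [apply Rmult_le_compat_l; easy|].
    assert (Hb3 : b * L <= 1 / 4).
    { eapply Rle_trans; [exact Hb2|]. apply Rmult_le_reg_r with L; [lra|].
      unfold Rdiv. rewrite Rmult_assoc, Rinv_l by lra. lra. }
    assert (b * (2 * L * (j0 - j1)) <= (j0 - j1) / 2) by nra.
    assert (b * K0 <= 1 / L); [|lra].
    apply Rmult_le_reg_r with L; [lra|].
    replace (1 / L * L) with 1 by (field; lra).
    apply Rle_trans with (c5 / L * K0).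
    - replace (b * K0 * L) with (b * L * K0) by ring. apply Rmult_le_compat_r; easy.
    - apply Rmult_le_reg_r with L; [lra|].
      replace (c5 / L * K0 * L) with (c5 * K0) by (field; lra). lra. }
  assert (Hsmall : 8 * C2 / (L * L) + alpha * c3 / (L * L) <= 1 / L).
  { apply Rmult_le_reg_r with (L * L); [apply Rmult_lt_0_compat; lra|].
    replace ((8 * C2 / (L * L) + alpha * c3 / (L * L)) * (L * L)) with (8 * C2 + alpha * c3) by (field; lra).
    replace (1 / L * (L * L)) with L by (field; lra). lra. }
  assert (Hfin : (j0 - j1) / 2 <= 4 * C1 / L + 3 / L).
  { replace (8 * C2 / (L * L)) with (2 * (4 * C2 / (L * L))) in Hsmall by (field; lra).
    replace (4 * C1 / L) with (2 * (2 * C1 / L)) by (field; lra).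
    replace (3 / L) with (1 / L + 1 / L + 1 / L) by (field; lra). lra. }
  replace ((8 * C1 + 6) / L) with (2 * (4 * C1 / L + 3 / L)) by (field; lra). lra.
Qed.

Lemma solves_continuous I phi T j t : solves n U gamma I phi T -> 0 <= t <= T -> (j < n)%nat ->
  continuous (fun s => I s j) t.
Proof.
  intros Hsol Ht Hj. apply (ex_derive_continuous (K := R_AbsRing) (V := R_NormedModule)).
  eexists. apply (proj1 (Hsol t Ht j Hj)).
Qed.

Theorem stability : exists L0 rs, 1 <= L0 /\ rho < rs /\ forall L, L0 <= L -> forall I phi,
  solves n U gamma I phi (fast_time L) -> nearB L rho (I 0) ->
  forall t, 0 <= t <= fast_time L -> nearB L rs (I t).
Proof.
  destruct fast_momentum_loss as [D [HD Hloss]].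
  destruct Ham_decomposition as [B [HB HH]].
  assert (Hn : 0 <= INR n * rho ^ 2).
  { apply Rmult_le_pos; [apply pos_INR|apply pow2_ge_0]. }
  (* K1 bounds the sum of the slow squares: J0^2 - Jt^2 is at most 4 L times D / L, and the rest
     comes from the initial slow energy and the potentials. Then |I_i| <= K1 + 1 < rs, so the
     bootstrap is strict. *)
  set (K1 := 4 * D + INR n * rho ^ 2 + 4 * B).
  set (rs := rho + K1 + 3).
  destruct (Hloss rs) as [L1 [HL1 HL]]; [unfold rs, K1; lra|]. clear Hloss.
  exists (L1 + D + 2 * rs + INR n * rho ^ 2 + 4 * B), rs.
  assert (HK1 : 0 <= K1) by (unfold K1; lra).
  split; [unfold rs; lra|split; [unfold rs; lra|]].
  intros L HLL I phi Hsol Hinit.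
  assert (Hrs : 0 < rs) by (unfold rs; lra).
  assert (HLpos : 0 < L) by lra.
  assert (HT : 0 <= fast_time L).
  { unfold fast_time. apply Rmult_le_pos; [lra|apply pow_le; lra]. }
  apply (continuation (fun t => nearB L rs (I t)) (fun t => nearB_weak L rs (I t))); try easy.
  - intros i Hi. specialize (Hinit i Hi). unfold rs. lra.
  - intros t Ht Hs. apply locally_forall_lt. intros i Hi. specialize (Hs i Hi).
    set (c := if Nat.eqb i kap then L else 0) in *.
    assert (Hc : continuous (fun s => Rabs (I s i - c)) t).
    { apply (continuous_comp (fun s => I s i - c) Rabs); [|apply continuous_Rabs].
      apply (continuous_minus (V := R_NormedModule) (fun s => I s i) (fun _ => c)).
      - apply (solves_continuous I phi (fast_time L)); easy.
      - apply continuous_const. }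
    apply (Hc (fun y => y < rs)). apply (open_lt rs). exact Hs.
  - intros t Ht Hs i Hi.
    set (c := if Nat.eqb i kap then L else 0).
    destruct (Rle_or_lt (Rabs (I t i - c)) rs) as [Hle|Hgt]; [easy|exfalso].
    assert (Hc : continuous (fun s => Rabs (I s i - c)) t).
    { apply (continuous_comp (fun s => I s i - c) Rabs); [|apply continuous_Rabs].
      apply (continuous_minus (V := R_NormedModule) (fun s => I s i) (fun _ => c)).
      - apply (solves_continuous I phi (fast_time L)); [easy|lra|easy].
      - apply continuous_const. }
    destruct (Hc (fun y => rs < y)) as [eps Heps]; [apply (open_gt rs); exact Hgt|].
    set (s := Rmax 0 (t - eps / 2)).
    assert (Hs1 : 0 <= s < t /\ t - eps / 2 <= s).
    { unfold s. generalize (cond_pos eps); intros He. split; [split|].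
      - apply Rmax_l.
      - apply Rmax_lub_lt; lra.
      - apply Rmax_r. }
    specialize (Hs s (proj1 Hs1) i Hi). fold c in Hs.
    assert (rs < Rabs (I s i - c)); [|lra].
    apply Heps. unfold ball; simpl. unfold AbsRing_ball, abs, minus, plus, opp; simpl.
    generalize (cond_pos eps); intros He. rewrite Rabs_left; lra.
  - intros t. apply nearB_nearB_weak.
  - intros t Ht Hweak.
    assert (Hd := HL L ltac:(lra) I phi t Hsol Hinit Ht Hweak).
    assert (HJ : forall s, 0 <= s <= t -> L / 2 <= I s kap).
    { intros s Hs. generalize (nearB_weak_J L rs _ (Hweak s Hs)); intros H.
      apply Rabs_le_between in H. lra. }
    assert (Hen := energy_nonincreasing I phi _ t Hsol Ht
      (fun s Hs => Rlt_le_trans _ _ _ (ltac:(lra) : 0 < L / 2) (HJ s Hs))).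
    assert (E1 := HH (I t) (phi t)). assert (E0 := HH (I 0) (phi 0)).
    apply Rabs_le_between in E1. apply Rabs_le_between in E0.
    assert (S0 := slow_square_le L rho (I 0) ltac:(lra) (nearB_nearB_weak _ _ _ Hinit)).
    assert (S1 := slow_square_nonneg (I t)).
    assert (HJ0 := nearB_weak_J L rho _ (nearB_nearB_weak _ _ _ Hinit)).
    apply Rabs_le_between in HJ0.
    assert (HJt := HJ t ltac:(lra)).
    assert (Hslow1 : slow_square (I t) <= K1).
    { assert (I 0 kap ^ 2 - I t kap ^ 2 <= 4 * D); [|unfold K1; lra].
      destruct (Rle_or_lt (I 0 kap) (I t kap)) as [H|H].
      - assert (I 0 kap ^ 2 <= I t kap ^ 2) by (apply pow_incr; unfold rs in *; lra). lra.
      - replace (I 0 kap ^ 2 - I t kap ^ 2) with ((I 0 kap + I t kap) * (I 0 kap - I t kap)) by ring.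
        apply Rle_trans with (4 * L * (D / L)); [|right; field; lra].
        apply Rmult_le_compat; unfold rs in *; lra. }
    assert (HDL : D / L <= 1).
    { apply Rmult_le_reg_r with L; [easy|]. unfold Rdiv. rewrite Rmult_assoc, Rinv_l; lra. }
    intros i Hi. destruct (Nat.eqb_spec i kap) as [->|Hne].
    + apply Rabs_def1.
      (* Growth of J is excluded by energy alone: J^2 can increase only by a constant, while raising
         J by 1 would cost more than 2 J0 >= L. *)
      * assert (Hsq : I t kap ^ 2 <= I 0 kap ^ 2 + (INR n * rho ^ 2 + 4 * B)) by lra.
        assert (I t kap <= I 0 kap + 1); [|unfold rs; lra].
        assert (HJ00 := HJ 0 ltac:(lra)).
        apply Rnot_lt_le. intros Hc.
        assert ((I 0 kap + 1) ^ 2 <= I t kap ^ 2) by (apply pow_incr; lra).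
        replace ((I 0 kap + 1) ^ 2) with (I 0 kap ^ 2 + 2 * I 0 kap + 1) in * by ring. lra.
      * unfold rs. lra.
    + rewrite Rminus_0_r. apply Rle_lt_trans with (K1 + 1); [|unfold rs; lra].
      apply Rnot_lt_le. intros Hc.
      assert (Hj := slow_square_ge (I t) i Hi Hne).
      rewrite <- (pow2_abs (I t i)) in Hj.
      assert ((K1 + 1) ^ 2 <= Rabs (I t i) ^ 2) by (apply pow_incr; lra). nra.
Qed.

End Stability.

(** * Time derivatives of the damped action *)

Lemma nil_of_no_member (f : tpoly) : (forall t, ~ In t f) -> f = [].
Proof. destruct f as [|t f]; [easy|]. intros H. exfalso. apply (H t). now left. Qed.

Section Derivatives.
Variables n kap : nat.
Hypothesis Hkap : (kap < n)%nat.
Hypothesis Hkap1 : (1 <= kap)%nat.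
Variable U : nat -> R -> R.
Variable UU : nat -> tpoly.
Hypothesis HUU : forall l t, In t (UU l) ->
  tm t = 0%Z /\ (forall j, ta t j = 0%nat) /\ (forall j, tq t j <> 0%Z -> j = l \/ j = S l).
Hypothesis HUUe : forall l I phi, (l < n - 1)%nat -> 0 < I kap ->
  peval n kap (UU l) I phi = U l (phi (S l) - phi l).
Hypothesis HUm : forall l, (l < n - 1)%nat -> finite_modes_no_const (U l).
Variable gamma : R.

Local Notation eval := (peval n kap).
Local Notation br := (pbr n kap).
Local Notation dI := (pdI kap).
Local Notation eqv := (peqv n kap).
Local Notation P := (Pp n kap UU).
Local Notation Hp := (ham_fast ++ P).

Definition action (j : nat) : tpoly :=
  [Term 1 0 (fun i => if Nat.eqb i j then 1%nat else 0%nat) (fun _ => 0%Z) 0].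

(** Here friction is included, unlike in the Lie series: this is the vector field of the damped
    equations as a derivation, so every time derivative of I_0 is again a list of terms. *)
Definition flow (f : tpoly) : tpoly := br f Hp ++ pscal (- gamma) (pmul (action 0) (dI 0 f)).

Lemma eval_action j I phi : (j < n)%nat -> j <> kap -> 0 < I kap -> eval (action j) I phi = I j.
Proof.
  intros Hj Hjk HJ. unfold action. rewrite eval_cons. change (eval [] I phi) with 0.
  unfold tval, phase; cbn [tc tq td].
  rewrite fsum_zero by (intros; ring). rewrite !Rplus_0_r, cos_0.
  rewrite (fprod_split n j) by easy. rewrite fprod_one.
  - unfold factor; cbn [ta tm]. rewrite Nat.eqb_refl, (proj2 (Nat.eqb_neq _ _) Hjk). ring.
  - intros i Hi. unfold factor; cbn [ta tm].
    destruct (Nat.eqb i j); [easy|]. destruct (Nat.eqb_spec i kap) as [->|]; [|easy].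
    apply Rpower_O; easy.
Qed.

Lemma eval_flow f I phi : 0 < I kap -> eval (flow f) I phi =
  eval (br f Hp) I phi - gamma * I 0%nat * eval (dI 0 f) I phi.
Proof.
  intros HJ. unfold flow. rewrite eval_app, eval_scal, eval_mul, eval_action by (easy || lia). ring.
Qed.

Lemma flow_eqv f g : eqv f g -> eqv (flow f) (flow g).
Proof.
  intros H I phi HJ. rewrite !eval_flow by easy.
  rewrite (br_eqv n kap Hkap f g Hp Hp H (fun _ _ _ => eq_refl) I phi HJ).
  rewrite (dI_eqv n kap Hkap f g 0 ltac:(lia) H I phi HJ). easy.
Qed.

Lemma eval_flow_app f g I phi : 0 < I kap ->
  eval (flow (f ++ g)) I phi = eval (flow f) I phi + eval (flow g) I phi.
Proof.
  intros HJ. rewrite !eval_flow, eval_br_app_l, dI_app, eval_app by easy. ring.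
Qed.

Lemma eval_flow_mul f g I phi : 0 < I kap ->
  eval (flow (pmul f g)) I phi =
  eval (flow f) I phi * eval g I phi + eval f I phi * eval (flow g) I phi.
Proof.
  intros HJ. rewrite !eval_flow, !eval_br, eval_dI_mul by (easy || lia).
  assert (E : fsum n (fun j => eval (dphi j (pmul f g)) I phi * eval (dI j Hp) I phi
      - eval (dI j (pmul f g)) I phi * eval (dphi j Hp) I phi) =
    eval g I phi * fsum n (fun j => eval (dphi j f) I phi * eval (dI j Hp) I phi
      - eval (dI j f) I phi * eval (dphi j Hp) I phi)
    + eval f I phi * fsum n (fun j => eval (dphi j g) I phi * eval (dI j Hp) I phi
      - eval (dI j g) I phi * eval (dphi j Hp) I phi)).
  { rewrite <- !fsum_scal, <- fsum_plus. apply fsum_ext; intros j Hj.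
    rewrite eval_dI_mul, eval_dphi_mul by easy. ring. }
  rewrite E. ring.
Qed.

Lemma eval_dI_action i j I phi : (i < n)%nat -> (j < n)%nat -> j <> kap -> 0 < I kap ->
  eval (dI i (action j)) I phi = if Nat.eqb i j then 1 else 0.
Proof.
  intros Hi Hj Hjk HJ.
  rewrite <- (is_derive_unique _ _ _ (is_derive_dI n kap Hkap (action j) i I phi Hi HJ)).
  apply is_derive_unique.
  apply is_derive_ext_loc with (fun s => upd I i s j).
  - generalize (locally_upd_pos kap I i HJ). apply filter_imp; intros s Hs.
    rewrite eval_action; easy.
  - rewrite Nat.eqb_sym. apply is_derive_upd.
Qed.

Lemma eval_flow_action j I phi : (S j < n)%nat -> j <> kap -> 0 < I kap ->
  eval (flow (action j)) I phi = Derive (U j) (phi (S j) - phi j)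
   - (if Nat.eqb j 0 then gamma * I 0%nat else Derive (U (j - 1)%nat) (phi j - phi (j - 1)%nat)).
Proof.
  intros Hj Hjk HJ. rewrite eval_flow, eval_br, eval_dI_action by (easy || lia).
  rewrite (fsum_ext n _ (fun i => if Nat.eqb i j then - eval (dphi i Hp) I phi else 0)).
  2:{ intros i Hi. rewrite eval_dI_action by (easy || lia).
      change (dphi i (action j)) with (@nil term). change (eval [] I phi) with 0.
      destruct (Nat.eqb i j); ring. }
  rewrite (fsum_delta n j (fun i => - eval (dphi i Hp) I phi)) by lia.
  rewrite <- (dH_dphi_eval n kap Hkap U UU HUUe I phi j ltac:(lia) HJ).
  rewrite (dH_dphi_eq n U I phi j HUm ltac:(lia)).
  rewrite (proj2 (Nat.ltb_lt j (n - 1))) by lia.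
  destruct j as [|j]; simpl; ring.
Qed.

Lemma eval_dphi_bond f V l i I phi : (i < n)%nat -> 0 < I kap ->
  (forall I phi, 0 < I kap -> eval f I phi = V (phi (S l) - phi l)) ->
  (forall x, ex_derive V x) ->
  eval (dphi i f) I phi = Derive V (phi (S l) - phi l) *
    ((if Nat.eqb (S l) i then 1 else 0) - (if Nat.eqb l i then 1 else 0)).
Proof.
  intros Hi HJ Hf HV.
  rewrite <- (is_derive_unique _ _ _ (is_derive_dphi n kap Hkap f i I phi Hi HJ)).
  apply is_derive_unique.
  apply is_derive_ext with (fun s => V (upd phi i s (S l) - upd phi i s l)).
  { intros s. rewrite Hf; easy. }
  evar_last.
  - apply (is_derive_comp V (fun s => upd phi i s (S l) - upd phi i s l)).
    + rewrite !upd_same. apply Derive_correct, HV.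
    + apply (is_derive_minus (K := R_AbsRing) (V := R_NormedModule)
        (fun s => upd phi i s (S l)) (fun s => upd phi i s l)); apply is_derive_upd.
  - cbv [Hierarchy.scal minus plus opp]; simpl. cbv [mult]; simpl. ring.
Qed.

(** Tension U_l' and, in [bond2], stiffness U_l'' of bond l. Differentiating in the upper angle of
    the bond gives both the sign plus. *)
Definition bond1 (l : nat) : tpoly := dphi (S l) (UU l).
Definition bond2 (l : nat) : tpoly := dphi (S l) (bond1 l).

Lemma delta_succ l : (if Nat.eqb (S l) (S l) then 1 else 0) - (if Nat.eqb l (S l) then 1 else 0) = 1.
Proof. rewrite Nat.eqb_refl, (proj2 (Nat.eqb_neq l (S l))) by lia. ring. Qed.

Lemma eval_bond1 l I phi : (S l < n)%nat -> 0 < I kap ->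
  eval (bond1 l) I phi = Derive (U l) (phi (S l) - phi l).
Proof.
  intros Hl HJ. unfold bond1. rewrite (eval_dphi_bond _ (U l) l); try easy.
  - rewrite delta_succ; ring.
  - intros; apply HUUe; [lia|easy].
  - apply finite_modes_ex_derive, HUm; lia.
Qed.

Lemma eval_dphi_bond1 l i I phi : (S l < n)%nat -> (i < n)%nat -> 0 < I kap ->
  eval (dphi i (bond1 l)) I phi = Derive (Derive (U l)) (phi (S l) - phi l) *
    ((if Nat.eqb (S l) i then 1 else 0) - (if Nat.eqb l i then 1 else 0)).
Proof.
  intros Hl Hi HJ. apply (eval_dphi_bond _ (Derive (U l)) l); try easy.
  - intros; apply eval_bond1; easy.
  - apply finite_modes_ex_derive, finite_modes_Derive, HUm; lia.
Qed.

Lemma eval_bond2 l I phi : (S l < n)%nat -> 0 < I kap ->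
  eval (bond2 l) I phi = Derive (Derive (U l)) (phi (S l) - phi l).
Proof.
  intros Hl HJ. unfold bond2. rewrite eval_dphi_bond1, delta_succ by easy. ring.
Qed.

(** No power of J, only actions below a and angles below b. For a <= kap such a function is bounded
    as soon as the slow actions are, even if b lets in the fast angle. *)
Definition slowdep (a b : nat) (f : tpoly) : Prop := forall t, In t f ->
  tm t = 0%Z /\ (forall i, ta t i <> 0%nat -> (i < a)%nat) /\ (forall i, tq t i <> 0%Z -> (i < b)%nat).

Lemma slowdep_weaken a b a' b' f : (a <= a')%nat -> (b <= b')%nat -> slowdep a b f -> slowdep a' b' f.
Proof.
  intros Ha Hb H t Ht. destruct (H t Ht) as [H1 [H2 H3]]. split; [easy|].
  split; intros i Hi; [specialize (H2 i Hi)|specialize (H3 i Hi)]; lia.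
Qed.

Lemma slowdep_app a b f g : slowdep a b f -> slowdep a b g -> slowdep a b (f ++ g).
Proof. intros Hf Hg t Ht. apply in_app_or in Ht. destruct Ht; auto. Qed.

Lemma slowdep_pscal a b c f : slowdep a b f -> slowdep a b (pscal c f).
Proof.
  intros Hf t Ht. apply in_pscal in Ht. destruct Ht as [s [Hs ->]]. exact (Hf s Hs).
Qed.

Lemma slowdep_pmul a b f g : slowdep a b f -> slowdep a b g -> slowdep a b (pmul f g).
Proof.
  intros Hf Hg t Ht. apply in_pmul in Ht. destruct Ht as [s [r [Hs [Hr Ht]]]].
  apply in_mul_term in Ht. destruct Ht as [E1 [E2 E3]].
  destruct (Hf s Hs) as [F1 [F2 F3]]. destruct (Hg r Hr) as [G1 [G2 G3]].
  split; [lia|]. split; intros i Hi.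
  - destruct (E2 i Hi); auto.
  - destruct (E3 i Hi); auto.
Qed.

Lemma slowdep_dphi a b j f : slowdep a b f -> slowdep a b (dphi j f).
Proof.
  intros Hf s Hs. apply in_dphi in Hs. destruct Hs as [t [Ht [_ [E1 [E2 E3]]]]].
  rewrite E1, E2, E3. apply Hf; easy.
Qed.

Lemma slowdep_UU l : slowdep 0 (S (S l)) (UU l).
Proof.
  intros t Ht. destruct (HUU l t Ht) as [H1 [H2 H3]]. split; [easy|]. split; intros i Hi.
  - now specialize (H2 i).
  - specialize (H3 i Hi). lia.
Qed.

Lemma slowdep_action j : slowdep (S j) 0 (action j).
Proof.
  intros t [<-|[]]. cbn [tm ta tq]. split; [easy|]. split; [|easy]. intros i.
  destruct (Nat.eqb_spec i j); lia.
Qed.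

(** The time derivative of phi_i brings in I_i, and that of I_i brings in angles up to phi_(i+1).
    With b <= kap the fast angle is absent, so its velocity J cannot appear. *)
Lemma slowdep_flow a b f : (b <= kap)%nat -> slowdep a b f ->
  slowdep (Nat.max a b) (Nat.max b (S a)) (flow f).
Proof.
  intros Hb Hf. apply slowdep_app.
  - intros t Ht. apply in_br in Ht.
    destruct Ht as [j [s [r [t' [Hj [E1 [E2 [E3 [Hm H]]]]]]]]].
    rewrite E1, E2, E3. clear t E1 E2 E3. apply in_mul_term in Hm. destruct Hm as [E1 [E2 E3]].
    destruct H as [[Hs Hr]|[Hs Hr]].
    + apply in_dphi in Hs. destruct Hs as [u [Hu [Hq [F1 [F2 F3]]]]].
      destruct (Hf u Hu) as [G1 [G2 G3]]. assert (Hjb := G3 j Hq).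
      apply in_dI in Hr. destruct Hr as [v [Hv [K1 [K2 K3]]]].
      apply in_app_or in Hv. destruct Hv as [[<-|[]]|Hv].
      { exfalso. destruct K3 as [K3|[_ [_ K3]]]; [lia|easy]. }
      destruct (in_Pp n kap UU v Hv) as [[j' [Hj1 [Hj2 ->]]]|[l Hl]].
      * assert (tm r = 0%Z /\ j = j') as [Hr0 <-].
        { cbn [kinetic tm ta] in K3. destruct K3 as [[_ [_ K3]]|[_ [K3 K4]]]; [easy|].
          split; [easy|]. destruct (Nat.eqb_spec j j'); easy. }
        rewrite F2, F3 in *. split; [lia|]. split; intros i Hi.
        -- destruct (E2 i Hi) as [H'|H']; [specialize (G2 i H'); lia|].
           specialize (K2 i H'). cbn [kinetic ta] in K2. destruct (Nat.eqb_spec i j); [lia|easy].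
        -- destruct (E3 i Hi) as [H'|H']; [specialize (G3 i H'); lia|]. rewrite K1 in H'. easy.
      * exfalso. destruct (HUU l v Hl) as [L1 [L2 _]].
        destruct K3 as [[_ [_ K3]]|[_ [_ K3]]]; [easy|]. apply K3, L2.
    + apply in_dI in Hs. destruct Hs as [u [Hu [F1 [F2 F3]]]].
      destruct (Hf u Hu) as [G1 [G2 G3]].
      destruct F3 as [[_ [_ F3]]|[Hjk [F3 F4]]]; [easy|]. assert (Hja := G2 j F4).
      apply in_dphi in Hr. destruct Hr as [v [Hv [Hq [K1 [K2 K3]]]]].
      apply in_app_or in Hv. destruct Hv as [[<-|[]]|Hv]; [easy|].
      destruct (in_Pp n kap UU v Hv) as [[j' [Hj1 [Hj2 ->]]]|[l Hl]]; [easy|].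
      destruct (HUU l v Hl) as [L1 [L2 L3]]. specialize (L3 j Hq) as L4.
      rewrite F1, K2, K3 in *. split; [lia|]. split; intros i Hi.
      * destruct (E2 i Hi) as [H'|H'].
        -- specialize (G2 i (F2 i H')). lia.
        -- now specialize (L2 i).
      * destruct (E3 i Hi) as [H'|H'].
        -- specialize (G3 i H'). lia.
        -- specialize (L3 i H'). lia.
  - apply slowdep_pscal. intros t Ht. apply in_pmul in Ht.
    destruct Ht as [s [r [[<-|[]] [Hr Ht]]]].
    apply in_mul_term in Ht. destruct Ht as [E1 [E2 E3]]. cbn [tm ta tq] in *.
    apply in_dI in Hr. destruct Hr as [u [Hu [F1 [F2 F3]]]].
    destruct (Hf u Hu) as [G1 [G2 G3]].
    destruct F3 as [F3|[_ [F3 F4]]]; [lia|]. assert (H0a := G2 0%nat F4).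
    split; [lia|]. split; intros i Hi.
    + destruct (E2 i Hi) as [H'|H'].
      * destruct (Nat.eqb_spec i 0); [lia|easy].
      * specialize (G2 i (F2 i H')). lia.
    + destruct (E3 i Hi) as [H'|H']; [easy|]. rewrite F1 in H'. specialize (G3 i H'). lia.
Qed.

Lemma eval_flow_bond1 l I phi : (S l < n)%nat -> 0 < I kap ->
  eval (flow (bond1 l)) I phi =
  Derive (Derive (U l)) (phi (S l) - phi l) * (I (S l) - I l).
Proof.
  intros Hl HJ.
  assert (E : forall i, dI i (bond1 l) = []).
  { intros i. apply nil_of_no_member. intros t Ht.
    destruct (in_dI kap t i _ Ht) as [u [Hu [_ [_ K3]]]].
    destruct (slowdep_dphi 0 (S (S l)) (S l) _ (slowdep_UU l) u Hu) as [L1 [L2 _]].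
    destruct K3 as [[_ [_ K3]]|[_ [_ K3]]]; [easy|]. specialize (L2 i K3). lia. }
  rewrite eval_flow, eval_br, E by easy. change (eval [] I phi) with 0.
  rewrite (fsum_ext n _ (fun i =>
    (if Nat.eqb i (S l) then Derive (Derive (U l)) (phi (S l) - phi l) * I i else 0)
    - (if Nat.eqb i l then Derive (Derive (U l)) (phi (S l) - phi l) * I i else 0))).
  - rewrite fsum_minus, !(fsum_delta n _ (fun i => Derive (Derive (U l)) (phi (S l) - phi l) * I i)) by lia.
    ring.
  - intros i Hi. rewrite E. change (eval [] I phi) with 0.
    rewrite eval_dphi_bond1 by easy.
    rewrite <- (dH_dI_eval n kap Hkap U UU HUUe I phi i Hi HJ), dH_dI_eq by easy.
    rewrite (Nat.eqb_sym i (S l)), (Nat.eqb_sym i l).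
    destruct (Nat.eqb (S l) i), (Nat.eqb l i); ring.
Qed.

Definition flow_iter (m : nat) : tpoly := Nat.iter m flow (action 0).

(* Every second time derivative of I_0 reaches one site further; up to terms that do not see
   the new site it is the product of the stiffnesses of the bonds crossed. *)
Lemma flow_iter_even j : (j <= kap)%nat -> exists A B,
  slowdep 0 (S j) A /\ slowdep j (S j) B /\
  (forall I phi, 0 < I kap ->
     eval A I phi = fprod j (fun i => Derive (Derive (U i)) (phi (S i) - phi i))) /\
  (forall I phi, 0 < I kap ->
     eval (flow_iter (2 * j)) I phi = eval A I phi * I j + eval B I phi).
Proof.
  induction j as [|j IH]; intros Hj.
  - exists [Term 1 0 (fun _ => 0%nat) (fun _ => 0%Z) 0], [].
    assert (E : forall I phi, 0 < I kap ->
      eval [Term 1 0 (fun _ => 0%nat) (fun _ => 0%Z) 0] I phi = 1).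
    { intros I phi HJ. rewrite eval_pure_J by easy. change (IZR (- 0)) with 0.
      rewrite Rpower_O by easy. ring. }
    split; [|split; [|split]].
    + intros t [<-|[]]. easy.
    + intros t [].
    + intros I phi HJ. apply E; easy.
    + intros I phi HJ. rewrite E by easy. change (flow_iter (2 * 0)) with (action 0).
      rewrite eval_action by (easy || lia). change (eval [] I phi) with 0. ring.
  - destruct (IH ltac:(lia)) as [A [B [HA [HB [EA EF]]]]]. clear IH.
    (* The part of the force on site j that does not look forward: friction at site 0, the pull of
       the preceding bond elsewhere. *)
    set (Rj := if Nat.eqb j 0 then pscal (- gamma) (action 0) else pscal (-1) (bond1 (j - 1))).
    set (B2 := pmul (flow A) (action j) ++ pmul A Rj ++ flow B).
    assert (HRj : slowdep (S j) (S j) Rj).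
    { unfold Rj. destruct (Nat.eqb_spec j 0) as [->|Hne]; apply slowdep_pscal.
      - apply (slowdep_weaken 1 0); [lia|lia|apply slowdep_action].
      - apply slowdep_dphi. apply (slowdep_weaken 0 (S (S (j - 1)))); [lia|lia|apply slowdep_UU]. }
    assert (HB2 : slowdep (S j) (S j) B2).
    { unfold B2. apply slowdep_app; [|apply slowdep_app].
      - apply slowdep_pmul.
        + apply (slowdep_weaken (Nat.max 0 (S j)) (Nat.max (S j) 1)); [lia|lia|].
          apply slowdep_flow; [lia|easy].
        + apply (slowdep_weaken (S j) 0); [lia|lia|apply slowdep_action].
      - apply slowdep_pmul; [|easy]. apply (slowdep_weaken 0 (S j)); [lia|lia|easy].
      - apply (slowdep_weaken (Nat.max j (S j)) (Nat.max (S j) (S j))); [lia|lia|].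
        apply slowdep_flow; [lia|easy]. }
    exists (pmul A (bond2 j)).
    exists (pmul (flow A) (bond1 j) ++ pscal (-1) (pmul (pmul A (bond2 j)) (action j)) ++ flow B2).
    assert (Hb1 : slowdep 0 (S (S j)) (bond1 j)) by (apply slowdep_dphi, slowdep_UU).
    assert (Hb2 : slowdep 0 (S (S j)) (bond2 j)) by (apply slowdep_dphi; easy).
    split; [|split; [|split]].
    + apply slowdep_pmul; [|easy]. apply (slowdep_weaken 0 (S j)); [lia|lia|easy].
    + apply slowdep_app; [|apply slowdep_app].
      * apply slowdep_pmul.
        -- apply (slowdep_weaken (Nat.max 0 (S j)) (Nat.max (S j) 1)); [lia|lia|].
           apply slowdep_flow; [lia|easy].
        -- apply (slowdep_weaken 0 (S (S j))); [lia|lia|easy].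
      * apply slowdep_pscal, slowdep_pmul; [apply slowdep_pmul|].
        -- apply (slowdep_weaken 0 (S j)); [lia|lia|easy].
        -- apply (slowdep_weaken 0 (S (S j))); [lia|lia|easy].
        -- apply (slowdep_weaken (S j) 0); [lia|lia|apply slowdep_action].
      * apply (slowdep_weaken (Nat.max (S j) (S j)) (Nat.max (S j) (S (S j)))); [lia|lia|].
        apply slowdep_flow; [lia|easy].
    + intros I phi HJ. rewrite eval_mul, EA, eval_bond2 by (easy || lia). easy.
    + assert (S1 : eqv (flow_iter (2 * j)) (pmul A (action j) ++ B)).
      { intros I phi HJ. rewrite eval_app, eval_mul, eval_action by (easy || lia). apply EF; easy. }
      (* Odd derivative: only the forward bond, through A U_j', reaches the new angle phi_(j+1). Its
         derivative then yields the stiffness times I_(j+1) - I_j, the only source of the new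
         action. *)
      assert (S2 : eqv (flow_iter (S (2 * j))) (pmul A (bond1 j) ++ B2)).
      { intros I phi HJ. change (flow_iter (S (2 * j))) with (flow (flow_iter (2 * j))).
        rewrite (flow_eqv _ _ S1 I phi HJ). unfold B2.
        rewrite eval_flow_app, eval_flow_mul, !eval_app, !eval_mul by easy.
        rewrite eval_flow_action, eval_action, eval_bond1 by (easy || lia).
        unfold Rj. destruct (Nat.eqb_spec j 0) as [->|Hne]; rewrite eval_scal.
        - rewrite eval_action by (easy || lia). ring.
        - rewrite eval_bond1 by (easy || lia). replace (S (j - 1)) with j by lia. ring. }
      intros I phi HJ. replace (2 * S j)%nat with (S (S (2 * j))) by lia.
      change (flow_iter (S (S (2 * j)))) with (flow (flow_iter (S (2 * j)))).
      rewrite (flow_eqv _ _ S2 I phi HJ).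
      rewrite eval_flow_app, eval_flow_mul, !eval_app, eval_scal, !eval_mul by easy.
      rewrite eval_flow_bond1, eval_action, eval_bond2 by (easy || lia). ring.
Qed.

(** At j = kap the newly reached action is J. The remainder contains the fast angle but only actions
    below kap and no power of J, hence it is bounded uniformly in J. *)
Lemma flow_iter_top r : exists C, 0 <= C /\ forall I phi, 1 <= I kap ->
  (forall j, (j < n)%nat -> j <> kap -> Rabs (I j) <= r) ->
  Rabs (eval (flow_iter (2 * kap)) I phi
    - fprod kap (fun i => Derive (Derive (U i)) (phi (S i) - phi i)) * I kap) <= C.
Proof.
  destruct (flow_iter_even kap (le_n _)) as [A [B [HA [HB [EA EF]]]]].
  destruct (eval_bound n kap Hkap r B 0) as [C [HC HBd]].
  { intros t Ht. destruct (HB t Ht) as [H _]. lia. }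
  exists C. split; [easy|]. intros I phi HJ HI.
  rewrite EF, EA by lra. replace (_ + _ - _) with (eval B I phi) by ring.
  specialize (HBd I phi HJ HI). simpl in HBd. lra.
Qed.

Lemma flow_iter_derive I phi T m t : solves n U gamma I phi T -> 0 <= t <= T -> 0 < I t kap ->
  is_derive (fun s => eval (flow_iter m) (I s) (phi s)) t (eval (flow_iter (S m)) (I t) (phi t)).
Proof.
  intros Hsol Ht HJ. change (flow_iter (S m)) with (flow (flow_iter m)).
  rewrite eval_flow by easy. apply (is_derive_along n kap Hkap U UU HUUe gamma I phi T Hsol (flow_iter m) t); easy.
Qed.

End Derivatives.

(** * Lower bounds from derivatives *)

Lemma mean_value (f df : R -> R) a b x y : a <= x <= b -> a <= y <= b ->
  (forall z, a <= z <= b -> is_derive f z (df z)) ->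
  exists z, a <= z <= b /\ Rmin x y <= z <= Rmax x y /\ f y - f x = df z * (y - x).
Proof.
  intros Hx Hy Hd.
  assert (Hb : forall z, Rmin x y <= z <= Rmax x y -> a <= z <= b).
  { intros z Hz. unfold Rmin, Rmax in Hz. destruct (Rle_dec x y); lra. }
  destruct (MVT_gen f x y df) as [z [Hz E]].
  - intros z Hz. apply Hd, Hb. lra.
  - intros z Hz.
    apply continuity_pt_filterlim, (ex_derive_continuous (K := R_AbsRing) (V := R_NormedModule)).
    exists (df z). apply Hd, Hb. lra.
  - exists z. split; [apply Hb; easy|easy].
Qed.

Lemma is_derive_lipschitz (f df : R -> R) a b K :
  (forall z, a <= z <= b -> is_derive f z (df z)) -> (forall z, a <= z <= b -> Rabs (df z) <= K) ->
  forall x y, a <= x <= b -> a <= y <= b -> Rabs (f y - f x) <= K * Rabs (y - x).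
Proof.
  intros Hd HK x y Hx Hy. destruct (mean_value f df a b x y Hx Hy Hd) as [z [Hz [_ ->]]].
  rewrite Rabs_mult. apply Rmult_le_compat_r; [apply Rabs_pos|auto].
Qed.

Lemma primitive_of_large (f g : R -> R) u l m : 0 < l -> 0 < m ->
  (forall x, u <= x <= u + l -> is_derive f x (g x)) ->
  (forall x, u <= x <= u + l -> m <= Rabs (g x)) ->
  exists v, u <= v /\ v + l / 4 <= u + l /\
    forall x, v <= x <= v + l / 4 -> m * l / 8 <= Rabs (f x).
Proof.
  intros Hl Hm Hd Hg.
  destruct (classic (forall x, u <= x <= u + l / 4 -> m * l / 8 <= Rabs (f x))) as [H|H].
  - exists u. split; [lra|]. split; [lra|easy].
  - apply not_all_ex_not in H. destruct H as [y H]. apply imply_to_and in H. destruct H as [Hy H].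
    exists (u + l / 2). split; [lra|]. split; [lra|]. intros x Hx.
    destruct (mean_value f g u (u + l) y x ltac:(lra) ltac:(lra) Hd) as [z [Hz [_ E]]].
    assert (Hdist : m * (l / 4) <= Rabs (f x - f y)).
    { rewrite E, Rabs_mult. apply Rmult_le_compat; try lra; [apply Hg; easy|].
      rewrite Rabs_pos_eq; lra. }
    generalize (Rabs_triang (f x) (- f y)). rewrite Rabs_Ropp. fold (f x - f y). lra.
Qed.

Lemma antiderivative_of_large p : exists c, 0 < c <= 1 /\
  forall (F : nat -> R -> R) u l m, 0 < l -> 0 < m ->
  (forall j x, (j < p)%nat -> u <= x <= u + l -> is_derive (F j) x (F (S j) x)) ->
  (forall x, u <= x <= u + l -> m <= Rabs (F p x)) ->
  exists v, u <= v /\ v + c * l <= u + l /\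
    forall x, v <= x <= v + c * l -> c * m * l ^ p <= Rabs (F 0%nat x).
Proof.
  induction p as [|p [c [Hc IH]]].
  - exists 1. split; [lra|]. intros F u l m Hl Hm _ H. exists u. split; [lra|]. split; [lra|].
    intros x Hx. simpl. rewrite Rmult_1_l, Rmult_1_r. apply H. lra.
  (* The hypothesis for p gives length c l and bound c m l^p for the first derivative. One more
     integration divides the length by 4 and multiplies the bound by c l / 8. *)
  - exists (c * c / 8). split; [split; nra|]. intros F u l m Hl Hm Hd Hlow.
    destruct (IH (fun j => F (S j)) u l m Hl Hm) as [v [Hv1 [Hv2 Hv3]]].
    { intros j x Hj Hx. apply Hd; [lia|easy]. }
    { exact Hlow. }
    assert (Hlp : 0 < l ^ p) by (apply pow_lt; easy).
    assert (Hm' : 0 < c * m * l ^ p) by (apply Rmult_lt_0_compat; [apply Rmult_lt_0_compat; lra|easy]).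
    assert (Hcl : 0 < c * l) by (apply Rmult_lt_0_compat; lra).
    destruct (primitive_of_large (F 0%nat) (F 1%nat) v (c * l) (c * m * l ^ p) Hcl Hm')
      as [w [Hw1 [Hw2 Hw3]]].
    { intros x Hx. apply Hd; [lia|lra]. }
    { exact Hv3. }
    assert (Hcc : c * c / 8 * l <= c * l / 4).
    { replace (c * c / 8 * l) with (c * l * (c / 8)) by field. nra. }
    exists w. split; [lra|]. split; [lra|]. intros x Hx.
    eapply Rle_trans; [|apply Hw3; lra]. right. simpl. field.
Qed.

(** Landau-type interpolation. Over a step h with K h <= eta / 2 the difference quotient is at most
    2 eps / h = eta / 2, and the derivative varies by at most another eta / 2. The choice h <= 1/2
    leaves room inside the window on one side of every point. *)
Lemma small_derivative K eta : 0 <= K -> 0 < eta -> exists eps, 0 < eps <= eta /\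
  forall (f g : R -> R) a,
  (forall x, a <= x <= a + 1 -> is_derive f x (g x)) ->
  (forall x y, a <= x <= a + 1 -> a <= y <= a + 1 -> Rabs (g y - g x) <= K * Rabs (y - x)) ->
  (forall x, a <= x <= a + 1 -> Rabs (f x) <= eps) ->
  forall x, a <= x <= a + 1 -> Rabs (g x) <= eta.
Proof.
  intros HK Heta. set (h := eta / (2 * (K + eta))).
  assert (Hh : 0 < h) by (apply Rdiv_lt_0_compat; lra).
  assert (Hh2 : h <= 1 / 2).
  { unfold h. apply Rmult_le_reg_r with (2 * (K + eta)); [lra|].
    unfold Rdiv at 1. rewrite Rmult_assoc, Rinv_l by lra. lra. }
  assert (HKh : K * h <= eta / 2).
  { unfold h. apply Rmult_le_reg_r with (2 * (K + eta)); [lra|].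
    replace (K * (eta / (2 * (K + eta))) * (2 * (K + eta))) with (K * eta) by (field; lra). nra. }
  exists (eta * h / 4). split; [split; nra|].
  intros f g a Hd HL Hf x Hx.
  assert (Hy : exists y, a <= y <= a + 1 /\ Rabs (y - x) = h).
  { destruct (Rle_or_lt x (a + 1 / 2)).
    - exists (x + h). split; [lra|]. replace (x + h - x) with h by ring. apply Rabs_pos_eq; lra.
    - exists (x - h). split; [lra|]. replace (x - h - x) with (- h) by ring.
      rewrite Rabs_Ropp. apply Rabs_pos_eq; lra. }
  destruct Hy as [y [Hy Hyx]].
  destruct (mean_value f g a (a + 1) x y Hx Hy Hd) as [z [Hz [Hz2 E]]].
  assert (Hzx : Rabs (x - z) <= h).
  { rewrite <- Hyx. unfold Rmin, Rmax in Hz2. destruct (Rle_dec x y).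
    - rewrite Rabs_left1, Rabs_pos_eq; lra.
    - rewrite Rabs_pos_eq, Rabs_left1; lra. }
  assert (Hgz : Rabs (g z) <= eta / 2).
  { apply Rmult_le_reg_r with h; [easy|]. rewrite <- Hyx at 1. rewrite <- Rabs_mult, <- E.
    generalize (Rabs_triang (f y) (- f x)). rewrite Rabs_Ropp. fold (f y - f x).
    generalize (Hf x Hx) (Hf y Hy). lra. }
  generalize (HL z x Hz Hx) (Rabs_triang (g z) (g x - g z)).
  replace (g z + (g x - g z)) with (g x) by ring. intros H1 H2.
  assert (K * Rabs (x - z) <= K * h) by (apply Rmult_le_compat_l; easy). lra.
Qed.

(** * Nondegenerate periodic potentials *)

Lemma period_Z (f : R -> R) : (forall x, f (x + 2 * PI) = f x) ->
  forall (z : Z) x, f (x + 2 * PI * IZR z) = f x.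
Proof.
  intros Hf. assert (Hn : forall (m : nat) x, f (x + 2 * PI * INR m) = f x).
  { induction m as [|m IH]; intros x; [simpl; f_equal; ring|].
    rewrite S_INR. replace (x + 2 * PI * (INR m + 1)) with (x + 2 * PI * INR m + 2 * PI) by ring.
    rewrite Hf; apply IH. }
  intros z x. destruct (Z_le_gt_dec 0 z) as [Hz|Hz].
  - replace (IZR z) with (INR (Z.to_nat z)); [apply Hn|].
    rewrite INR_IZR_INZ, Z2Nat.id; easy.
  - rewrite <- (Hn (Z.to_nat (- z)) (x + 2 * PI * IZR z)). f_equal.
    rewrite INR_IZR_INZ, Z2Nat.id by lia. rewrite opp_IZR. ring.
Qed.

Lemma shift_into_period x y : exists z : Z, y <= x + 2 * PI * IZR z <= y + 2 * PI.
Proof.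
  assert (HP := PI_RGT_0).
  destruct (archimed ((y - x) / (2 * PI))) as [H1 H2].
  exists (up ((y - x) / (2 * PI))).
  set (u := IZR (up ((y - x) / (2 * PI)))) in *.
  assert (E : y - x = (y - x) / (2 * PI) * (2 * PI)) by (field; lra).
  set (w := (y - x) / (2 * PI)) in *. clearbody u w. split; nra.
Qed.

Lemma finite_modes_continuous U : finite_modes_no_const U -> forall x, continuous U x.
Proof.
  intros H x. apply (ex_derive_continuous (K := R_AbsRing) (V := R_NormedModule)).
  apply finite_modes_ex_derive; easy.
Qed.

(** Compactness of one period: U'^2 + U''^2 is continuous, periodic and never zero, so it has a
    positive minimum. *)
Lemma nondegenerate_gap U : finite_modes_no_const U -> nondegenerate U ->
  exists c, 0 < c /\ forall x, Rabs (Derive U x) < c -> c <= Rabs (Derive (Derive U) x).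
Proof.
  intros HU Hnd. assert (HP := PI_RGT_0).
  assert (HV := finite_modes_Derive U HU). assert (HW := finite_modes_Derive _ HV).
  set (V := Derive U) in *. set (W := Derive V) in *.
  set (g := fun x => V x * V x + W x * W x).
  destruct (continuity_ab_min g 0 (2 * PI)) as [mx [Hmin _]]; [lra| |].
  { intros c _. apply continuity_pt_filterlim.
    apply (continuous_plus (fun x => V x * V x) (fun x => W x * W x));
      apply (continuous_mult (K := R_AbsRing)); apply finite_modes_continuous; easy. }
  assert (Hpos : 0 < g mx).
  { unfold g. destruct (Req_dec (V mx) 0) as [E|E].
    - assert (W mx <> 0) by (intros E'; apply Hnd; exists mx; easy). nra.
    - nra. }
  (* If both |U'| and |U''| were below c, then g x < 2 c^2 <= 2 c <= g mx, contradicting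
     minimality. *)
  set (c := Rmin 1 (g mx / 2)).
  assert (Hc : 0 < c) by (apply Rmin_glb_lt; lra).
  assert (Hc1 : c <= 1) by apply Rmin_l. assert (Hc2 : c <= g mx / 2) by apply Rmin_r.
  exists c. split; [easy|]. intros x Hx.
  destruct (shift_into_period x 0) as [z Hz].
  assert (Hg : g mx <= g x).
  { replace (g x) with (g (x + 2 * PI * IZR z)); [apply Hmin; lra|].
    unfold g. rewrite (period_Z V), (period_Z W); try easy; apply finite_modes_period; easy. }
  unfold g at 2 in Hg. apply Rnot_lt_le. intros Hlt.
  assert (HVx : V x * V x <= c * Rabs (V x)).
  { rewrite <- (Rabs_pos_eq (V x * V x)) by nra. rewrite Rabs_mult.
    apply Rmult_le_compat_r; [apply Rabs_pos|lra]. }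
  assert (HWx : W x * W x <= c * Rabs (W x)).
  { rewrite <- (Rabs_pos_eq (W x * W x)) by nra. rewrite Rabs_mult.
    apply Rmult_le_compat_r; [apply Rabs_pos|lra]. }
  generalize (Rabs_pos (V x)) (Rabs_pos (W x)). nra.
Qed.

(** By Rolle over a period U has a critical point, where nondegeneracy gives U'' <> 0. For the bond
    next to the fast site one such interval suffices, because its angle sweeps the whole circle. *)
Lemma stiff_interval U : finite_modes_no_const U -> nondegenerate U ->
  exists xi w c, 0 < w <= 1 /\ 0 < c /\
    forall x, xi - w <= x <= xi + w -> c <= Rabs (Derive (Derive U) x).
Proof.
  intros HU Hnd. assert (HP := PI_RGT_0).
  assert (HV := finite_modes_Derive U HU). assert (HW := finite_modes_Derive _ HV).
  destruct (mean_value U (Derive U) 0 (2 * PI) 0 (2 * PI)) as [xi [_ [_ E]]]; try lra.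
  { intros z _. apply Derive_correct, finite_modes_ex_derive; easy. }
  assert (E0 : Derive U xi = 0).
  { replace (2 * PI) with (0 + 2 * PI) in E at 1 by ring.
    rewrite (finite_modes_period U HU) in E. nra. }
  assert (Hne : Derive (Derive U) xi <> 0) by (intros E'; apply Hnd; exists xi; easy).
  set (W := Derive (Derive U)) in *.
  assert (Hpos : 0 < Rabs (W xi)) by (apply Rabs_pos_lt; easy).
  assert (Hc : continuous (fun x => Rabs (W x)) xi).
  { apply (continuous_comp W Rabs); [apply finite_modes_continuous; easy|apply continuous_Rabs]. }
  destruct (Hc (fun y => Rabs (W xi) / 2 < y)) as [eps Heps].
  { apply (open_gt (Rabs (W xi) / 2)). lra. }
  assert (He := cond_pos eps).
  exists xi, (Rmin 1 (eps / 2)), (Rabs (W xi) / 2). split; [split|split].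
  - apply Rmin_glb_lt; lra.
  - apply Rmin_l.
  - lra.
  - intros x Hx. left. apply Heps. generalize (Rmin_r 1 (eps / 2)). intros H.
    unfold ball; simpl. unfold AbsRing_ball, abs, minus, plus, opp; simpl.
    apply Rabs_def1; lra.
Qed.

Lemma uniform_constant (Q : nat -> R -> Prop) m :
  (forall j c c', Q j c -> 0 < c' <= c -> Q j c') ->
  (forall j, (j < m)%nat -> exists c, 0 < c /\ Q j c) ->
  exists c, 0 < c /\ forall j, (j < m)%nat -> Q j c.
Proof.
  intros Hmono. induction m as [|m IH]; intros H.
  - exists 1. split; [lra|]. intros; lia.
  - destruct IH as [c [Hc HQ]]; [auto|]. destruct (H m ltac:(lia)) as [d [Hd HQd]].
    exists (Rmin c d). assert (0 < Rmin c d) by (apply Rmin_glb_lt; easy). split; [easy|].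
    intros j Hj. destruct (Nat.eq_dec j m) as [->|Hne].
    + apply (Hmono m d); [easy|]. split; [easy|apply Rmin_r].
    + apply (Hmono j c); [apply HQ; lia|]. split; [easy|apply Rmin_l].
Qed.

Lemma dissipated_energy (E y : R -> R) gamma a b x1 x2 mu : 0 < gamma -> 0 <= mu ->
  a <= x1 -> x1 <= x2 -> x2 <= b ->
  (forall s, a <= s <= b -> is_derive E s (- gamma * y s ^ 2)) ->
  (forall s, x1 <= s <= x2 -> mu <= Rabs (y s)) ->
  E b <= E a - gamma * mu ^ 2 * (x2 - x1).
Proof.
  intros Hg Hmu H1 H2 H3 Hd Hy.
  assert (Hinc : forall c d m, a <= c -> c <= d -> d <= b ->
    (forall s, c <= s <= d -> m <= gamma * y s ^ 2) -> m * (d - c) <= - E d - - E c).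
  { intros c d m Hc Hcd Hdb Hm.
    replace (- E d - - E c) with (-1 * E d - -1 * E c) by ring.
    apply (is_derive_increment_ge (fun s => -1 * E s) (fun s => -1 * (- gamma * y s ^ 2))); [easy| |].
    - intros s Hs. apply is_derive_scal, Hd. lra.
    - intros s Hs. specialize (Hm s Hs). lra. }
  assert (A1 := Hinc a x1 0 ltac:(lra) ltac:(lra) ltac:(lra)
    (fun s _ => Rmult_le_pos _ _ (Rlt_le _ _ Hg) (pow2_ge_0 (y s)))).
  assert (A3 := Hinc x2 b 0 ltac:(lra) ltac:(lra) ltac:(lra)
    (fun s _ => Rmult_le_pos _ _ (Rlt_le _ _ Hg) (pow2_ge_0 (y s)))).
  assert (A2 := Hinc x1 x2 (gamma * mu ^ 2) ltac:(lra) ltac:(lra) ltac:(lra)).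
  assert (gamma * mu ^ 2 * (x2 - x1) <= - E x2 - - E x1).
  { apply A2. intros s Hs. apply Rmult_le_compat_l; [lra|].
    rewrite <- (pow2_abs (y s)). apply pow_incr. split; [easy|apply Hy; easy]. }
  lra.
Qed.

Lemma iterated_decrease (E : R -> R) a tau d (N : nat) :
  (forall i, (i < N)%nat -> E (a + INR (S i) * tau) <= E (a + INR i * tau) - d) ->
  E (a + INR N * tau) <= E a - INR N * d.
Proof.
  induction N as [|N IH]; intros H.
  - simpl. replace (a + 0 * tau) with a by ring. lra.
  - specialize (IH (fun i Hi => H i (Nat.lt_trans _ _ _ Hi (Nat.lt_succ_diag_r N)))).
    specialize (H N (Nat.lt_succ_diag_r N)). rewrite (S_INR N) in *. lra.
Qed.

(** * If the damped site is quiet, so are all slow sites *)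

Section Quiet.
Variables n kap : nat.
Hypothesis Hkap : (kap < n)%nat.
Variable U : nat -> R -> R.
Hypothesis HUm : forall l, (l < n - 1)%nat -> finite_modes_no_const (U l).
Variable gamma : R.
Hypothesis Hgamma : 0 < gamma.
Variables r Bd cnd : R.
Hypothesis Hr : 0 < r.
Hypothesis HBd : 0 < Bd.
Hypothesis Hbound : forall l, (l < n - 1)%nat -> forall x,
  Rabs (Derive (U l) x) <= Bd /\ Rabs (Derive (Derive (U l)) x) <= Bd /\
  Rabs (Derive (Derive (Derive (U l))) x) <= Bd.
Hypothesis Hcnd : 0 < cnd.
Hypothesis Hgap : forall l, (l < n - 1)%nat -> forall x,
  Rabs (Derive (U l) x) < cnd -> cnd <= Rabs (Derive (Derive (U l)) x).

Definition force (v phi : nat -> R) (j : nat) : R :=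
  (if Nat.ltb j (n - 1) then Derive (U j) (phi (S j) - phi j) else 0)
  - (if Nat.eqb j 0 then gamma * v 0%nat else Derive (U (j - 1)%nat) (phi j - phi (j - 1)%nat)).

Lemma solves_force I phi T t j : solves n U gamma I phi T -> 0 <= t <= T -> (j < n)%nat ->
  is_derive (fun s => I s j) t (force (I t) (phi t) j) /\
  is_derive (fun s => phi s j) t (I t j).
Proof.
  intros Hsol Ht Hj. destruct (Hsol t Ht j Hj) as [H1 H2].
  rewrite (dH_dphi_eq n U _ _ j HUm Hj) in H1. rewrite dH_dI_eq in H2 by easy.
  split; [|easy]. evar_last; [exact H1|]. unfold force. destruct (Nat.eqb j 0); ring.
Qed.

Definition window (I phi : R -> nat -> R) (a : R) : Prop := forall x, a <= x <= a + 1 ->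
  (forall j, (j < n)%nat -> is_derive (fun s => I s j) x (force (I x) (phi x) j)) /\
  (forall j, (j < n)%nat -> is_derive (fun s => phi s j) x (I x j)) /\
  (forall j, (j < n)%nat -> j <> kap -> Rabs (I x j) <= r).

Definition force_max : R := 2 * Bd + gamma * r.

Lemma force_bound v phi j : (j < n)%nat -> Rabs (v 0%nat) <= r -> Rabs (force v phi j) <= force_max.
Proof.
  intros Hj Hv. unfold force, force_max.
  assert (A1 : Rabs (if Nat.ltb j (n - 1) then Derive (U j) (phi (S j) - phi j) else 0) <= Bd).
  { destruct (Nat.ltb_spec j (n - 1)); [apply Hbound; easy|rewrite Rabs_R0; lra]. }
  assert (A2 : Rabs (if Nat.eqb j 0 then gamma * v 0%nat
    else Derive (U (j - 1)%nat) (phi j - phi (j - 1)%nat)) <= Bd + gamma * r).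
  { destruct (Nat.eqb_spec j 0).
    - rewrite Rabs_mult, (Rabs_pos_eq gamma) by lra. nra.
    - assert (H := proj1 (Hbound (j - 1)%nat ltac:(lia) (phi j - phi (j - 1)%nat))). nra. }
  eapply Rle_trans; [apply Rabs_triang|]. rewrite Rabs_Ropp. lra.
Qed.

Lemma is_derive_bond I phi V j x : (S j < n)%nat -> (forall y, ex_derive V y) ->
  (forall i, (i < n)%nat -> is_derive (fun s => phi s i) x (I x i)) ->
  is_derive (fun s => V (phi s (S j) - phi s j)) x
    (Derive V (phi x (S j) - phi x j) * (I x (S j) - I x j)).
Proof.
  intros Hj HV Hphi. evar_last.
  - apply (is_derive_comp V (fun s => phi s (S j) - phi s j)).
    + apply Derive_correct, HV.
    + apply (is_derive_minus (K := R_AbsRing) (V := R_NormedModule)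
        (fun s => phi s (S j)) (fun s => phi s j)); apply Hphi; lia.
  - cbv [Hierarchy.scal minus plus opp]; simpl. cbv [mult]; simpl. ring.
Qed.

Definition tension (phi : R -> nat -> R) (j : nat) (x : R) : R :=
  Derive (U j) (phi x (S j) - phi x j).

Definition tension' (I phi : R -> nat -> R) (j : nat) (x : R) : R :=
  Derive (Derive (U j)) (phi x (S j) - phi x j) * (I x (S j) - I x j).

Lemma is_derive_tension I phi a j x : window I phi a -> (S j < n)%nat -> a <= x <= a + 1 ->
  is_derive (tension phi j) x (tension' I phi j x).
Proof.
  intros HW Hj Hx. destruct (HW x Hx) as [_ [Hphi _]].
  apply (is_derive_bond I phi (Derive (U j))); [easy| |easy].
  apply finite_modes_ex_derive, finite_modes_Derive, HUm; lia.
Qed.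

Lemma slow_difference I phi a j x : window I phi a -> (S j < kap)%nat -> a <= x <= a + 1 ->
  Rabs (I x (S j) - I x j) <= 2 * r.
Proof.
  intros HW Hj Hx. destruct (HW x Hx) as [_ [_ Hs]].
  eapply Rle_trans; [apply Rabs_triang|]. rewrite Rabs_Ropp.
  generalize (Hs (S j) ltac:(lia) ltac:(lia)) (Hs j ltac:(lia) ltac:(lia)). lra.
Qed.

Lemma tension_lipschitz I phi a j : window I phi a -> (S j < kap)%nat ->
  forall x y, a <= x <= a + 1 -> a <= y <= a + 1 ->
  Rabs (tension phi j y - tension phi j x) <= 2 * r * Bd * Rabs (y - x).
Proof.
  intros HW Hj. apply (is_derive_lipschitz (tension phi j) (tension' I phi j)).
  - intros z Hz. apply (is_derive_tension I phi a); [easy|lia|easy].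
  - intros z Hz. unfold tension'. rewrite Rabs_mult, Rmult_comm.
    apply Rmult_le_compat; try apply Rabs_pos.
    + apply (slow_difference I phi a); easy.
    + apply Hbound; lia.
Qed.

Lemma action_lipschitz I phi a j : window I phi a -> (1 <= kap)%nat -> (j < n)%nat ->
  forall x y, a <= x <= a + 1 -> a <= y <= a + 1 ->
  Rabs (I y j - I x j) <= force_max * Rabs (y - x).
Proof.
  intros HW Hk Hj.
  apply (is_derive_lipschitz (fun s => I s j) (fun s => force (I s) (phi s) j)).
  - intros z Hz. apply (HW z Hz); easy.
  - intros z Hz. destruct (HW z Hz) as [_ [_ Hs]]. apply force_bound; [easy|]. apply Hs; lia.
Qed.

Lemma Kf_pos : 0 < force_max.
Proof. unfold force_max. generalize (Rmult_lt_0_compat _ _ Hgamma Hr). lra. Qed.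

Definition force_lip : R := 4 * r * Bd + gamma * force_max.
Definition tension_lip : R := Bd * (4 * r * r) + Bd * (2 * force_max).

(** [S j < kap] keeps both bonds at site j away from the fast site, so the constant does not grow
    with L. *)
Lemma force_lipschitz I phi a j : window I phi a -> (S j < kap)%nat ->
  forall x y, a <= x <= a + 1 -> a <= y <= a + 1 ->
  Rabs (force (I y) (phi y) j - force (I x) (phi x) j) <= force_lip * Rabs (y - x).
Proof.
  intros HW Hj x y Hx Hy. assert (HKf := Kf_pos).
  unfold force. rewrite (proj2 (Nat.ltb_lt j (n - 1))) by lia.
  fold (tension phi j y) (tension phi j x).
  assert (A1 := tension_lipschitz I phi a j HW Hj x y Hx Hy).
  assert (Hyx := Rabs_pos (y - x)).
  assert (A2 : Rabs ((if Nat.eqb j 0 then gamma * I y 0%nat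
      else Derive (U (j - 1)%nat) (phi y j - phi y (j - 1)%nat))
    - (if Nat.eqb j 0 then gamma * I x 0%nat
      else Derive (U (j - 1)%nat) (phi x j - phi x (j - 1)%nat)))
    <= (2 * r * Bd + gamma * force_max) * Rabs (y - x)).
  { assert (Hp1 : 0 <= 2 * r * Bd * Rabs (y - x)) by (repeat apply Rmult_le_pos; lra).
    assert (Hp2 : 0 <= gamma * force_max * Rabs (y - x)) by (repeat apply Rmult_le_pos; lra).
    destruct (Nat.eqb_spec j 0) as [E|E].
    - rewrite <- Rmult_minus_distr_l, Rabs_mult, (Rabs_pos_eq gamma) by lra.
      assert (H := action_lipschitz I phi a 0 HW ltac:(lia) ltac:(lia) x y Hx Hy).
      assert (gamma * Rabs (I y 0%nat - I x 0%nat) <= gamma * (force_max * Rabs (y - x)))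
        by (apply Rmult_le_compat_l; lra). lra.
    - assert (H := tension_lipschitz I phi a (j - 1) HW ltac:(lia) x y Hx Hy).
      unfold tension in H. replace (S (j - 1)) with j in H by lia. lra. }
  apply Rabs_le_between in A1. apply Rabs_le_between in A2. apply Rabs_le_between.
  unfold force_lip. lra.
Qed.

Lemma tension'_lipschitz I phi a j : window I phi a -> (S j < kap)%nat ->
  forall x y, a <= x <= a + 1 -> a <= y <= a + 1 ->
  Rabs (tension' I phi j y - tension' I phi j x) <= tension_lip * Rabs (y - x).
Proof.
  intros HW Hj. assert (HKf := Kf_pos).
  assert (HF := finite_modes_Derive _ (finite_modes_Derive _ (HUm j ltac:(lia)))).
  apply (is_derive_lipschitz (tension' I phi j) (fun x =>
    Derive (Derive (Derive (U j))) (phi x (S j) - phi x j) * (I x (S j) - I x j) * (I x (S j) - I x j)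
    + Derive (Derive (U j)) (phi x (S j) - phi x j) * (force (I x) (phi x) (S j) - force (I x) (phi x) j))).
  - intros x Hx. destruct (HW x Hx) as [HI [Hphi _]].
    apply (is_derive_Rmult (fun s => Derive (Derive (U j)) (phi s (S j) - phi s j))
      (fun s => I s (S j) - I s j)).
    + apply (is_derive_bond I phi); [lia| |easy]. apply finite_modes_ex_derive; easy.
    + apply (is_derive_minus (K := R_AbsRing) (V := R_NormedModule)
        (fun s => I s (S j)) (fun s => I s j)); apply HI; lia.
  - intros x Hx. destruct (HW x Hx) as [_ [_ Hs]].
    assert (D1 := slow_difference I phi a j x HW Hj Hx).
    assert (D2 : Rabs (force (I x) (phi x) (S j) - force (I x) (phi x) j) <= 2 * force_max).
    { eapply Rle_trans; [apply Rabs_triang|]. rewrite Rabs_Ropp.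
      assert (H0 : Rabs (I x 0%nat) <= r) by (apply Hs; lia).
      generalize (force_bound (I x) (phi x) (S j) ltac:(lia) H0)
        (force_bound (I x) (phi x) j ltac:(lia) H0). lra. }
    destruct (Hbound j ltac:(lia) (phi x (S j) - phi x j)) as [_ [B2 B3]].
    eapply Rle_trans; [apply Rabs_triang|]. unfold tension_lip. apply Rplus_le_compat.
    + rewrite !Rabs_mult.
      replace (Bd * (4 * r * r)) with (Bd * (2 * r) * (2 * r)) by ring.
      repeat apply Rmult_le_compat; try apply Rabs_pos; try easy.
      apply Rmult_le_pos; apply Rabs_pos.
    + rewrite Rabs_mult. apply Rmult_le_compat; try apply Rabs_pos; easy.
Qed.

(** Two interpolations per site. A small I_j has a small derivative, the force; friction or the
    preceding tension being small, so is tension j. Its derivative U_j'' (I_(j+1) - I_j) is then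
    small as well, and small tension means stiffness at least [cnd], so I_(j+1) is small. *)
Lemma quiet_chain j : (S j <= kap)%nat -> forall eta, 0 < eta -> exists eps, 0 < eps /\
  forall I phi a, window I phi a -> (forall x, a <= x <= a + 1 -> Rabs (I x 0%nat) <= eps) ->
  forall x, a <= x <= a + 1 ->
    Rabs (I x j) <= eta /\ forall i, (i < j)%nat -> Rabs (tension phi i x) <= eta.
Proof.
  assert (HKf := Kf_pos).
  assert (HK1 : 0 <= force_lip).
  { unfold force_lip. apply Rplus_le_le_0_compat; repeat apply Rmult_le_pos; lra. }
  assert (HK2 : 0 <= tension_lip).
  { unfold tension_lip. apply Rplus_le_le_0_compat; repeat apply Rmult_le_pos; lra. }
  induction j as [|j IH]; intros Hj eta Heta.
  - exists eta. split; [easy|]. intros I phi a _ H x Hx. split; [apply H; easy|]. intros; lia.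
  - destruct (small_derivative tension_lip (cnd * eta / 4) HK2) as [e2 [He2 L2]].
    { apply Rdiv_lt_0_compat; [apply Rmult_lt_0_compat; easy|lra]. }
    set (eta2 := Rmin e2 (Rmin (cnd / 2) eta)).
    assert (Heta2 : 0 < eta2) by (repeat apply Rmin_glb_lt; lra).
    assert (Hm1 : eta2 <= e2) by apply Rmin_l.
    assert (Hm2 : eta2 <= cnd / 2) by (eapply Rle_trans; [apply Rmin_r|apply Rmin_l]).
    assert (Hm3 : eta2 <= eta) by (eapply Rle_trans; [apply Rmin_r|apply Rmin_r]).
    (* Tension j is at most the force, eta1, plus the backward part, eta1 + gamma eta1; together
       this stays below eta2. *)
    set (eta1 := eta2 / (3 + gamma)).
    assert (Heta1 : 0 < eta1) by (apply Rdiv_lt_0_compat; lra).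
    assert (E1 : eta2 = 3 * eta1 + gamma * eta1) by (unfold eta1; field; lra).
    assert (Hge : 0 < gamma * eta1) by (apply Rmult_lt_0_compat; easy).
    destruct (small_derivative force_lip eta1 HK1 Heta1) as [e1 [He1 L1]].
    destruct (IH ltac:(lia) e1 ltac:(lra)) as [e0 [He0 L0]].
    exists (Rmin e0 e1). split; [apply Rmin_glb_lt; lra|].
    intros I phi a HW Hquiet.
    assert (Hq0 : forall x, a <= x <= a + 1 -> Rabs (I x 0%nat) <= e0).
    { intros x Hx. eapply Rle_trans; [apply Hquiet; easy|apply Rmin_l]. }
    assert (Hq1 : forall x, a <= x <= a + 1 -> Rabs (I x 0%nat) <= e1).
    { intros x Hx. eapply Rle_trans; [apply Hquiet; easy|apply Rmin_r]. }
    specialize (L0 I phi a HW Hq0).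
    assert (Hforce : forall x, a <= x <= a + 1 -> Rabs (force (I x) (phi x) j) <= eta1).
    { apply (L1 (fun s => I s j) (fun s => force (I s) (phi s) j) a).
      - intros x Hx. apply (HW x Hx); lia.
      - intros x y Hx Hy. apply (force_lipschitz I phi a); try easy.
      - intros x Hx. apply L0; easy. }
    assert (Htens : forall x, a <= x <= a + 1 -> Rabs (tension phi j x) <= eta2).
    { intros x Hx. specialize (Hforce x Hx). unfold force in Hforce.
      rewrite (proj2 (Nat.ltb_lt j (n - 1))) in Hforce by lia.
      fold (tension phi j x) in Hforce.
      assert (A : Rabs (if Nat.eqb j 0 then gamma * I x 0%nat
        else Derive (U (j - 1)%nat) (phi x j - phi x (j - 1)%nat)) <= eta1 + gamma * eta1).
      { destruct (Nat.eqb_spec j 0) as [E|E].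
        - rewrite Rabs_mult, (Rabs_pos_eq gamma) by lra.
          assert (gamma * Rabs (I x 0%nat) <= gamma * eta1); [|lra].
          apply Rmult_le_compat_l; [lra|]. specialize (Hq1 x Hx). lra.
        - destruct (L0 x Hx) as [_ Ht]. specialize (Ht (j - 1)%nat ltac:(lia)).
          unfold tension in Ht. replace (S (j - 1)) with j in Ht by lia. lra. }
      apply Rabs_le_between in Hforce. apply Rabs_le_between in A. apply Rabs_le_between. lra. }
    assert (Htens' : forall x, a <= x <= a + 1 -> Rabs (tension' I phi j x) <= cnd * eta / 4).
    { apply (L2 (tension phi j) (tension' I phi j) a).
      - intros x Hx. apply (is_derive_tension I phi a); [easy|lia|easy].
      - intros x y Hx Hy. apply (tension'_lipschitz I phi a); try easy.
      - intros x Hx. specialize (Htens x Hx). lra. }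
    intros x Hx. specialize (Htens x Hx). destruct (L0 x Hx) as [HIj Hti]. split.
    + assert (Hstiff := Hgap j ltac:(lia) (phi x (S j) - phi x j)
        ltac:(fold (tension phi j x); lra)).
      specialize (Htens' x Hx). unfold tension' in Htens'. rewrite Rabs_mult in Htens'.
      assert (HD : Rabs (I x (S j) - I x j) <= eta / 4).
      { apply Rmult_le_reg_l with cnd; [easy|].
        apply Rle_trans with (cnd * eta / 4); [|lra]. eapply Rle_trans; [|exact Htens'].
        apply Rmult_le_compat_r; [apply Rabs_pos|easy]. }
      apply Rabs_le_between in HD. apply Rabs_le_between in HIj. apply Rabs_le_between. lra.
    + intros i Hi. destruct (Nat.eq_dec i j) as [->|Hne]; [lra|].
      specialize (Hti i ltac:(lia)). lra.
Qed.

Lemma quiet_stiff : (1 <= kap)%nat -> exists eps, 0 < eps /\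
  forall I phi a, window I phi a -> (forall x, a <= x <= a + 1 -> Rabs (I x 0%nat) <= eps) ->
  forall x, a <= x <= a + 1 -> forall i, (S i < kap)%nat ->
    cnd <= Rabs (Derive (Derive (U i)) (phi x (S i) - phi x i)).
Proof.
  intros Hk. destruct (quiet_chain (kap - 1) ltac:(lia) (cnd / 2) ltac:(lra)) as [eps [He H]].
  exists eps. split; [easy|]. intros I phi a HW Hq x Hx i Hi.
  destruct (H I phi a HW Hq x Hx) as [_ Ht]. specialize (Ht i ltac:(lia)).
  apply Hgap; [lia|]. unfold tension in Ht. lra.
Qed.

End Quiet.

(** * Dissipation *)

Lemma fprod_abs_ge m f c : 0 <= c -> (forall i, (i < m)%nat -> c <= Rabs (f i)) ->
  c ^ m <= Rabs (fprod m f).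
Proof.
  intros Hc. induction m as [|m IH]; intros H; simpl; [rewrite Rabs_R1; lra|].
  rewrite Rabs_mult, Rmult_comm. apply Rmult_le_compat; auto. apply pow_le; easy.
Qed.

Section Dissipation.
Variables n kap : nat.
Hypothesis Hkap : (kap < n)%nat.
Hypothesis Hkap1 : (1 <= kap)%nat.
Variable U : nat -> R -> R.
Variable UU : nat -> tpoly.
Hypothesis HUU : forall l t, In t (UU l) ->
  tm t = 0%Z /\ (forall j, ta t j = 0%nat) /\ (forall j, tq t j <> 0%Z -> j = l \/ j = S l).
Hypothesis HUUe : forall l I phi, (l < n - 1)%nat -> 0 < I kap ->
  peval n kap (UU l) I phi = U l (phi (S l) - phi l).
Hypothesis HUm : forall l, (l < n - 1)%nat -> finite_modes_no_const (U l).
Hypothesis HUn : forall l, (l < n - 1)%nat -> nondegenerate (U l).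
Variable gamma : R.
Hypothesis Hgamma : 0 < gamma.
Variable r : R.
Hypothesis Hr : 0 < r.

Local Notation eval := (peval n kap).
Local Notation Hp := (ham_fast ++ Pp n kap UU).

(** The angle of the fast bond turns at a speed between L/2 and 2 L. In time 8 pi / L it makes at
    least two turns, so it meets the interval around xi, and it needs at least w / L to traverse its
    width 2 w. *)
Lemma fast_crossing I phi T L xi w p tau :
  solves n U gamma I phi T -> 0 <= p -> p + tau <= T -> 4 * r <= L -> 0 < w <= 1 ->
  8 * PI / L <= tau ->
  (forall x, p <= x <= p + tau -> nearB_weak n kap L r (I x)) ->
  exists x1 (z : Z), p <= x1 /\ x1 + w / L <= p + tau /\ forall x, x1 <= x <= x1 + w / L ->
    xi - w <= phi x kap - phi x (kap - 1)%nat + 2 * PI * IZR z <= xi + w.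
Proof.
  intros Hsol Hp0 HpT HL Hw Htau Hnear. assert (HP := PI_RGT_0). assert (HP3 := PI2_3_2).
  assert (HL0 : 0 < L) by lra.
  set (psi := fun x => phi x kap - phi x (kap - 1)%nat).
  assert (Htau0 : 0 < tau).
  { eapply Rlt_le_trans; [|exact Htau]. apply Rdiv_lt_0_compat; lra. }
  assert (Hd : forall x, p <= x <= p + tau -> is_derive psi x (I x kap - I x (kap - 1)%nat)).
  { intros x Hx.
    apply (is_derive_minus (K := R_AbsRing) (V := R_NormedModule)
      (fun s => phi s kap) (fun s => phi s (kap - 1)%nat));
      apply (solves_force n U HUm gamma I phi T x); (lra || lia || easy). }
  assert (Hspeed : forall x, p <= x <= p + tau -> L / 2 <= I x kap - I x (kap - 1)%nat <= 2 * L).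
  { intros x Hx. assert (H1 := nearB_weak_J n kap Hkap L r _ (Hnear x Hx)).
    assert (H2 := nearB_weak_slow n kap L r _ (kap - 1)%nat (Hnear x Hx) ltac:(lia) ltac:(lia)).
    apply Rabs_le_between in H1. apply Rabs_le_between in H2. lra. }
  assert (Hincr : forall x y, p <= x -> x <= y -> y <= p + tau ->
    L / 2 * (y - x) <= psi y - psi x <= 2 * L * (y - x)).
  { intros x y Hx Hxy Hy.
    destruct (mean_value psi _ p (p + tau) x y ltac:(lra) ltac:(lra) Hd) as [z [Hz [_ ->]]].
    specialize (Hspeed z Hz). split; apply Rmult_le_compat_r; lra. }
  destruct (shift_into_period (xi - w) (psi p)) as [z Hz].
  set (y := xi - w + 2 * PI * IZR z) in *.
  assert (Hend : psi p + 4 * PI <= psi (p + tau)).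
  { assert (H := Hincr p (p + tau) ltac:(lra) ltac:(lra) ltac:(lra)).
    assert (4 * PI <= L / 2 * tau); [|replace (p + tau - p) with tau in H by ring; lra].
    apply Rle_trans with (L / 2 * (8 * PI / L)); [right; field; lra|].
    apply Rmult_le_compat_l; lra. }
  destruct (f_interv_is_interv psi p (p + tau) y) as [x1 [Hx1 E1]]; [lra|lra| |].
  { intros x Hx.
    apply continuity_pt_filterlim, (ex_derive_continuous (K := R_AbsRing) (V := R_NormedModule)).
    eexists. apply Hd; easy. }
  (* The entry point was chosen in the first turn, so a full turn remains. It takes at least pi / L,
     and w <= 1 < pi. *)
  assert (Hroom : x1 + w / L <= p + tau).
  { assert (H := Hincr x1 (p + tau) ltac:(lra) ltac:(lra) ltac:(lra)).
    assert (Hx : PI / L <= p + tau - x1).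
    { apply Rmult_le_reg_l with (2 * L); [lra|].
      replace (2 * L * (PI / L)) with (2 * PI) by (field; lra). lra. }
    assert (w / L <= PI / L); [|lra].
    apply Rmult_le_compat_r; [left; apply Rinv_0_lt_compat; lra|lra]. }
  exists x1, (- z)%Z. split; [lra|]. split; [easy|]. intros x Hx.
  assert (H := Hincr x1 x ltac:(lra) ltac:(lra) ltac:(lra)).
  assert (2 * L * (x - x1) <= 2 * w).
  { apply Rle_trans with (2 * L * (w / L)); [apply Rmult_le_compat_l; lra|right; field; lra]. }
  assert (0 <= L / 2 * (x - x1)) by (apply Rmult_le_pos; lra).
  change (phi x kap - phi x (kap - 1)%nat) with (psi x). rewrite opp_IZR.
  unfold y in E1. lra.
Qed.

Lemma bounds_exist : exists Bd, 0 < Bd /\ forall l, (l < n - 1)%nat -> forall x,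
  Rabs (Derive (U l) x) <= Bd /\ Rabs (Derive (Derive (U l)) x) <= Bd /\
  Rabs (Derive (Derive (Derive (U l))) x) <= Bd.
Proof.
  (* [uniform_constant] merges constants by shrinking them, so upper bounds are written as
     inverses. *)
  destruct (uniform_constant (fun l c => forall x,
    Rabs (Derive (U l) x) <= / c /\ Rabs (Derive (Derive (U l)) x) <= / c /\
    Rabs (Derive (Derive (Derive (U l))) x) <= / c) (n - 1)) as [c [Hc H]].
  - intros l c c' H Hc x. destruct (H x) as [H1 [H2 H3]].
    assert (/ c <= / c') by (apply Rinv_le_contravar; lra). lra.
  - intros l Hl. assert (F1 := finite_modes_Derive _ (HUm l Hl)).
    assert (F2 := finite_modes_Derive _ F1). assert (F3 := finite_modes_Derive _ F2).
    destruct (finite_modes_bound _ F1) as [B1 [HB1 HB1']].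
    destruct (finite_modes_bound _ F2) as [B2 [HB2 HB2']].
    destruct (finite_modes_bound _ F3) as [B3 [HB3 HB3']].
    exists (/ (1 + B1 + B2 + B3)). split; [apply Rinv_0_lt_compat; lra|].
    intros x. rewrite Rinv_inv. specialize (HB1' x). specialize (HB2' x). specialize (HB3' x). lra.
  - exists (/ c). split; [apply Rinv_0_lt_compat; easy|exact H].
Qed.

(** In the quiet case about L crossings each keep |I_0| above a multiple of L^(1 - 2 kap) for a time
    of order 1/L, which dissipates L^(2 - 4 kap) in total. Otherwise the loss is of order one, more
    than required. *)
Lemma window_dissipation : exists C L2, 0 < C /\ 1 <= L2 /\ forall L, L2 <= L ->
  forall I phi T a, solves n U gamma I phi T -> 0 <= a -> a + 1 <= T ->
  (forall x, a <= x <= a + 1 -> nearB_weak n kap L r (I x)) ->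
  eval Hp (I (a + 1)) (phi (a + 1)) <= eval Hp (I a) (phi a) - C / L ^ (4 * kap - 2).
Proof.
  assert (HP := PI_RGT_0).
  destruct bounds_exist as [Bd [HBd Hbound]].
  destruct (uniform_constant (fun l c => forall x,
    Rabs (Derive (U l) x) < c -> c <= Rabs (Derive (Derive (U l)) x)) (n - 1)) as [cnd [Hcnd Hgap]].
  { intros l c c' H Hc x Hx. specialize (H x ltac:(lra)). lra. }
  { intros l Hl. apply nondegenerate_gap; auto. }
  destruct (stiff_interval (U (kap - 1)%nat)) as [xi [w [c0 [Hw [Hc0 Hstiff]]]]];
    [apply HUm; lia|apply HUn; lia|].
  destruct (quiet_stiff n kap Hkap U HUm gamma Hgamma r Bd cnd Hr HBd Hbound Hcnd Hgap Hkap1)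
    as [eps [Heps Hquiet]].
  destruct (flow_iter_top n kap Hkap Hkap1 U UU HUU HUUe HUm gamma r) as [CB [HCB Htop]].
  destruct (antiderivative_of_large (2 * kap)) as [cM [HcM Hanti]].
  assert (HKf := Kf_pos gamma Hgamma r Bd Hr HBd). set (K := force_max gamma r Bd) in *.
  (* The product of the stiffnesses is at least 4 c6: [cnd] for each slow bond and c0 for the fast
     one. One factor 2 is spent on J >= L/2 and one on absorbing the remainder CB <= c6 L. *)
  set (c6 := cnd ^ (kap - 1) * c0 / 4).
  assert (Hcp : 0 < cnd ^ (kap - 1)) by (apply pow_lt; easy).
  assert (Hc6 : 0 < c6) by (unfold c6; apply Rdiv_lt_0_compat; [apply Rmult_lt_0_compat; easy|lra]).
  set (c7 := cM * c6 * w ^ (2 * kap)).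
  assert (Hwp : 0 < w ^ (2 * kap)) by (apply pow_lt; lra).
  assert (Hc7 : 0 < c7) by (unfold c7; repeat apply Rmult_lt_0_compat; lra).
  (* Forces are at most K, so |I_0| > eps at one point stays above eps / 2 for a time l0; l0 <= 1/2
     fits this interval into the window. *)
  set (l0 := Rmin (1 / 2) (eps / (2 * K))).
  assert (Hl0 : 0 < l0) by (apply Rmin_glb_lt; [lra|apply Rdiv_lt_0_compat; lra]).
  set (Ca := gamma * (eps / 2) ^ 2 * l0).
  assert (HCa : 0 < Ca).
  { unfold Ca. apply Rmult_lt_0_compat; [apply Rmult_lt_0_compat; [easy|apply pow_lt; lra]|easy]. }
  set (Cb := gamma * c7 ^ 2 * (cM * w) / (16 * PI)).
  assert (HCb : 0 < Cb).
  { unfold Cb. apply Rdiv_lt_0_compat; [|lra].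
    apply Rmult_lt_0_compat; [|apply Rmult_lt_0_compat; lra].
    apply Rmult_lt_0_compat; [lra|apply pow_lt; easy]. }
  exists (Rmin Ca Cb), (1 + 4 * r + 16 * PI + CB / c6).
  assert (HCBc : 0 <= CB / c6) by (apply Rmult_le_pos; [easy|left; apply Rinv_0_lt_compat; easy]).
  split; [apply Rmin_glb_lt; easy|]. split; [lra|].
  intros L HL I phi T a Hsol Ha HaT Hnear.
  assert (HL1 : 1 <= L) by lra.
  assert (HJ : forall x, a <= x <= a + 1 -> L / 2 <= I x kap /\ 1 <= I x kap).
  { intros x Hx. assert (H := nearB_weak_J n kap Hkap L r _ (Hnear x Hx)).
    apply Rabs_le_between in H. lra. }
  assert (Hslow : forall x, a <= x <= a + 1 -> forall j, (j < n)%nat -> j <> kap -> Rabs (I x j) <= r).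
  { intros x Hx j Hj Hne. apply (nearB_weak_slow n kap L r); auto. }
  assert (HW : window n kap U gamma r I phi a).
  { intros x Hx. split; [|split].
    - intros j Hj. apply (solves_force n U HUm gamma I phi T x); [easy|lra|easy].
    - intros j Hj. apply (solves_force n U HUm gamma I phi T x); [easy|lra|easy].
    - apply Hslow; easy. }
  set (E := fun s => eval Hp (I s) (phi s)).
  assert (HE : forall s, a <= s <= a + 1 -> is_derive E s (- gamma * I s 0%nat ^ 2)).
  { intros s Hs. apply (energy_derive n kap Hkap U UU HUUe gamma I phi T Hsol); [lra|].
    specialize (HJ s Hs). lra. }
  change (E (a + 1) <= E a - Rmin Ca Cb / L ^ (4 * kap - 2)).
  set (Q := L ^ (4 * kap - 2)).
  assert (HQ : 1 <= Q) by (apply pow_R1_Rle; easy).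
  destruct (classic (forall x, a <= x <= a + 1 -> Rabs (I x 0%nat) <= eps)) as [Hq|Hq].
  - specialize (Hquiet I phi a HW Hq).
    (* The window is cut into N equal pieces, each long enough for one crossing. As L / (8 pi) >= 2,
       rounding down costs at most a factor 2, the origin of 16 pi in Cb. *)
    destruct (nfloor_ex (L / (8 * PI))) as [N [HN1 HN2]].
    { apply Rmult_le_pos; [lra|left; apply Rinv_0_lt_compat; lra]. }
    assert (HL8 : L = L / (8 * PI) * (8 * PI)) by (field; lra).
    assert (HN3 : 2 <= L / (8 * PI)) by nra.
    assert (HNpos : 1 < INR N) by lra.
    set (tau := / INR N).
    assert (Htau : 8 * PI / L <= tau).
    { unfold tau. replace (8 * PI / L) with (/ (L / (8 * PI))) by (field; lra).
      apply Rinv_le_contravar; lra. }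
    assert (HNtau : INR N * tau = 1) by (unfold tau; field; lra).
    set (mu := c7 / L ^ (2 * kap - 1)).
    assert (HLp : 0 < L ^ (2 * kap - 1)) by (apply pow_lt; lra).
    assert (Hmu : 0 < mu) by (apply Rdiv_lt_0_compat; easy).
    set (d := gamma * mu ^ 2 * (cM * (w / L))).
    assert (Hpiece : forall p, a <= p -> p + tau <= a + 1 -> E (p + tau) <= E p - d).
    { intros p Hp1 Hp2.
      assert (Htau0 : 0 < tau) by (unfold tau; apply Rinv_0_lt_compat; lra).
      destruct (fast_crossing I phi T L xi w p tau Hsol ltac:(lra) ltac:(lra) ltac:(lra) Hw Htau)
        as [x1 [z [Hx1 [Hx2 Hx3]]]].
      { intros x Hx. apply Hnear. lra. }
      assert (HwL : 0 < w / L) by (apply Rdiv_lt_0_compat; lra).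
      (* Integrating 2 kap times from size c6 L over length w / L gives cM c6 L (w / L)^(2 kap) = c7
         / L^(2 kap - 1), which is mu. *)
      destruct (Hanti (fun m x => eval (flow_iter n kap UU gamma m) (I x) (phi x)) x1 (w / L) (c6 * L))
        as [v [Hv1 [Hv2 Hv3]]].
      - easy.
      - apply Rmult_lt_0_compat; lra.
      - intros j x _ Hx. apply (flow_iter_derive n kap Hkap Hkap1 U UU HUUe gamma I phi T); [easy|lra|].
        specialize (HJ x ltac:(lra)). lra.
      - intros x Hx. destruct (HJ x ltac:(lra)) as [HJ1 HJ2].
        specialize (Htop (I x) (phi x) HJ2 (Hslow x ltac:(lra))).
        set (A := fprod kap (fun i => Derive (Derive (U i)) (phi x (S i) - phi x i))) in *.
        assert (HA : 4 * c6 <= Rabs A).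
        { unfold A. replace kap with (S (kap - 1)) at 1 by lia. cbn [fprod].
          rewrite Rabs_mult. replace (4 * c6) with (cnd ^ (kap - 1) * c0) by (unfold c6; field).
          apply Rmult_le_compat; [lra|lra| |].
          - apply fprod_abs_ge; [lra|]. intros i Hi. apply Hquiet; [lra|lia].
          - replace (S (kap - 1)) with kap by lia.
            rewrite <- (period_Z (Derive (Derive (U (kap - 1)%nat)))
              (finite_modes_period _ (finite_modes_Derive _ (finite_modes_Derive _ (HUm (kap - 1)%nat ltac:(lia))))) z).
            apply Hstiff, Hx3; lra. }
        assert (HAJ : 2 * c6 * L <= Rabs (A * I x kap)).
        { rewrite Rabs_mult, (Rabs_pos_eq (I x kap)) by lra.
          apply Rle_trans with (4 * c6 * (L / 2)); [right; field|].
          apply Rmult_le_compat; lra. }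
        assert (HCBL : CB <= c6 * L).
        { apply Rmult_le_reg_r with (/ c6); [apply Rinv_0_lt_compat; easy|].
          replace (c6 * L * / c6) with L by (field; lra). unfold Rdiv in HL. lra. }
        set (F := eval (flow_iter n kap UU gamma (2 * kap)) (I x) (phi x)) in *.
        generalize (Rabs_triang F (A * I x kap - F)). rewrite (Rabs_minus_sym _ F).
        replace (F + (A * I x kap - F)) with (A * I x kap) by ring. lra.
      - assert (Hmu' : forall x, v <= x <= v + cM * (w / L) -> mu <= Rabs (I x 0%nat)).
        { intros x Hx. specialize (Hv3 x Hx). cbn [flow_iter Nat.iter] in Hv3.
          change (flow_iter n kap UU gamma 0) with (action 0) in Hv3.
          rewrite eval_action in Hv3.
          - eapply Rle_trans; [|exact Hv3]. right. unfold mu, c7.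
            unfold Rdiv. rewrite Rpow_mult_distr, pow_inv.
            replace (L ^ (2 * kap)) with (L * L ^ (2 * kap - 1)).
            + field. lra.
            + replace (2 * kap)%nat with (S (2 * kap - 1)) at 2 by lia. easy.
          - lia.
          - lia.
          - assert (HcMw : cM * (w / L) <= w / L) by (rewrite <- (Rmult_1_l (w / L)) at 2; apply Rmult_le_compat_r; lra).
            specialize (HJ x ltac:(lra)). lra. }
        assert (HcMw : 0 < cM * (w / L)) by (apply Rmult_lt_0_compat; lra).
        assert (H := dissipated_energy E (fun s => I s 0%nat) gamma p (p + tau) v (v + cM * (w / L)) mu
          Hgamma ltac:(lra) ltac:(lra) ltac:(lra) ltac:(lra)
          (fun s Hs => HE s (conj (Rle_trans _ _ _ Hp1 (proj1 Hs)) (Rle_trans _ _ _ (proj2 Hs) Hp2))) Hmu').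
        replace (v + cM * (w / L) - v) with (cM * (w / L)) in H by ring. exact H. }
    assert (Hit := iterated_decrease E a tau d N).
    assert (Hit' : E (a + INR N * tau) <= E a - INR N * d).
    { apply Hit. intros i Hi. rewrite S_INR.
      replace (a + (INR i + 1) * tau) with (a + INR i * tau + tau) by ring.
      assert (Hi' : INR i + 1 <= INR N) by (rewrite <- S_INR; apply le_INR; lia).
      assert (Htau0 : 0 < tau) by (unfold tau; apply Rinv_0_lt_compat; lra).
      assert (0 <= INR i * tau) by (apply Rmult_le_pos; [apply pos_INR|lra]).
      assert ((INR i + 1) * tau <= INR N * tau) by (apply Rmult_le_compat_r; lra).
      apply Hpiece; lra. }
    rewrite HNtau in Hit'.
    assert (Hfin : Rmin Ca Cb / Q <= INR N * d); [|lra].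
    apply Rle_trans with (Cb / Q).
    { apply Rmult_le_compat_r; [left; apply Rinv_0_lt_compat; lra|apply Rmin_r]. }
    assert (HNL : L / (16 * PI) <= INR N).
    { replace (L / (16 * PI)) with (L / (8 * PI) / 2) by (field; lra). lra. }
    apply Rle_trans with (L / (16 * PI) * d).
    + right. unfold d, mu, Cb.
      replace Q with (L ^ (2 * kap - 1) * L ^ (2 * kap - 1)).
      * field. lra.
      * unfold Q. rewrite <- pow_add. f_equal. lia.
    + apply Rmult_le_compat_r; [|easy]. unfold d.
      apply Rmult_le_pos; [apply Rmult_le_pos; [lra|apply pow2_ge_0]|].
      apply Rmult_le_pos; [lra|left; apply Rdiv_lt_0_compat; lra].
  - apply not_all_ex_not in Hq. destruct Hq as [x Hq]. apply imply_to_and in Hq.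
    destruct Hq as [Hx Hq]. apply Rnot_le_lt in Hq.
    assert (Hl1 : l0 <= 1 / 2) by apply Rmin_l.
    assert (Hl2 : l0 <= eps / (2 * K)) by apply Rmin_r.
    assert (HKl : K * l0 <= eps / 2).
    { apply Rle_trans with (K * (eps / (2 * K))); [apply Rmult_le_compat_l; lra|right; field; lra]. }
    assert (Hint : exists x1, a <= x1 /\ x1 + l0 <= a + 1 /\ x1 <= x <= x1 + l0).
    { destruct (Rle_or_lt x (a + 1 / 2)).
      - exists x. lra.
      - exists (x - l0). lra. }
    destruct Hint as [x1 [Hx1 [Hx2 Hx3]]].
    assert (Hlow : forall s, x1 <= s <= x1 + l0 -> eps / 2 <= Rabs (I s 0%nat)).
    { intros s Hs.
      assert (HLip := action_lipschitz n kap Hkap U gamma Hgamma r Bd Hr HBd Hbound I phi a 0 HW Hkap1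
        ltac:(lia) x s ltac:(lra) ltac:(lra)). fold K in HLip.
      assert (Hsx : Rabs (s - x) <= l0) by (apply Rabs_le; lra).
      assert (K * Rabs (s - x) <= K * l0) by (apply Rmult_le_compat_l; lra).
      generalize (Rabs_triang (I s 0%nat) (I x 0%nat - I s 0%nat)).
      replace (I s 0%nat + (I x 0%nat - I s 0%nat)) with (I x 0%nat) by ring.
      rewrite (Rabs_minus_sym (I x 0%nat)). lra. }
    assert (H := dissipated_energy E (fun s => I s 0%nat) gamma a (a + 1) x1 (x1 + l0) (eps / 2)
      Hgamma ltac:(lra) ltac:(lra) ltac:(lra) ltac:(lra) HE Hlow).
    replace (x1 + l0 - x1) with l0 in H by ring. fold Ca in H.
    assert (Rmin Ca Cb / Q <= Ca); [|lra].
    apply Rle_trans with (Ca / Q).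
    + apply Rmult_le_compat_r; [left; apply Rinv_0_lt_compat; lra|apply Rmin_l].
    + apply Rmult_le_reg_r with Q; [lra|]. unfold Rdiv. rewrite Rmult_assoc, Rinv_l by lra. nra.
Qed.

End Dissipation.

(** * Summing the losses of unit windows *)

Theorem theorem2p4 (n k : nat) (hn : (2 <= n)%nat) (hk : (2 <= k <= n)%nat)
  (U : nat -> R -> R)
  (hU : forall i, (i < n - 1)%nat -> finite_modes_no_const (U i) /\ nondegenerate (U i))
  (gamma : R) (hgamma : 0 < gamma)
  (alpha rho : R) (halpha : 0 < alpha) (hrho : 0 < rho) :
  exists L0 rhos C1 : R, 0 < L0 /\ 0 < rhos /\ 0 < C1 /\
    forall L : R, L0 <= L ->
    forall I phi : R -> nat -> R,
      let T := alpha * L ^ (2 * k - 3) in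
      solves n U gamma I phi T ->
      inB n k L rho (I 0) ->
      (forall t, 0 <= t <= T -> inB n k L rhos (I t)) /\
      Ham n U (I T) (phi T) - Ham n U (I 0) (phi 0)
        <= - C1 * (T / L ^ (4 * k - 6)).
Proof.
  set (kap := (k - 1)%nat).
  assert (Hkap : (kap < n)%nat) by (unfold kap; lia).
  assert (Hkap1 : (1 <= kap)%nat) by (unfold kap; lia).
  (* The family of bond polynomials is indexed by all naturals; indices beyond the chain receive the
     empty list. *)
  assert (Hch : forall l, exists f : tpoly,
    (forall t, In t f -> tm t = 0%Z /\ (forall j, ta t j = 0%nat) /\
       (forall j, tq t j <> 0%Z -> j = l \/ j = S l)) /\
    (forall I phi, (l < n - 1)%nat -> 0 < I kap -> peval n kap f I phi = U l (phi (S l) - phi l))).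
  { intros l. destruct (Nat.lt_ge_cases l (n - 1)) as [Hl|Hl].
    - destruct (hU l Hl) as [[M [a [b HM]]] _]. exists (bond_poly l M a b). split.
      + intros t; apply in_bond_poly.
      + intros I phi _ HJ. rewrite HM. apply eval_bond_poly; [lia|easy].
    - exists []. split; [easy|]. intros; lia. }
  destruct (functional_choice _ Hch) as [UU HUU0]. clear Hch.
  assert (HUU := fun l => proj1 (HUU0 l)).
  assert (HUUe := fun l I phi => proj2 (HUU0 l) I phi).
  assert (HUm := fun l Hl => proj1 (hU l Hl)). assert (HUn := fun l Hl => proj2 (hU l Hl)).
  destruct (stability n kap Hkap Hkap1 U UU HUU HUUe HUm gamma hgamma alpha rho halpha hrho)
    as [L1 [rs [HL1 [Hrs Hstab]]]].
  destruct (window_dissipation n kap Hkap Hkap1 U UU HUU HUUe HUm HUn gamma hgamma rs ltac:(lra))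
    as [C [L2 [HC [HL2 Hdiss]]]].
  (* The summand 1 / alpha forces T >= 1. Then at least T / 2 whole unit windows fit into [0, T],
     which halves C. *)
  exists (L1 + L2 + rs + / alpha), rs, (C / 2).
  assert (Hia : 0 < / alpha) by (apply Rinv_0_lt_compat; easy).
  split; [lra|]. split; [lra|]. split; [lra|].
  intros L HL I phi T Hsol Hinit.
  assert (ET : T = fast_time kap alpha L).
  { unfold T, fast_time. do 2 f_equal. unfold kap. lia. }
  assert (Hnear : forall t, 0 <= t <= T -> nearB n kap L rs (I t)).
  { rewrite ET in Hsol |- *. apply (Hstab L ltac:(lra) I phi Hsol). exact Hinit. }
  split; [exact Hnear|].
  replace (4 * k - 6)%nat with (4 * kap - 2)%nat by (unfold kap; lia).
  assert (HT1 : 1 <= T).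
  { rewrite ET. unfold fast_time. replace (2 * kap - 1)%nat with (S (2 * kap - 2)) by lia.
    cbn [pow]. rewrite <- (Rinv_r alpha) by lra. apply Rmult_le_compat_l; [lra|].
    apply Rle_trans with (L * 1); [lra|]. apply Rmult_le_compat_l; [lra|]. apply pow_R1_Rle; lra. }
  assert (HJ : forall t, 0 <= t <= T -> 0 < I t kap).
  { intros t Ht. assert (H := Hnear t Ht kap Hkap). rewrite Nat.eqb_refl in H.
    apply Rabs_def2 in H. lra. }
  destruct (nfloor_ex T) as [N [HN1 HN2]]; [lra|].
  set (E := fun s => peval n kap (ham_fast ++ Pp n kap UU) (I s) (phi s)).
  assert (Hit : E (0 + INR N * 1) <= E 0 - INR N * (C / L ^ (4 * kap - 2))).
  { apply iterated_decrease. intros i Hi. rewrite S_INR.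
    assert (Hi' : INR i + 1 <= INR N) by (rewrite <- S_INR; apply le_INR; lia).
    assert (Hi0 := pos_INR i).
    replace (0 + (INR i + 1) * 1) with (0 + INR i * 1 + 1) by ring.
    apply (Hdiss L ltac:(lra) I phi T); [easy|lra|lra|].
    intros x Hx. apply nearB_nearB_weak, Hnear. lra. }
  replace (0 + INR N * 1) with (INR N) in Hit by ring.
  assert (HN0 := pos_INR N).
  assert (Hlast : E T <= E (INR N)).
  (* The incomplete last window only needs monotonicity of the energy: the lower bound mu is 0, on
     an interval reduced to the point T. *)
  { assert (H := dissipated_energy E (fun s => I s 0%nat) gamma (INR N) T T T 0 hgamma
      ltac:(lra) HN1 ltac:(lra) ltac:(lra)).
    assert (E T <= E (INR N) - gamma * 0 ^ 2 * (T - T)); [|lra]. apply H.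
    - intros s Hs. apply (energy_derive n kap Hkap U UU HUUe gamma I phi T Hsol); [lra|].
      apply HJ; lra.
    - intros; apply Rabs_pos. }
  rewrite (Ham_eval n kap Hkap U UU HUUe (I T)) by (apply HJ; lra).
  rewrite (Ham_eval n kap Hkap U UU HUUe (I 0)) by (apply HJ; lra).
  fold (E T) (E 0).
  assert (HQ : 0 < C / L ^ (4 * kap - 2)) by (apply Rdiv_lt_0_compat; [easy|apply pow_lt; lra]).
  assert (T / 2 * (C / L ^ (4 * kap - 2)) <= INR N * (C / L ^ (4 * kap - 2))).
  { apply Rmult_le_compat_r; [lra|].
    assert (1 <= N)%nat.
    { apply INR_lt. simpl. lra. }
    apply le_INR in H. simpl in H. lra. }
  replace (- (C / 2) * (T / L ^ (4 * kap - 2))) with (- (T / 2 * (C / L ^ (4 * kap - 2)))).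
  - lra.
  - field. apply pow_nonzero. lra.
Qed.
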